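(* Let $w_1,w_2$ be two vertices of $\mathfrak G_n^B$ (resp. of $\mathfrak G_n^D$). Then $w_1\sim w_2$ if and only if $w_1\equiv w_2$ in $\mathfrak{Pl}(B_n)$ (resp. in $\mathfrak{Pl}(D_n)$).
   Context: Fix $n\ge2$; $\mathcal B_n=\{1\prec\cdots\prec n\prec0\prec\bar n\prec\cdots\prec\bar1\}$, $\mathcal D_n=\{1\prec\cdots\prec n-1\prec n,\bar n\prec\overline{n-1}\prec\cdots\prec\bar1\}$ ($n,\bar n$ incomparable); $\bar{\bar k}=k$, $\bar0=0$. Vector crystals: $\mathcal B_n$: $i\xrightarrow{i}i+1$, $\overline{i+1}\xrightarrow{i}\bar i$ ($i<n$), $n\xrightarrow{n}0\xrightarrow{n}\bar n$; $\mathcal D_n$: $i\xrightarrow{i}i+1$, $\overline{i+1}\xrightarrow{i}\bar i$ ($i<n$), $n-1\xrightarrow{n}\bar n$, $n\xrightarrow{n}\overline{n-1}$. Spin columns: sets of $n$ letters of $\mathcal D_n$ containing exactly one of $i,\bar i$ for each $i$. Spin crystals: $B(\Lambda_n^B)$ = all spin columns, with $\tilde f_n$ replacing $n$ by $\bar n$, and for $i<n$ $\tilde f_i$ replacing $i,\overline{i+1}$ by $i+1,\bar i$ ($0$ if impossible; $\tilde e_i$ the reverse); $B(\Lambda_n^D)$, $B(\Lambda_{n-1}^D)$ = spin columns with even, resp. odd, number of barred letters, same $\tilde f_i$ ($i<n$) and $\tilde f_n$ replacing $n-1,n$ by $\bar n,\overline{n-1}$. $\mathfrak G_n^B$ (resp.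 $\mathfrak G_n^D$) is the crystal on words over $\mathfrak B_n=\mathcal B_n\cup SP_n$ (resp. $\mathfrak D_n=\mathcal D_n\cup SP_n$), $SP_n$ the set of spin columns, words identified with tensors, tensor rule $\tilde f_i(u\otimes v)=\tilde f_iu\otimes v$ if $\varphi_i(u)>\varepsilon_i(v)$, else $u\otimes\tilde f_iv$; $\tilde e_i(u\otimes v)=u\otimes\tilde e_iv$ if $\varphi_i(u)<\varepsilon_i(v)$, else $\tilde e_iu\otimes v$. $w_1\sim w_2$ means the connected components of $w_1,w_2$ are isomorphic as colored graphs and $w_j=\tilde f_{i_1}\cdots\tilde f_{i_r}w_j^0$ ($j=1,2$) for the same $i_1,\dots,i_r$, $w_j^0$ the highest weight vertices. Weights: $\mathrm{wt}(i)=e_i$, $\mathrm{wt}(\bar i)=-e_i$, $\mathrm{wt}(0)=0$, $\mathrm{wt}(\mathfrak C)=\frac12(\sum_{i\in\mathfrak C}e_i-\sum_{\bar i\in\mathfrak C}e_i)$. For a letter $x$ and spin column $\mathfrak C$ with greatest letter $z$, $x\vartriangle\mathfrak C$ means $x\not\preceq z$. Columns: type $B$: letters of $\mathcal B_n$ strictly increasing except $0$ may repeat; type $D$: $x_1..x_l\in\mathcal D_n$ with $x_{i+1}\not\preceq x_i$; reading $x_1\cdots x_l$; $N(z)$ = number of letters $x$ with $x\preceq z$ or $x\succeq\bar z$; admissible: $l\le n$ and $N(z)\le z$ for all unbarred $z$ with $z,\bar z\in C$. $\mathfrak{Pl}(B_n)=\mathfrak B_n^*/\equiv$ where $\equiv$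 is the congruence generated by: (R1) $yzx\equiv yxz$, $xzy\equiv zxy$ ($x\prec y\prec z$, $x\ne\bar z$); (R2) for $x\prec y$, $x\ne\bar y$: $xyx\equiv xxy$ ($x\ne0$), $xyy\equiv yxy$ ($y\ne0$); (R3) for $1\prec x\preceq n$, $x\preceq y\preceq\bar x$: $y\overline{x-1}(x-1)\equiv yx\bar x$, $x\bar xy\equiv\overline{x-1}(x-1)y$; $0\bar nn\equiv\bar nn0$; (R4) $00x\equiv0x0$, $0\bar x0\equiv\bar x00$ ($x\preceq n$); (R5) for a non-admissible type $B$ column word $w$ all of whose proper factors are admissible: $w\equiv\tilde w$ where $\tilde w$ erases $z,\bar z$ for the lowest unbarred $z$ with $z,\bar z\in w$ and $N(z)>z$ if one exists, and erases a $0$ otherwise; (R6) $\mathfrak Cx\equiv\mathfrak C'$ when $x\vartriangle\mathfrak C$, with $\mathrm{wt}(\mathfrak C')=\mathrm{wt}(\mathfrak C)+\mathrm{wt}(x)$; (R7) $\mathfrak Cx\equiv x'\mathfrak C'$ when $x\not\vartriangle\mathfrak C$, with $x'=\min\{t\in\mathfrak C:t\succeq x\}$ if $x\succeq0$, $x'=\min(\{t\in\mathfrak C:t\succeq x\}\cup\{0\})$ if $x\preceq n$, and $\mathrm{wt}(\mathfrak C')=\mathrm{wt}(\mathfrak C)+\mathrm{wt}(x)-\mathrm{wt}(x')$; (R8) $S^B(\mathrm w(C))\equiv\mathrm w(C)$ for every admissible type $B$ column $C$, where $S^B$ is the crystal isomorphism from the union of the components of the empty word and of the words $12\cdots i$ ($1\le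 i\le n$) in $\mathfrak G_n^B$ onto $B(\Lambda_n^B)^{\otimes 2}$. $\mathfrak{Pl}(D_n)=\mathfrak D_n^*/\equiv$ with $\equiv$ generated by: (R1) $yzx\equiv yxz$ ($x\preceq y\prec z$, $x\neq\bar z$), $xzy\equiv zxy$ ($x\prec y\preceq z$, $x\ne\bar z$); (R2) for $1\prec x\prec n$, $x\preceq y\preceq\bar x$: $y\overline{x-1}(x-1)\equiv yx\bar x$, $x\bar xy\equiv\overline{x-1}(x-1)y$; (R3) for $x\preceq n-1$: $\bar n\bar xn\equiv\bar x\bar nn$, $n\bar x\bar n\equiv\bar xn\bar n$, $\bar nnx\equiv\bar nxn$, $n\bar nx\equiv nx\bar n$; (R4) $n\bar n\bar n\equiv\overline{n-1}(n-1)\bar n$, $\bar nnn\equiv\overline{n-1}(n-1)n$, $\bar n\overline{n-1}(n-1)\equiv\bar n\bar nn$, $n\overline{n-1}(n-1)\equiv nn\bar n$; (R5) for a non-admissible type $D$ column word $w$ with all proper factors admissible, with $z$ the lowest unbarred letter with $z,\bar z\in w$, $N(z)>z$: $w\equiv\tilde w$, erasing $z,\bar z$ if $z\prec n$, or a pair of consecutive letters $n,\bar n$ if $z=n$; (R6) $\mathfrak Cx\equiv\mathfrak C'$ if $x\vartriangle\mathfrak C$, $\mathrm{wt}(\mathfrak C')=\mathrm{wt}(\mathfrak C)+\mathrm{wt}(x)$; (R7) $\mathfrak Cx\equiv x'\mathfrak C'$ if $x\not\vartriangle\mathfrak C$, $x'=\min\{t\in\mathfrak C:t\succeq x\}$,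 $\mathrm{wt}(\mathfrak C')=\mathrm{wt}(\mathfrak C)+\mathrm{wt}(x)-\mathrm{wt}(x')$; (R8) $S_n^D(\mathrm w(C))\equiv\mathrm w(C)$ and $S_{n-1}^D(\mathrm w(C))\equiv\mathrm w(C)$ for admissible type $D$ columns $C$ in the respective domains, where $S_n^D$ is the crystal isomorphism from the union of the components of the empty word and of $12\cdots i$ ($1\le i\le n$) onto $B(\Lambda_n^D)\otimes(B(\Lambda_n^D)\cup B(\Lambda_{n-1}^D))$, and $S_{n-1}^D$ the one from the union of the components of the empty word, of $12\cdots i$ ($i<n$) and of $12\cdots(n-1)\bar n$ onto $B(\Lambda_{n-1}^D)\otimes(B(\Lambda_{n-1}^D)\cup B(\Lambda_n^D))$. *)

(* Defs.v *)
From HB Require Import structures.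
From mathcomp Require Import all_boot all_algebra.
From Stdlib Require Import Relations.
Set Implicit Arguments. Unset Strict Implicit. Unset Printing Implicit Defensive.
Import GRing.Theory Num.Theory.

Inductive ctype := TB | TD.

(* vector letters: Pos i = i, Zer = 0, Neg i = \bar i  (1 <= i <= n) *)
Inductive letter := Pos of nat | Zer | Neg of nat.

Definition letter_eqb (x y : letter) : bool :=
  match x, y with
  | Pos i, Pos j => i == j
  | Zer, Zer => true
  | Neg i, Neg j => i == j
  | _, _ => false
  end.

Lemma letter_eqP : Equality.axiom letter_eqb.
Proof.
case=> [i||i] [j||j] /=; try (by constructor);
  by apply: (iffP eqP) => [->|[]].
Qed.

HB.instance Definition _ := hasDecEq.Build letter letter_eqP.

(* letters of the words: vector letters and spin columns.
   A spin column is encoded by a boolean list C of size n: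
   nth false C (j-1) = true  iff  \bar j is in the column (else j is). *)
Inductive gletter := V of letter | S of seq bool.
Definition word := seq gletter.

Definition bar (x : letter) : letter :=
  match x with Pos i => Neg i | Zer => Zer | Neg i => Pos i end.

Definition valid_letter (t : ctype) (n : nat) (x : letter) : bool :=
  match x with
  | Pos i | Neg i => (0 < i <= n)
  | Zer => if t is TB then true else false
  end.

Definition valid_spin (n : nat) (C : seq bool) : bool := size C == n.

Definition valid_g (t : ctype) (n : nat) (g : gletter) : bool :=
  match g with V x => valid_letter t n x | S C => valid_spin n C end.

Definition valid_word (t : ctype) (n : nat) (w : word) : bool :=
  all (valid_g t n) w.

(* B_n : 1 < ... < n < 0 < \bar n < ... < \bar 1  (total)
   D_n : 1 < ... < n-1 < n, \bar n < \bar{n-1} < ... < \bar 1,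
         n and \bar n incomparable (both of rank n). *)
Definition rank (t : ctype) (n : nat) (x : letter) : nat :=
  match t, x with
  | TB, Pos i => i
  | TB, Zer => n.+1
  | TB, Neg i => (n.*2).+2 - i
  | TD, Pos i => i
  | TD, Zer => 0
  | TD, Neg i => n.*2 - i
  end.

Definition ltL (t : ctype) (n : nat) (x y : letter) : bool := rank t n x < rank t n y.
Definition leL (t : ctype) (n : nat) (x y : letter) : bool := (x == y) || ltL t n x y.

Definition in_spin (n : nat) (C : seq bool) (x : letter) : bool :=
  match x with
  | Pos j => (0 < j <= n) && ~~ nth false C j.-1
  | Neg j => (0 < j <= n) && nth false C j.-1
  | Zer => false
  end.

Definition spin_greatest (t : ctype) (n : nat) (C : seq bool) (z : letter) : Prop :=
  in_spin n C z /\ forall y, in_spin n C y -> leL t n y z.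

Definition tri (t : ctype) (n : nat) (x : letter) (C : seq bool) : Prop :=
  exists z, spin_greatest t n C z /\ ~~ leL t n x z.

(* ---------- weights (doubled, so that they are integral) ---------- *)
Local Open Scope ring_scope.
Definition wt2L (x : letter) (j : nat) : int :=
  match x with
  | Pos k => if k == j then 2 else 0
  | Zer => 0
  | Neg k => if k == j then - 2 else 0
  end.
(* 2 wt(C) = sum_{i in C} e_i - sum_{\bar i in C} e_i *)
Definition wt2S (C : seq bool) (j : nat) : int :=
  if nth false C j.-1 then - 1 else 1.
Local Close Scope ring_scope.

Definition fL (t : ctype) (n i : nat) (x : letter) : option letter :=
  match x with
  | Pos k =>
      if (0 < i < n) && (k == i) then Some (Pos i.+1)
      else if i == n then
        match t with
        | TB => if k == n then Some Zer else None
        | TD => if k == n.-1 then Some (Neg n)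
                else if k == n then Some (Neg n.-1) else None
        end
      else None
  | Zer => if t is TB then (if i == n then Some (Neg n) else None) else None
  | Neg k => if (0 < i < n) && (k == i.+1) then Some (Neg i) else None
  end.

Definition eL (t : ctype) (n i : nat) (x : letter) : option letter :=
  match x with
  | Pos k => if (0 < i < n) && (k == i.+1) then Some (Pos i) else None
  | Zer => if t is TB then (if i == n then Some (Pos n) else None) else None
  | Neg k =>
      if (0 < i < n) && (k == i) then Some (Neg i.+1)
      else if i == n then
        match t with
        | TB => if k == n then Some Zer else None
        | TD => if k == n then Some (Pos n.-1)
                else if k == n.-1 then Some (Pos n) else None
        end
      else None
  end.

Definition fS (t : ctype) (n i : nat) (C : seq bool) : option (seq bool) :=
  if 0 < i < n then
    (if ~~ nth false C i.-1 && nth false C i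
     then Some (set_nth false (set_nth false C i.-1 true) i false) else None)
  else if i == n then
    match t with
    | TB => if ~~ nth false C n.-1 then Some (set_nth false C n.-1 true) else None
    | TD => if ~~ nth false C n.-2 && ~~ nth false C n.-1
            then Some (set_nth false (set_nth false C n.-2 true) n.-1 true) else None
    end
  else None.

Definition eS (t : ctype) (n i : nat) (C : seq bool) : option (seq bool) :=
  if 0 < i < n then
    (if nth false C i.-1 && ~~ nth false C i
     then Some (set_nth false (set_nth false C i.-1 false) i true) else None)
  else if i == n then
    match t with
    | TB => if nth false C n.-1 then Some (set_nth false C n.-1 false) else None
    | TD => if nth false C n.-2 && nth false C n.-1
            then Some (set_nth false (set_nth false C n.-2 false) n.-1 false) else None
    end
  else None.

Definition fG (t : ctype) (n i : nat) (g : gletter) : option gletter :=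
  match g with
  | V x => omap V (fL t n i x)
  | S C => omap S (fS t n i C)
  end.

Definition eG (t : ctype) (n i : nat) (g : gletter) : option gletter :=
  match g with
  | V x => omap V (eL t n i x)
  | S C => omap S (eS t n i C)
  end.

Fixpoint cnt (h : gletter -> option gletter) (k : nat) (g : gletter) : nat :=
  match k with
  | 0 => 0
  | k.+1 => match h g with Some g' => (cnt h k g').+1 | None => 0 end
  end.

(* epsilon_i and phi_i of a letter (all i-strings have length <= 2) *)
Definition epsG (t : ctype) (n i : nat) (g : gletter) : nat := cnt (eG t n i) 4 g.
Definition phiG (t : ctype) (n i : nat) (g : gletter) : nat := cnt (fG t n i) 4 g.

(* ---------- crystal of words: w = x1 (x) (x2 (x) ( ... )) ---------- *)
(* (epsilon_i, phi_i) of a word, by Kashiwara's tensor product rule: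
   eps(u(x)v) = max(eps u, eps v - phi u + eps u),
   phi(u(x)v) = max(phi v, phi u + phi v - eps v) *)
Fixpoint epsphiW (t : ctype) (n i : nat) (w : word) : nat * nat :=
  match w with
  | [::] => (0, 0)
  | x :: v =>
      let ev := (epsphiW t n i v).1 in
      let pv := (epsphiW t n i v).2 in
      let eu := epsG t n i x in
      let pu := phiG t n i x in
      (maxn eu (ev + eu - pu), maxn pv (pu + pv - ev))
  end.

Definition epsW (t : ctype) (n i : nat) (w : word) : nat := (epsphiW t n i w).1.
Definition phiW (t : ctype) (n i : nat) (w : word) : nat := (epsphiW t n i w).2.

Fixpoint fW (t : ctype) (n i : nat) (w : word) : option word :=
  match w with
  | [::] => None
  | x :: v =>
      if epsW t n i v < phiG t n i x then omap (fun y => y :: v) (fG t n i x)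
      else omap (cons x) (fW t n i v)
  end.

Fixpoint eW (t : ctype) (n i : nat) (w : word) : option word :=
  match w with
  | [::] => None
  | x :: v =>
      if phiG t n i x < epsW t n i v then omap (cons x) (eW t n i v)
      else omap (fun y => y :: v) (eG t n i x)
  end.

Definition cstep (t : ctype) (n : nat) (u v : word) : Prop :=
  exists i, 0 < i <= n /\ (fW t n i u = Some v \/ eW t n i u = Some v).

Definition conn (t : ctype) (n : nat) : word -> word -> Prop :=
  clos_refl_trans word (cstep t n).

Definition highest (t : ctype) (n : nat) (w : word) : Prop :=
  forall i, 0 < i <= n -> eW t n i w = None.

Definition fpath (t : ctype) (n : nat) (js : seq nat) (w : word) : option word :=
  foldr (fun i ow => obind (fW t n i) ow) (Some w) js.

Definition comp_iso (t : ctype) (n : nat) (w1 w2 : word) : Prop :=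
  exists phi : word -> word,
    (forall u, conn t n w1 u -> conn t n w2 (phi u)) /\
    (forall u v, conn t n w1 u -> conn t n w1 v -> phi u = phi v -> u = v) /\
    (forall u', conn t n w2 u' -> exists u, conn t n w1 u /\ phi u = u') /\
    (forall i u v, 0 < i <= n -> conn t n w1 u -> conn t n w1 v ->
       (fW t n i u = Some v <-> fW t n i (phi u) = Some (phi v))).

Definition sim (t : ctype) (n : nat) (w1 w2 : word) : Prop :=
  comp_iso t n w1 w2 /\
  exists w10 w20 (js : seq nat),
    [/\ conn t n w1 w10, conn t n w2 w20, highest t n w10 & highest t n w20] /\
    [/\ all (fun i => 0 < i <= n) js,
        fpath t n js w10 = Some w1 & fpath t n js w20 = Some w2].

Definition colB (n : nat) (w : seq letter) : bool :=
  all (valid_letter TB n) w &&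
  sorted (fun x y => ltL TB n x y || ((x == Zer) && (y == Zer))) w.

Definition colD (n : nat) (w : seq letter) : bool :=
  all (valid_letter TD n) w && sorted (fun x y => ~~ leL TD n y x) w.

Definition Ncnt (t : ctype) (n : nat) (w : seq letter) (k : nat) : nat :=
  count (fun x => leL t n x (Pos k) || leL t n (Neg k) x) w.

Definition admissible (t : ctype) (n : nat) (w : seq letter) : Prop :=
  size w <= n /\
  forall k, 0 < k <= n -> Pos k \in w -> Neg k \in w -> Ncnt t n w k <= k.

Definition proper_factors_adm (t : ctype) (n : nat) (w : seq letter) : Prop :=
  forall a b c, w = a ++ b ++ c -> size b < size w -> admissible t n b.

Definition badz (t : ctype) (n : nat) (w : seq letter) (k : nat) : Prop :=
  [/\ 0 < k <= n, Pos k \in w, Neg k \in w & k < Ncnt t n w k].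

Definition lowest_badz (t : ctype) (n : nat) (w : seq letter) (k : nat) : Prop :=
  badz t n w k /\ forall k', k' < k -> ~ badz t n w k'.

Definition Vw (w : seq letter) : word := map V w.

Definition word12 (i : nat) : word := [seq V (Pos k) | k <- iota 1 i].

Definition in_comps (t : ctype) (n : nat) (seeds : word -> Prop) (w : word) : Prop :=
  exists u0, seeds u0 /\ conn t n u0 w.

Definition cryst_iso (t : ctype) (n : nat) (Dom Tgt : word -> Prop)
    (Sm : word -> word) : Prop :=
  [/\ forall u, Dom u -> Tgt (Sm u),
      forall u v, Dom u -> Dom v -> Sm u = Sm v -> u = v,
      forall v, Tgt v -> exists u, Dom u /\ Sm u = v &
      forall i u, 0 < i <= n -> Dom u ->
        fW t n i (Sm u) = omap Sm (fW t n i u) /\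
        eW t n i (Sm u) = omap Sm (eW t n i u)].

Definition seedsB (n : nat) (w : word) : Prop :=
  w = [::] \/ exists i, 0 < i <= n /\ w = word12 i.
Definition tgtB (n : nat) (w : word) : Prop :=
  exists C1 C2, [/\ w = [:: S C1; S C2], size C1 = n & size C2 = n].

Definition nbars (C : seq bool) : nat := count id C.
Definition seedsDn (n : nat) (w : word) : Prop :=
  w = [::] \/ exists i, 0 < i <= n /\ w = word12 i.
Definition seedsDn1 (n : nat) (w : word) : Prop :=
  w = [::] \/ (exists i, 0 < i < n /\ w = word12 i) \/
  w = word12 n.-1 ++ [:: V (Neg n)].
(* B(Lambda_n^D) (x) (B(Lambda_n^D) u B(Lambda_{n-1}^D)) *)
Definition tgtDn (n : nat) (w : word) : Prop :=
  exists C1 C2, [/\ w = [:: S C1; S C2], size C1 = n, size C2 = n & ~~ odd (nbars C1)].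
(* B(Lambda_{n-1}^D) (x) (B(Lambda_{n-1}^D) u B(Lambda_n^D)) *)
Definition tgtDn1 (n : nat) (w : word) : Prop :=
  exists C1 C2, [/\ w = [:: S C1; S C2], size C1 = n, size C2 = n & odd (nbars C1)].

Local Open Scope ring_scope.
Inductive relB (n : nat) : word -> word -> Prop :=
| RB1a x y z : valid_letter TB n x -> valid_letter TB n y -> valid_letter TB n z ->
    ltL TB n x y -> ltL TB n y z -> x <> bar z ->
    relB n [:: V y; V z; V x] [:: V y; V x; V z]
| RB1b x y z : valid_letter TB n x -> valid_letter TB n y -> valid_letter TB n z ->
    ltL TB n x y -> ltL TB n y z -> x <> bar z ->
    relB n [:: V x; V z; V y] [:: V z; V x; V y]
| RB2a x y : valid_letter TB n x -> valid_letter TB n y ->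
    ltL TB n x y -> x <> bar y -> x <> Zer ->
    relB n [:: V x; V y; V x] [:: V x; V x; V y]
| RB2b x y : valid_letter TB n x -> valid_letter TB n y ->
    ltL TB n x y -> x <> bar y -> y <> Zer ->
    relB n [:: V x; V y; V y] [:: V y; V x; V y]
| RB3a k y : (1 < k <= n)%N -> valid_letter TB n y ->
    leL TB n (Pos k) y -> leL TB n y (Neg k) ->
    relB n [:: V y; V (Neg k.-1); V (Pos k.-1)] [:: V y; V (Pos k); V (Neg k)]
| RB3b k y : (1 < k <= n)%N -> valid_letter TB n y ->
    leL TB n (Pos k) y -> leL TB n y (Neg k) ->
    relB n [:: V (Pos k); V (Neg k); V y] [:: V (Neg k.-1); V (Pos k.-1); V y]
| RB3c : relB n [:: V Zer; V (Neg n); V (Pos n)] [:: V (Neg n); V (Pos n); V Zer]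
| RB4a k : (0 < k <= n)%N ->
    relB n [:: V Zer; V Zer; V (Pos k)] [:: V Zer; V (Pos k); V Zer]
| RB4b k : (0 < k <= n)%N ->
    relB n [:: V Zer; V (Neg k); V Zer] [:: V (Neg k); V Zer; V Zer]
| RB5a w k : colB n w -> ~ admissible TB n w -> proper_factors_adm TB n w ->
    lowest_badz TB n w k ->
    relB n (Vw w) (Vw [seq x <- w | (x != Pos k) && (x != Neg k)])
| RB5b a c : colB n (a ++ Zer :: c) -> ~ admissible TB n (a ++ Zer :: c) ->
    proper_factors_adm TB n (a ++ Zer :: c) ->
    (forall k, ~ badz TB n (a ++ Zer :: c) k) ->
    relB n (Vw (a ++ Zer :: c)) (Vw (a ++ c))
| RB6 C x C' : valid_spin n C -> valid_letter TB n x -> valid_spin n C' ->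
    tri TB n x C ->
    (forall j, (0 < j <= n)%N -> wt2S C' j = wt2S C j + wt2L x j) ->
    relB n [:: S C; V x] [:: S C']
| RB7a C x x' C' : valid_spin n C -> valid_letter TB n x -> valid_spin n C' ->
    valid_letter TB n x' ->
    ~ tri TB n x C -> leL TB n Zer x ->
    (in_spin n C x' /\ leL TB n x x' /\
     forall y, in_spin n C y -> leL TB n x y -> leL TB n x' y) ->
    (forall j, (0 < j <= n)%N -> wt2S C' j = wt2S C j + wt2L x j - wt2L x' j) ->
    relB n [:: S C; V x] [:: V x'; S C']
| RB7b C x x' C' : valid_spin n C -> valid_letter TB n x -> valid_spin n C' ->
    valid_letter TB n x' ->
    ~ tri TB n x C -> leL TB n x (Pos n) ->
    ((in_spin n C x' || (x' == Zer)) /\ leL TB n x x' /\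
     forall y, (in_spin n C y || (y == Zer)) -> leL TB n x y -> leL TB n x' y) ->
    (forall j, (0 < j <= n)%N -> wt2S C' j = wt2S C j + wt2L x j - wt2L x' j) ->
    relB n [:: S C; V x] [:: V x'; S C']
| RB8 (Sm : word -> word) w :
    cryst_iso TB n (in_comps TB n (seedsB n)) (tgtB n) Sm ->
    colB n w -> admissible TB n w -> in_comps TB n (seedsB n) (Vw w) ->
    relB n (Sm (Vw w)) (Vw w).

Inductive relD (n : nat) : word -> word -> Prop :=
| RD1a x y z : valid_letter TD n x -> valid_letter TD n y -> valid_letter TD n z ->
    leL TD n x y -> ltL TD n y z -> x <> bar z ->
    relD n [:: V y; V z; V x] [:: V y; V x; V z]
| RD1b x y z : valid_letter TD n x -> valid_letter TD n y -> valid_letter TD n z ->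
    ltL TD n x y -> leL TD n y z -> x <> bar z ->
    relD n [:: V x; V z; V y] [:: V z; V x; V y]
| RD2a k y : (1 < k < n)%N -> valid_letter TD n y ->
    leL TD n (Pos k) y -> leL TD n y (Neg k) ->
    relD n [:: V y; V (Neg k.-1); V (Pos k.-1)] [:: V y; V (Pos k); V (Neg k)]
| RD2b k y : (1 < k < n)%N -> valid_letter TD n y ->
    leL TD n (Pos k) y -> leL TD n y (Neg k) ->
    relD n [:: V (Pos k); V (Neg k); V y] [:: V (Neg k.-1); V (Pos k.-1); V y]
| RD3a x : valid_letter TD n x -> leL TD n x (Pos n.-1) ->
    relD n [:: V (Neg n); V (bar x); V (Pos n)] [:: V (bar x); V (Neg n); V (Pos n)]
| RD3b x : valid_letter TD n x -> leL TD n x (Pos n.-1) ->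
    relD n [:: V (Pos n); V (bar x); V (Neg n)] [:: V (bar x); V (Pos n); V (Neg n)]
| RD3c x : valid_letter TD n x -> leL TD n x (Pos n.-1) ->
    relD n [:: V (Neg n); V (Pos n); V x] [:: V (Neg n); V x; V (Pos n)]
| RD3d x : valid_letter TD n x -> leL TD n x (Pos n.-1) ->
    relD n [:: V (Pos n); V (Neg n); V x] [:: V (Pos n); V x; V (Neg n)]
| RD4a : relD n [:: V (Pos n); V (Neg n); V (Neg n)]
               [:: V (Neg n.-1); V (Pos n.-1); V (Neg n)]
| RD4b : relD n [:: V (Neg n); V (Pos n); V (Pos n)]
               [:: V (Neg n.-1); V (Pos n.-1); V (Pos n)]
| RD4c : relD n [:: V (Neg n); V (Neg n.-1); V (Pos n.-1)]
               [:: V (Neg n); V (Neg n); V (Pos n)]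
| RD4d : relD n [:: V (Pos n); V (Neg n.-1); V (Pos n.-1)]
               [:: V (Pos n); V (Pos n); V (Neg n)]
| RD5a w k : colD n w -> ~ admissible TD n w -> proper_factors_adm TD n w ->
    lowest_badz TD n w k -> (k < n)%N ->
    relD n (Vw w) (Vw [seq x <- w | (x != Pos k) && (x != Neg k)])
| RD5b a b : colD n (a ++ [:: Pos n; Neg n] ++ b) ->
    ~ admissible TD n (a ++ [:: Pos n; Neg n] ++ b) ->
    proper_factors_adm TD n (a ++ [:: Pos n; Neg n] ++ b) ->
    lowest_badz TD n (a ++ [:: Pos n; Neg n] ++ b) n ->
    relD n (Vw (a ++ [:: Pos n; Neg n] ++ b)) (Vw (a ++ b))
| RD5c a b : colD n (a ++ [:: Neg n; Pos n] ++ b) ->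
    ~ admissible TD n (a ++ [:: Neg n; Pos n] ++ b) ->
    proper_factors_adm TD n (a ++ [:: Neg n; Pos n] ++ b) ->
    lowest_badz TD n (a ++ [:: Neg n; Pos n] ++ b) n ->
    relD n (Vw (a ++ [:: Neg n; Pos n] ++ b)) (Vw (a ++ b))
| RD6 C x C' : valid_spin n C -> valid_letter TD n x -> valid_spin n C' ->
    tri TD n x C ->
    (forall j, (0 < j <= n)%N -> wt2S C' j = wt2S C j + wt2L x j) ->
    relD n [:: S C; V x] [:: S C']
| RD7 C x x' C' : valid_spin n C -> valid_letter TD n x -> valid_spin n C' ->
    valid_letter TD n x' ->
    ~ tri TD n x C ->
    (in_spin n C x' /\ leL TD n x x' /\
     forall y, in_spin n C y -> leL TD n x y -> leL TD n x' y) ->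
    (forall j, (0 < j <= n)%N -> wt2S C' j = wt2S C j + wt2L x j - wt2L x' j) ->
    relD n [:: S C; V x] [:: V x'; S C']
| RD8n (Sm : word -> word) w :
    cryst_iso TD n (in_comps TD n (seedsDn n)) (tgtDn n) Sm ->
    colD n w -> admissible TD n w -> in_comps TD n (seedsDn n) (Vw w) ->
    relD n (Sm (Vw w)) (Vw w)
| RD8n1 (Sm : word -> word) w :
    cryst_iso TD n (in_comps TD n (seedsDn1 n)) (tgtDn1 n) Sm ->
    colD n w -> admissible TD n w -> in_comps TD n (seedsDn1 n) (Vw w) ->
    relD n (Sm (Vw w)) (Vw w).
Local Close Scope ring_scope.

Inductive congr (R : word -> word -> Prop) : word -> word -> Prop :=
| cg_base a b u v : R u v -> congr R (a ++ u ++ b) (a ++ v ++ b)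
| cg_refl w : congr R w w
| cg_sym u v : congr R u v -> congr R v u
| cg_trans u v w : congr R u v -> congr R v w -> congr R u w.

(* Main.v *)
(** Soundness: the union of the generating relations with equality is stable under all f_i and e_i,
    hence so is the congruence. For R6-R7 this follows from describing R6 and R7 as a transducer reading
    the spin column position by position; for R5 columns are read as walks, and R5 erases the pair
    at which the walk first becomes negative; for R8 the inverse isomorphism is written down
    explicitly by bracketing the two spin columns.

    Completeness: let F_i be the fundamental words (12...i, or one of the spin columns of highest
    weight). Up to congruence they commute, since 12...k is congruent to a product of two
    spin columns through which the letters 1, ..., k pass by R7. Reading a highest weight word w from
    the left and using R6 and R8, w is congruent to a product of the F_i, with multiplicities
    phi_i(w). If two highest weight words lie in one component, each weight dominates the other,
    so the weights agree, and by induction on prefixes so do the words. *)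

From HB Require Import structures.
From mathcomp Require Import all_boot all_order all_algebra.
From Stdlib Require Import Relations ClassicalEpsilon Lia.
Require Import Defs.
Set Implicit Arguments. Unset Strict Implicit. Unset Printing Implicit Defensive.

(** No representation theory is presupposed, so the uniqueness of the highest weight vertex of a
    component has to be proved for words, and the congruence itself does this. A highest weight word
    becomes a product of fundamental words; every other vertex of its component then has a congruent
    partner of the same weight in the component of that product, and the partner lies factor by
    factor in the components of the fundamental words, where partial sums of weights are bounded
    directly. Uniqueness also shows that a congruence class meets a component at most once, so that
    sending a vertex to its congruent partner is an isomorphism of components. Stability under the
    operators must be checked for all ranks at once. The letters 1 and \bar 1, and the first
    position of a spin column, are inert for f_i and e_i with i >= 2; hence each combinatorial model
    is a recursion over positions, and only i = 1 and the smallest rank remain as finite checks. R1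
    to R4 involve three letters only, which are replaced by numbers so that linear arithmetic
    decides them. *)

Definition optrel (T : Type) (Q : T -> T -> Prop) (x y : option T) : Prop :=
  match x, y with Some a, Some b => Q a b | None, None => True | _, _ => False end.

(** * The plactic relations R1 to R4 *)

Section Knuth.
Local Open Scope coq_nat_scope.
Local Notation "m + n" := (Nat.add m n) : nat_scope.

(* (eps, phi, f, e) of a letter given by its rank *)
Definition kdata := (nat * nat * option nat * option nat)%type.

(** Letter codes of type B: k for the letter k, n+1 for 0 and 2n+2-k for \bar k, so that every f_i
    adds 1 to the code. Case analysis on this predicate turns eps and phi into numerals, after which
    the tensor rule computes. Predecessors enter through equations such as [r = r'.+1], which avoids
    truncated subtraction. *)
Inductive iclsB (n i r : nat) : kdata -> Prop :=
| iclsB_1 : i < n -> r = i -> iclsB n i r (0, 1, Some r.+1, None)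
| iclsB_2 r' : i < n -> r = r'.+1 -> r' = i -> iclsB n i r (1, 0, None, Some r')
| iclsB_3 : i < n -> (r + i = n + n + 1)%coq_nat -> iclsB n i r (0, 1, Some r.+1, None)
| iclsB_4 r' : i < n -> r = r'.+1 -> (r' + i = n + n + 1)%coq_nat -> iclsB n i r (1, 0, None, Some r')
| iclsB_5 : i < n -> r <> i -> r <> i.+1 -> (r + i <> n + n + 1)%coq_nat -> (r + i <> n + n + 2)%coq_nat ->
   iclsB n i r (0, 0, None, None)
| iclsB_6 : i = n -> r = i -> iclsB n i r (0, 2, Some r.+1, None)
| iclsB_7 r' : i = n -> r = r'.+1 -> r' = i -> iclsB n i r (1, 1, Some r.+1, Some r')
| iclsB_8 r' : i = n -> r = r'.+1 -> r' = i.+1 -> iclsB n i r (2, 0, None, Some r')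
| iclsB_9 : i = n -> r <> i -> r <> i.+1 -> r <> i.+2 -> iclsB n i r (0, 0, None, None).

(** [maxn eb (ec + eb - pb)] is eps of the last two factors, so this is the tensor rule for three
    letters, acting on codes. *)
Definition f3 (a b c : nat) (A B C : kdata) : option (nat * nat * nat) :=
  let: (ea, pa, fa, _) := A in let: (eb, pb, fb, _) := B in let: (ec, pc, fc, _) := C in
  if (maxn eb (ec + eb - pb) < pa)%N then omap (fun x => (x, b, c)) fa
  else if (ec < pb)%N then omap (fun x => (a, x, c)) fb else omap (fun x => (a, b, x)) fc.

Definition e3 (a b c : nat) (A B C : kdata) : option (nat * nat * nat) :=
  let: (ea, pa, _, ga) := A in let: (eb, pb, _, gb) := B in let: (ec, pc, _, gc) := C in
  if (pa < maxn eb (ec + eb - pb))%N then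
     (if (pb < ec)%N then omap (fun x => (a, b, x)) gc else omap (fun x => (a, x, c)) gb)
  else omap (fun x => (x, b, c)) ga.

(** R1 to R4 on codes; the codes of x and \bar x add up to 2n+2. All six entries are variables tied
    by equations, so that every constructor unifies with every goal and leaves only arithmetic to be
    decided. *)
Inductive knuthB (n : nat) : nat * nat * nat -> nat * nat * nat -> Prop :=
| kB1a a b c a' b' c' : 1 <= c -> c < a -> a < b -> b <= n + n + 1 -> c + b <> n + n + 2 -> a' = a -> b' = c -> c' = b -> knuthB n (a, b, c) (a', b', c')
| kB1b a b c a' b' c' : 1 <= a -> a < c -> c < b -> b <= n + n + 1 -> a + b <> n + n + 2 -> a' = b -> b' = a -> c' = c -> knuthB n (a, b, c) (a', b', c')
| kB2a a b c a' b' c' : 1 <= a -> a < b -> b <= n + n + 1 -> a = c -> a + b <> n + n + 2 -> a <> n + 1 -> a' = a -> b' = a -> c' = b -> knuthB n (a, b, c) (a', b', c')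
| kB2b a b c a' b' c' : 1 <= a -> a < b -> b <= n + n + 1 -> b = c -> a + b <> n + n + 2 -> b <> n + 1 -> a' = b -> b' = a -> c' = c -> knuthB n (a, b, c) (a', b', c')
| kB3a a b c a' b' c' : 1 <= c -> c < n -> b + c = n + n + 2 -> c < a -> a < b -> a' = a -> b' = c.+1 -> c'.+1 = b -> knuthB n (a, b, c) (a', b', c')
| kB3b a b c a' b' c' : 2 <= a -> a <= n -> a + b = n + n + 2 -> a <= c -> c <= b -> a' = b.+1 -> b'.+1 = a -> c' = c -> knuthB n (a, b, c) (a', b', c')
| kB3c a b c a' b' c' : a = n.+1 -> b = n.+2 -> c = n -> a' = n.+2 -> b' = n -> c' = n.+1 -> knuthB n (a, b, c) (a', b', c')
| kB4a a b c a' b' c' : a = n.+1 -> b = n.+1 -> 1 <= c -> c <= n -> a' = n.+1 -> b' = c -> c' = n.+1 -> knuthB n (a, b, c) (a', b', c')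
| kB4b a b c a' b' c' : a = n.+1 -> c = n.+1 -> n.+2 <= b -> b <= n + n + 1 -> a' = b -> b' = n.+1 -> c' = n.+1 -> knuthB n (a, b, c) (a', b', c').

Definition keq3 (K : nat * nat * nat -> nat * nat * nat -> Prop) x y := K x y \/ x = y.

Ltac kfin := first [ exact I | exfalso; lia
  | left; first [ apply kB1a; lia | apply kB1b; lia | apply kB2a; lia | apply kB2b; lia
    | apply kB3a; lia | apply kB3b; lia | apply kB3c; lia | apply kB4a; lia | apply kB4b; lia ]
  | right; repeat f_equal; lia ].

Ltac knuth_cases :=
  intros;
  repeat match goal with H : iclsB _ _ _ _ |- _ => destruct H; try lia end;
  subst; split; lazy; kfin.

Lemma knuthB_1a n i a b c A B C : 1 <= i -> i <= n ->
  1 <= c ->  c < a ->  a < b ->  b <= n + n + 1 ->  c + b <> n + n + 2 ->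
  iclsB n i a A -> iclsB n i b B -> iclsB n i c C -> 
  optrel (keq3 (knuthB n)) (f3 a b c A B C) (f3 a c b A C B) /\
  optrel (keq3 (knuthB n)) (e3 a b c A B C) (e3 a c b A C B).
Proof. knuth_cases. Qed.

Lemma knuthB_1b n i a b c A B C : 1 <= i -> i <= n ->
  1 <= a ->  a < c ->  c < b ->  b <= n + n + 1 ->  a + b <> n + n + 2 ->
  iclsB n i a A -> iclsB n i b B -> iclsB n i c C -> 
  optrel (keq3 (knuthB n)) (f3 a b c A B C) (f3 b a c B A C) /\
  optrel (keq3 (knuthB n)) (e3 a b c A B C) (e3 b a c B A C).
Proof. knuth_cases. Qed.

Lemma knuthB_2a n i a b A B : 1 <= i -> i <= n ->
  1 <= a ->  a < b ->  b <= n + n + 1 ->  a + b <> n + n + 2 ->  a <> n + 1 ->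
  iclsB n i a A -> iclsB n i b B -> 
  optrel (keq3 (knuthB n)) (f3 a b a A B A) (f3 a a b A A B) /\
  optrel (keq3 (knuthB n)) (e3 a b a A B A) (e3 a a b A A B).
Proof. knuth_cases. Qed.

Lemma knuthB_2b n i a b A B : 1 <= i -> i <= n ->
  1 <= a ->  a < b ->  b <= n + n + 1 ->  a + b <> n + n + 2 ->  b <> n + 1 ->
  iclsB n i a A -> iclsB n i b B -> 
  optrel (keq3 (knuthB n)) (f3 a b b A B B) (f3 b a b B A B) /\
  optrel (keq3 (knuthB n)) (e3 a b b A B B) (e3 b a b B A B).
Proof. knuth_cases. Qed.

Lemma knuthB_3a n i a c d A B C D E : 1 <= i -> i <= n ->
  1 <= c ->  c < n ->  d.+1 + c = n + n + 2 ->  c < a ->  a <= d ->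
  iclsB n i a A -> iclsB n i c B -> iclsB n i d C -> iclsB n i d.+1 D -> iclsB n i c.+1 E -> 
  optrel (keq3 (knuthB n)) (f3 a (d.+1) c A D B) (f3 a (c.+1) d A E C) /\
  optrel (keq3 (knuthB n)) (e3 a (d.+1) c A D B) (e3 a (c.+1) d A E C).
Proof. knuth_cases. Qed.

Lemma knuthB_3b n i a b c A B C D E : 1 <= i -> i <= n ->
  1 <= a ->  a < n ->  a.+1 + b = n + n + 2 ->  a < c ->  c <= b ->
  iclsB n i a A -> iclsB n i b B -> iclsB n i c C -> iclsB n i a.+1 D -> iclsB n i b.+1 E -> 
  optrel (keq3 (knuthB n)) (f3 (a.+1) b c D B C) (f3 (b.+1) a c E A C) /\
  optrel (keq3 (knuthB n)) (e3 (a.+1) b c D B C) (e3 (b.+1) a c E A C).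
Proof. knuth_cases. Qed.

Lemma knuthB_3c n i  A B C : 1 <= i -> i <= n ->

  iclsB n i n A -> iclsB n i n.+1 B -> iclsB n i n.+2 C -> 
  optrel (keq3 (knuthB n)) (f3 (n.+1) (n.+2) n B C A) (f3 (n.+2) n (n.+1) C A B) /\
  optrel (keq3 (knuthB n)) (e3 (n.+1) (n.+2) n B C A) (e3 (n.+2) n (n.+1) C A B).
Proof. knuth_cases. Qed.

Lemma knuthB_4a n i c A B : 1 <= i -> i <= n ->
  1 <= c ->  c <= n ->
  iclsB n i c A -> iclsB n i n.+1 B -> 
  optrel (keq3 (knuthB n)) (f3 (n.+1) (n.+1) c B B A) (f3 (n.+1) c (n.+1) B A B) /\
  optrel (keq3 (knuthB n)) (e3 (n.+1) (n.+1) c B B A) (e3 (n.+1) c (n.+1) B A B).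
Proof. knuth_cases. Qed.

Lemma knuthB_4b n i b A B : 1 <= i -> i <= n ->
  n.+2 <= b ->  b <= n + n + 1 ->
  iclsB n i b A -> iclsB n i n.+1 B -> 
  optrel (keq3 (knuthB n)) (f3 (n.+1) b (n.+1) B A B) (f3 b (n.+1) (n.+1) A B B) /\
  optrel (keq3 (knuthB n)) (e3 (n.+1) b (n.+1) B A B) (e3 b (n.+1) (n.+1) A B B).
Proof. knuth_cases. Qed.

Lemma knuthB_closed n i (kd : nat -> kdata) x y : 1 <= i -> i <= n -> 
  (forall r, 1 <= r -> r <= n + n + 1 -> iclsB n i r (kd r)) -> knuthB n x y ->
  let F w := f3 w.1.1 w.1.2 w.2 (kd w.1.1) (kd w.1.2) (kd w.2) in
  let E w := e3 w.1.1 w.1.2 w.2 (kd w.1.1) (kd w.1.2) (kd w.2) in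
  optrel (keq3 (knuthB n)) (F x) (F y) /\ optrel (keq3 (knuthB n)) (E x) (E y).
Proof.
move=> i1 i2 K h F E; rewrite /F /E {F E}; case: h; intros; subst; cbn [fst snd].
- eapply (@knuthB_1a n i); [exact i1|exact i2|..]; try eassumption; try (apply: K; lia); try lia.
- eapply (@knuthB_1b n i); [exact i1|exact i2|..]; try eassumption; try (apply: K; lia); try lia.
- eapply (@knuthB_2a n i); [exact i1|exact i2|..]; try eassumption; try (apply: K; lia); try lia.
- eapply (@knuthB_2b n i); [exact i1|exact i2|..]; try eassumption; try (apply: K; lia); try lia.
- eapply (@knuthB_3a n i); [exact i1|exact i2|..]; try eassumption; try (apply: K; lia); try lia.
- eapply (@knuthB_3b n i); [exact i1|exact i2|..]; try eassumption; try (apply: K; lia); try lia.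
- eapply (@knuthB_3c n i); [exact i1|exact i2|..]; try eassumption; try (apply: K; lia); try lia.
- eapply (@knuthB_4a n i); [exact i1|exact i2|..]; try eassumption; try (apply: K; lia); try lia.
- eapply (@knuthB_4b n i); [exact i1|exact i2|..]; try eassumption; try (apply: K; lia); try lia.
Qed.

(** Letter codes of type D: k for k and 2n+1-k for \bar k, so n and \bar n have the neighbouring
    codes n and n+1. Here f_i adds 1 for i < n, and f_n adds 2. *)
Inductive iclsD (n i r : nat) : kdata -> Prop :=
| iclsD_1 : i < n -> r = i -> iclsD n i r (0, 1, Some r.+1, None)
| iclsD_2 r' : i < n -> r = r'.+1 -> r' = i -> iclsD n i r (1, 0, None, Some r')
| iclsD_3 : i < n -> (r + i = n + n)%coq_nat -> iclsD n i r (0, 1, Some r.+1, None)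
| iclsD_4 r' : i < n -> r = r'.+1 -> (r' + i = n + n)%coq_nat -> iclsD n i r (1, 0, None, Some r')
| iclsD_5 : i < n -> r <> i -> r <> i.+1 -> (r + i <> n + n)%coq_nat -> (r + i <> n + n + 1)%coq_nat ->
   iclsD n i r (0, 0, None, None)
| iclsD_6 : i = n -> r.+1 = i \/ r = i -> iclsD n i r (0, 1, Some r.+2, None)
| iclsD_7 r' : i = n -> r = r'.+2 -> r'.+1 = i \/ r' = i -> iclsD n i r (1, 0, None, Some r')
| iclsD_8 : i = n -> r.+1 <> i -> r <> i -> r <> i.+1 -> r <> i.+2 -> iclsD n i r (0, 0, None, None).

(** The order of the codes is total although n and \bar n are incomparable; the disjunctions remove
    the pair (n, n+1) from the order. In R4 the code of n-1 is the variable m with [m.+1 = n]. *)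
Inductive knuthD (n : nat) : nat * nat * nat -> nat * nat * nat -> Prop :=
| kD1a a b c p q r p' q' r' : 1 <= c -> c <= a -> (c <> n \/ a <> n.+1) -> a < b -> (a <> n \/ b <> n.+1) -> b <= n + n -> c + b <> n + n + 1 -> p = a -> q = b -> r = c -> p' = a -> q' = c -> r' = b -> knuthD n (p, q, r) (p', q', r')
| kD1b a b c p q r p' q' r' : 1 <= a -> a < c -> (a <> n \/ c <> n.+1) -> c <= b -> (c <> n \/ b <> n.+1) -> b <= n + n -> a + b <> n + n + 1 -> p = a -> q = b -> r = c -> p' = b -> q' = a -> r' = c -> knuthD n (p, q, r) (p', q', r')
| kD2a a c d p q r p' q' r' : 1 <= c -> c.+1 < n -> d.+1 + c = n + n + 1 -> c < a -> a <= d -> p = a -> q = d.+1 -> r = c -> p' = a -> q' = c.+1 -> r' = d -> knuthD n (p, q, r) (p', q', r')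
| kD2b a b c p q r p' q' r' : 1 <= a -> a.+1 < n -> a.+1 + b = n + n + 1 -> a < c -> c <= b -> p = a.+1 -> q = b -> r = c -> p' = b.+1 -> q' = a -> r' = c -> knuthD n (p, q, r) (p', q', r')
| kD3a b p q r p' q' r' : n.+2 <= b -> b <= n + n -> p = n.+1 -> q = b -> r = n -> p' = b -> q' = n.+1 -> r' = n -> knuthD n (p, q, r) (p', q', r')
| kD3b b p q r p' q' r' : n.+2 <= b -> b <= n + n -> p = n -> q = b -> r = n.+1 -> p' = b -> q' = n -> r' = n.+1 -> knuthD n (p, q, r) (p', q', r')
| kD3c c p q r p' q' r' : 1 <= c -> c < n -> p = n.+1 -> q = n -> r = c -> p' = n.+1 -> q' = c -> r' = n -> knuthD n (p, q, r) (p', q', r')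
| kD3d c p q r p' q' r' : 1 <= c -> c < n -> p = n -> q = n.+1 -> r = c -> p' = n -> q' = c -> r' = n.+1 -> knuthD n (p, q, r) (p', q', r')
| kD4a m p q r p' q' r' : m.+1 = n -> p = n -> q = n.+1 -> r = n.+1 -> p' = n.+2 -> q' = m -> r' = n.+1 -> knuthD n (p, q, r) (p', q', r')
| kD4b m p q r p' q' r' : m.+1 = n -> p = n.+1 -> q = n -> r = n -> p' = n.+2 -> q' = m -> r' = n -> knuthD n (p, q, r) (p', q', r')
| kD4c m p q r p' q' r' : m.+1 = n -> p = n.+1 -> q = n.+2 -> r = m -> p' = n.+1 -> q' = n.+1 -> r' = n -> knuthD n (p, q, r) (p', q', r')
| kD4d m p q r p' q' r' : m.+1 = n -> p = n -> q = n.+2 -> r = m -> p' = n -> q' = n -> r' = n.+1 -> knuthD n (p, q, r) (p', q', r').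

Ltac kfinD := first [ exact I | exfalso; lia
  | right; repeat f_equal; lia
  | left; match goal with |- knuthD _ (?p, ?q, ?r) (?p', ?q', ?r') => first [ apply (@kD1a _ p q r); lia | apply (@kD1b _ p q r); lia | apply (@kD2a _ p r r'); lia | apply (@kD2b _ q' q r); lia | apply (@kD3a _ q); lia | apply (@kD3b _ q); lia | apply (@kD3c _ r); lia | apply (@kD3d _ r); lia | apply (@kD4a _ q'); lia | apply (@kD4b _ q'); lia | apply (@kD4c _ r); lia | apply (@kD4d _ r); lia ] end ].

Ltac knuth_casesD :=
  intros; match goal with _ : iclsD ?n ?i _ _ |- _ => destruct (PeanoNat.Nat.eq_dec i.+1 n) end;
  repeat match goal with H : iclsD _ _ _ _ |- _ => destruct H; try lia end;
  subst; split; lazy; kfinD.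

Lemma knuthD_1a n i a b c A B C : 1 <= i -> i <= n -> 2 <= n ->
  1 <= c ->  c <= a ->  (c <> n \/ a <> n.+1) ->  a < b ->  (a <> n \/ b <> n.+1) ->  b <= n + n ->  c + b <> n + n + 1 ->
  iclsD n i a A -> iclsD n i b B -> iclsD n i c C -> 
  optrel (keq3 (knuthD n)) (f3 a b c A B C) (f3 a c b A C B) /\
  optrel (keq3 (knuthD n)) (e3 a b c A B C) (e3 a c b A C B).
Proof. knuth_casesD. Qed.

Lemma knuthD_1b n i a b c A B C : 1 <= i -> i <= n -> 2 <= n ->
  1 <= a ->  a < c ->  (a <> n \/ c <> n.+1) ->  c <= b ->  (c <> n \/ b <> n.+1) ->  b <= n + n ->  a + b <> n + n + 1 ->
  iclsD n i a A -> iclsD n i b B -> iclsD n i c C -> 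
  optrel (keq3 (knuthD n)) (f3 a b c A B C) (f3 b a c B A C) /\
  optrel (keq3 (knuthD n)) (e3 a b c A B C) (e3 b a c B A C).
Proof. knuth_casesD. Qed.

Lemma knuthD_2a n i a c d A B C D E : 1 <= i -> i <= n -> 2 <= n ->
  1 <= c ->  c.+1 < n ->  d.+1 + c = n + n + 1 ->  c < a ->  a <= d ->
  iclsD n i a A -> iclsD n i c B -> iclsD n i d C -> iclsD n i d.+1 D -> iclsD n i c.+1 E -> 
  optrel (keq3 (knuthD n)) (f3 a (d.+1) c A D B) (f3 a (c.+1) d A E C) /\
  optrel (keq3 (knuthD n)) (e3 a (d.+1) c A D B) (e3 a (c.+1) d A E C).
Proof. knuth_casesD. Qed.

Lemma knuthD_2b n i a b c A B C D E : 1 <= i -> i <= n -> 2 <= n ->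
  1 <= a ->  a.+1 < n ->  a.+1 + b = n + n + 1 ->  a < c ->  c <= b ->
  iclsD n i a A -> iclsD n i b B -> iclsD n i c C -> iclsD n i a.+1 D -> iclsD n i b.+1 E -> 
  optrel (keq3 (knuthD n)) (f3 (a.+1) b c D B C) (f3 (b.+1) a c E A C) /\
  optrel (keq3 (knuthD n)) (e3 (a.+1) b c D B C) (e3 (b.+1) a c E A C).
Proof. knuth_casesD. Qed.

Lemma knuthD_3a n i b A B C : 1 <= i -> i <= n -> 2 <= n ->
  n.+2 <= b ->  b <= n + n ->
  iclsD n i n A -> iclsD n i n.+1 B -> iclsD n i b C -> 
  optrel (keq3 (knuthD n)) (f3 (n.+1) b n B C A) (f3 b (n.+1) n C B A) /\
  optrel (keq3 (knuthD n)) (e3 (n.+1) b n B C A) (e3 b (n.+1) n C B A).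
Proof. knuth_casesD. Qed.

Lemma knuthD_3b n i b A B C : 1 <= i -> i <= n -> 2 <= n ->
  n.+2 <= b ->  b <= n + n ->
  iclsD n i n A -> iclsD n i n.+1 B -> iclsD n i b C -> 
  optrel (keq3 (knuthD n)) (f3 n b (n.+1) A C B) (f3 b n (n.+1) C A B) /\
  optrel (keq3 (knuthD n)) (e3 n b (n.+1) A C B) (e3 b n (n.+1) C A B).
Proof. knuth_casesD. Qed.

Lemma knuthD_3c n i c A B C : 1 <= i -> i <= n -> 2 <= n ->
  1 <= c ->  c < n ->
  iclsD n i n A -> iclsD n i n.+1 B -> iclsD n i c C -> 
  optrel (keq3 (knuthD n)) (f3 (n.+1) n c B A C) (f3 (n.+1) c n B C A) /\
  optrel (keq3 (knuthD n)) (e3 (n.+1) n c B A C) (e3 (n.+1) c n B C A).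
Proof. knuth_casesD. Qed.

Lemma knuthD_3d n i c A B C : 1 <= i -> i <= n -> 2 <= n ->
  1 <= c ->  c < n ->
  iclsD n i n A -> iclsD n i n.+1 B -> iclsD n i c C -> 
  optrel (keq3 (knuthD n)) (f3 n (n.+1) c A B C) (f3 n c (n.+1) A C B) /\
  optrel (keq3 (knuthD n)) (e3 n (n.+1) c A B C) (e3 n c (n.+1) A C B).
Proof. knuth_casesD. Qed.

Lemma knuthD_4a n i m A B C D : 1 <= i -> i <= n -> 2 <= n ->
  m.+1 = n ->
  iclsD n i n A -> iclsD n i n.+1 B -> iclsD n i n.+2 C -> iclsD n i m D -> 
  optrel (keq3 (knuthD n)) (f3 n (n.+1) (n.+1) A B B) (f3 (n.+2) m (n.+1) C D B) /\
  optrel (keq3 (knuthD n)) (e3 n (n.+1) (n.+1) A B B) (e3 (n.+2) m (n.+1) C D B).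
Proof. knuth_casesD. Qed.

Lemma knuthD_4b n i m A B C D : 1 <= i -> i <= n -> 2 <= n ->
  m.+1 = n ->
  iclsD n i n A -> iclsD n i n.+1 B -> iclsD n i n.+2 C -> iclsD n i m D -> 
  optrel (keq3 (knuthD n)) (f3 (n.+1) n n B A A) (f3 (n.+2) m n C D A) /\
  optrel (keq3 (knuthD n)) (e3 (n.+1) n n B A A) (e3 (n.+2) m n C D A).
Proof. knuth_casesD. Qed.

Lemma knuthD_4c n i m A B C D : 1 <= i -> i <= n -> 2 <= n ->
  m.+1 = n ->
  iclsD n i n A -> iclsD n i n.+1 B -> iclsD n i n.+2 C -> iclsD n i m D -> 
  optrel (keq3 (knuthD n)) (f3 (n.+1) (n.+2) m B C D) (f3 (n.+1) (n.+1) n B B A) /\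
  optrel (keq3 (knuthD n)) (e3 (n.+1) (n.+2) m B C D) (e3 (n.+1) (n.+1) n B B A).
Proof. knuth_casesD. Qed.

Lemma knuthD_4d n i m A B C D : 1 <= i -> i <= n -> 2 <= n ->
  m.+1 = n ->
  iclsD n i n A -> iclsD n i n.+1 B -> iclsD n i n.+2 C -> iclsD n i m D -> 
  optrel (keq3 (knuthD n)) (f3 n (n.+2) m A C D) (f3 n n (n.+1) A A B) /\
  optrel (keq3 (knuthD n)) (e3 n (n.+2) m A C D) (e3 n n (n.+1) A A B).
Proof. knuth_casesD. Qed.

Lemma knuthD_closed n i (kd : nat -> kdata) x y : 1 <= i -> i <= n -> 2 <= n ->
  (forall r, 1 <= r -> r <= n + n -> iclsD n i r (kd r)) -> knuthD n x y ->
  let F w := f3 w.1.1 w.1.2 w.2 (kd w.1.1) (kd w.1.2) (kd w.2) in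
  let E w := e3 w.1.1 w.1.2 w.2 (kd w.1.1) (kd w.1.2) (kd w.2) in
  optrel (keq3 (knuthD n)) (F x) (F y) /\ optrel (keq3 (knuthD n)) (E x) (E y).
Proof.
move=> i1 i2 n2 K h F E; rewrite /F /E {F E}; case: h; intros; subst p q r p' q' r'; cbn [fst snd].
- eapply (@knuthD_1a n i); [exact i1|exact i2|exact n2|..]; try eassumption; try (apply: K; lia); try lia.
- eapply (@knuthD_1b n i); [exact i1|exact i2|exact n2|..]; try eassumption; try (apply: K; lia); try lia.
- eapply (@knuthD_2a n i); [exact i1|exact i2|exact n2|..]; try eassumption; try (apply: K; lia); try lia.
- eapply (@knuthD_2b n i); [exact i1|exact i2|exact n2|..]; try eassumption; try (apply: K; lia); try lia.
- eapply (@knuthD_3a n i); [exact i1|exact i2|exact n2|..]; try eassumption; try (apply: K; lia); try lia.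
- eapply (@knuthD_3b n i); [exact i1|exact i2|exact n2|..]; try eassumption; try (apply: K; lia); try lia.
- eapply (@knuthD_3c n i); [exact i1|exact i2|exact n2|..]; try eassumption; try (apply: K; lia); try lia.
- eapply (@knuthD_3d n i); [exact i1|exact i2|exact n2|..]; try eassumption; try (apply: K; lia); try lia.
- eapply (@knuthD_4a n i); [exact i1|exact i2|exact n2|..]; try eassumption; try (apply: K; lia); try lia.
- eapply (@knuthD_4b n i); [exact i1|exact i2|exact n2|..]; try eassumption; try (apply: K; lia); try lia.
- eapply (@knuthD_4c n i); [exact i1|exact i2|exact n2|..]; try eassumption; try (apply: K; lia); try lia.
- eapply (@knuthD_4d n i); [exact i1|exact i2|exact n2|..]; try eassumption; try (apply: K; lia); try lia.
Qed.

End Knuth.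

(* Single letters and spin columns: strings and the shift of rank *)
From mathcomp Require Import zify.

(** The ranks at which the induction on positions may stop: rank 1 in type B, but rank 2 in type D,
    whose node n involves two positions. *)
Definition okn (t : ctype) (n : nat) : bool := if t is TD then 1 < n else 0 < n.

(** Embedding of the crystal of rank n into the one of rank n+1. It turns f_i into f_(i+1), and
    among the valid letters it misses exactly 1 and \bar 1. *)
Definition letter_shift (x : letter) : letter :=
  match x with Pos k => Pos k.+1 | Zer => Zer | Neg k => Neg k.+1 end.

Lemma fLK t n i x y : okn t n -> 0 < i <= n ->
  fL t n i x = Some y -> eL t n i y = Some x.
Proof.
case: t x => [] [k||k] //= on li; repeat case: ifP => //; move=> *;
 try match goal with H : Some _ = Some _ |- _ => case: H => <- end => /=;
 repeat case: ifP => //; intros; try (exfalso; lia); repeat f_equal; lia.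
Qed.

Lemma eLK t n i x y : okn t n -> 0 < i <= n ->
  eL t n i x = Some y -> fL t n i y = Some x.
Proof.
case: t x => [] [k||k] //= on li; repeat case: ifP => //; move=> *;
 try match goal with H : Some _ = Some _ |- _ => case: H => <- end => /=;
 repeat case: ifP => //; intros; try (exfalso; lia); repeat f_equal; lia.
Qed.

Lemma valid_fL t n i x y : okn t n -> 0 < i <= n ->
  valid_letter t n x -> fL t n i x = Some y -> valid_letter t n y.
Proof.
case: t x => [] [k||k] //= on li v; repeat case: ifP => //; move=> *;
 match goal with H : Some _ = Some _ |- _ => case: H => <- end => //=; lia.
Qed.

Lemma valid_eL t n i x y : okn t n -> 0 < i <= n ->
  valid_letter t n x -> eL t n i x = Some y -> valid_letter t n y.
Proof.
case: t x => [] [k||k] //= on li v; repeat case: ifP => //; move=> *;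
 match goal with H : Some _ = Some _ |- _ => case: H => <- end => //=; lia.
Qed.

Lemma fS_shift t n i a C : okn t n -> 0 < i <= n ->
  fS t n.+1 i.+1 (a :: C) = omap (cons a) (fS t n i C).
Proof.
case: i => // i; case: n => // n on /= li; rewrite /fS /=.
rewrite !ltnS !eqSS.
case: ifP => h1 /=; first by case: ifP.
case: ifP => // _; move: on; case: t => /=; first by case: ifP.
by case: n {h1 li} => // n _ /=; case: ifP.
Qed.

Lemma eS_shift t n i a C : okn t n -> 0 < i <= n ->
  eS t n.+1 i.+1 (a :: C) = omap (cons a) (eS t n i C).
Proof.
case: i => // i; case: n => // n on /= li; rewrite /eS /=.
rewrite !ltnS !eqSS.
case: ifP => h1 /=; first by case: ifP.
case: ifP => // _; move: on; case: t => /=; first by case: ifP.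
by case: n {h1 li} => // n _ /=; case: ifP.
Qed.

Lemma fL_shift t n i x : okn t n -> 0 < i <= n ->
  fL t n.+1 i.+1 (letter_shift x) = omap letter_shift (fL t n i x).
Proof.
case: t x => [] [k||k] //= on li; rewrite ?eqSS ?ltnS.
all: repeat case: ifP => //=; intros; try (exfalso; lia); repeat f_equal; lia.
Qed.

Lemma eL_shift t n i x : okn t n -> 0 < i <= n ->
  eL t n.+1 i.+1 (letter_shift x) = omap letter_shift (eL t n i x).
Proof.
case: t x => [] [k||k] //= on li; rewrite ?eqSS ?ltnS.
all: repeat case: ifP => //=; intros; try (exfalso; lia); repeat f_equal; lia.
Qed.

Definition glift (a : bool) (g : gletter) : gletter :=
  match g with V x => V (letter_shift x) | S C => S (a :: C) end.

Lemma fG_shift t n i a g : okn t n -> 0 < i <= n ->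
  fG t n.+1 i.+1 (glift a g) = omap (glift a) (fG t n i g).
Proof.
case: g => [x|C] on li /=; first by rewrite fL_shift //; case: fL.
by rewrite fS_shift //; case: fS.
Qed.

Lemma eG_shift t n i a g : okn t n -> 0 < i <= n ->
  eG t n.+1 i.+1 (glift a g) = omap (glift a) (eG t n i g).
Proof.
case: g => [x|C] on li /=; first by rewrite eL_shift //; case: eL.
by rewrite eS_shift //; case: eS.
Qed.

Lemma cnt_morph (h h' : gletter -> option gletter) s k g :
  (forall g, h (s g) = omap s (h' g)) -> cnt h k (s g) = cnt h' k g.
Proof.
move=> hs; elim: k g => //= k IH g; rewrite hs; case: (h' g) => //= g'; by rewrite IH.
Qed.

(* The induction scheme behind every spin argument: position 1 of the columns is
   inert for all f_i with i >= 2, so those reduce to rank n - 1. *)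
Lemma spin_ind t (P : nat -> nat -> seq bool -> Prop) :
  (forall i C, (if t is TD then size C = 2 else size C = 1) ->
     0 < i <= size C -> P (size C) i C) ->
  (forall b b' C, (okn t (size C).+1) -> P (size C).+2 1 (b :: b' :: C)) ->
  (forall n i b C, size C = n -> okn t n -> 0 < i <= n -> P n i C -> P n.+1 i.+1 (b :: C)) ->
  forall n i C, okn t n -> size C = n -> 0 < i <= n -> P n i C.
Proof.
move=> h0 h1 hs n i C + sC; move: n i sC => _ i <-; elim: C i => [|b C IH] i on li; first by case: (t) on.
case okC: (okn t (size C)).
  case: i li => // -[|i] li; last by apply: hs => //; apply: IH.
  by case: C on li okC {IH} => [|b' C]; [case: (t)|move=> on li okC; apply: h1].
apply: h0 => //; move: on okC => /=; case: (t) => /=; lia.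
Qed.

Lemma fS_props t n i C : okn t n -> size C = n -> 0 < i <= n ->
  forall C', fS t n i C = Some C' -> [/\ size C' = n, eS t n i C' = Some C & fS t n i C' = None].
Proof.
move: n i C; apply: spin_ind => [i C|b b' C on C'|n i b C sC on li IH C'].
- case: t; first by case: C => [|b [|]] //= _; case: i => [|[]] //= _ C';
    rewrite /fS /eS /=; case: b => // -[<-] //.
  case: C => [|b [|b' [|]]] //= _; case: i => [|[|[|]]] //= _ C';
    rewrite /fS /eS /=; case: b; case: b' => // -[<-] //.
- by rewrite /fS /eS /=; case: b; case: b' => // -[<-] /=.
- rewrite fS_shift //; case E: fS => [C1|] //= [<-]; have [s1 e1 f1] := IH _ E.
  by rewrite /= s1 eS_shift // e1 fS_shift // f1.
Qed.

Lemma eS_props t n i C : okn t n -> size C = n -> 0 < i <= n ->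
  forall C', eS t n i C = Some C' -> [/\ size C' = n, fS t n i C' = Some C & eS t n i C' = None].
Proof.
move: n i C; apply: spin_ind => [i C|b b' C on C'|n i b C sC on li IH C'].
- case: t; first by case: C => [|b [|]] //= _; case: i => [|[]] //= _ C';
    rewrite /fS /eS /=; case: b => // -[<-] //.
  case: C => [|b [|b' [|]]] //= _; case: i => [|[|[|]]] //= _ C';
    rewrite /fS /eS /=; case: b; case: b' => // -[<-] //.
- by rewrite /fS /eS /=; case: b; case: b' => // -[<-] /=.
- rewrite eS_shift //; case E: eS => [C1|] //= [<-]; have [s1 e1 f1] := IH _ E.
  by rewrite /= s1 fS_shift // e1 eS_shift // f1.
Qed.

Section Letters.
Variables (t : ctype) (n : nat).
Hypothesis on : okn t n.

Lemma fG_props i g g' : 0 < i <= n -> valid_g t n g -> fG t n i g = Some g' ->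
  valid_g t n g' /\ eG t n i g' = Some g.
Proof.
move=> li; case: g => [x|C] /= v.
  case E: fL => [y|] //= [<-] /=; split; first exact: valid_fL E.
  by rewrite (fLK on li E).
move/eqP: v => v; case E: fS => [D|] //= [<-] /=.
by have [s1 -> _] := fS_props on v li E; rewrite /valid_spin s1.
Qed.

Lemma eG_props i g g' : 0 < i <= n -> valid_g t n g -> eG t n i g = Some g' ->
  valid_g t n g' /\ fG t n i g' = Some g.
Proof.
move=> li; case: g => [x|C] /= v.
  case E: eL => [y|] //= [<-] /=; split; first exact: valid_eL E.
  by rewrite (eLK on li E).
move/eqP: v => v; case E: eS => [D|] //= [<-] /=.
by have [s1 -> _] := eS_props on v li E; rewrite /valid_spin s1.
Qed.

(** [epsG] and [phiG] count with fuel 4. Three steps always lead out of the crystal, so fuel 3 gives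
    the same number; this is what makes phi drop by exactly one along f_i. *)
Lemma cnt_stable (h : gletter -> option gletter) g :
  obind h (obind h (h g)) = None -> cnt h 3 g = cnt h 4 g.
Proof. by rewrite /=; case: (h g) => //= g1; case: (h g1) => //= g2 ->. Qed.

Lemma fG3 i g : 0 < i <= n -> valid_g t n g ->
  obind (fG t n i) (obind (fG t n i) (fG t n i g)) = None.
Proof.
move=> li; case: g => [x|C] /= v; last first.
  case E: fS => [D|] //=; have [_ _ ->] := fS_props on (eqP v) li E; by [].
case E: fL => [y|] //=; case E2: fL => [z|] //=; case E3: fL => [u|] //=.
by exfalso; move: v E E2 E3; case: t on x y z u => [] /= o [k||k] [l||l] [m||m] [p||p] //=;
  repeat case: ifP => //; intros; repeat match goal with H : Some _ = Some _ |- _ => case: H => ? end;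
  subst; lia.
Qed.

Lemma eG3 i g : 0 < i <= n -> valid_g t n g ->
  obind (eG t n i) (obind (eG t n i) (eG t n i g)) = None.
Proof.
move=> li; case: g => [x|C] /= v; last first.
  case E: eS => [D|] //=; have [_ _ ->] := eS_props on (eqP v) li E; by [].
case E: eL => [y|] //=; case E2: eL => [z|] //=; case E3: eL => [u|] //=.
by exfalso; move: v E E2 E3; case: t on x y z u => [] /= o [k||k] [l||l] [m||m] [p||p] //=;
  repeat case: ifP => //; intros; repeat match goal with H : Some _ = Some _ |- _ => case: H => ? end;
  subst; lia.
Qed.

Lemma phiG_f i g : 0 < i <= n -> valid_g t n g ->
  match fG t n i g with
  | Some g' => phiG t n i g = (phiG t n i g').+1 /\ epsG t n i g' = (epsG t n i g).+1
  | None => phiG t n i g = 0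
  end.
Proof.
move=> li v; rewrite /phiG /epsG; case E: fG => [g'|]; last by rewrite /= E.
have [v' e'] := fG_props li v E.
rewrite -(cnt_stable (fG3 li v')) -(cnt_stable (eG3 li v)).
by rewrite [cnt _ 4 g]/= E [cnt _ 4 g']/= e'.
Qed.

Lemma epsG_e i g : 0 < i <= n -> valid_g t n g ->
  match eG t n i g with
  | Some g' => epsG t n i g = (epsG t n i g').+1 /\ phiG t n i g' = (phiG t n i g).+1
  | None => epsG t n i g = 0
  end.
Proof.
move=> li v; case E: eG => [g'|]; last by rewrite /epsG /= E.
have [v' f'] := eG_props li v E.
by have := phiG_f li v'; rewrite f' => -[-> ->].
Qed.
End Letters.

(** * Crystals of words *)

Ltac maxlia :=
  repeat match goal with H : context [maxn _ _] |- _ => revert H end;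
  repeat (match goal with |- context [maxn ?a ?b] =>
    lazymatch a with context [maxn] => fail | _ =>
    lazymatch b with context [maxn] => fail | _ => case: (leqP a b) => ? end end end);
  intros; lia.

Lemma epsW_cons t n i x v : epsW t n i (x :: v) =
  maxn (epsG t n i x) (epsW t n i v + epsG t n i x - phiG t n i x).
Proof. by []. Qed.

Lemma phiW_cons t n i x v : phiW t n i (x :: v) =
  maxn (phiW t n i v) (phiG t n i x + phiW t n i v - epsW t n i v).
Proof. by []. Qed.

(** Associativity of the tensor rule: [epsphiW] peels off one letter at a time, whereas words are
    cut at arbitrary places below. *)
Lemma epsphiW_cat t n i u v :
  epsW t n i (u ++ v) = maxn (epsW t n i u) (epsW t n i v + epsW t n i u - phiW t n i u) /\
  phiW t n i (u ++ v) = maxn (phiW t n i v) (phiW t n i u + phiW t n i v - epsW t n i v).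
Proof.
elim: u => [|x u [IH1 IH2]] /=; first by rewrite /epsW /phiW /=; split; maxlia.
by rewrite !epsW_cons !phiW_cons IH1 IH2; split; maxlia.
Qed.

Definition epsW_cat t n i u v := (epsphiW_cat t n i u v).1.
Definition phiW_cat t n i u v := (epsphiW_cat t n i u v).2.

Lemma fW_cat t n i u v : fW t n i (u ++ v) =
  if epsW t n i v < phiW t n i u then omap (cat^~ v) (fW t n i u)
  else omap (cat u) (fW t n i v).
Proof.
elim: u => [|x u IH] /=; first by case: fW.
rewrite IH epsW_cat phiW_cons.
case: (ltnP (epsW t n i u) (phiG t n i x)) => h1.
  case: (ltnP (epsW t n i v) (maxn _ _)) => h2.
    case: (ltnP (maxn _ _) _) => h3; first by case: fG.
    by exfalso; maxlia.
  case: (ltnP (maxn _ _) _) => h3; first by exfalso; maxlia.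
  case: (ltnP _ (phiW t n i u)) => h4; first by exfalso; maxlia.
  by case: fW.
case: (ltnP (epsW t n i v) (maxn _ _)) => h2.
  case: (ltnP (maxn _ _) _) => h3; first by exfalso; maxlia.
  case: (ltnP _ (phiW t n i u)) => h4; last by exfalso; maxlia.
  by case: fW.
case: (ltnP (maxn _ _) _) => h3; first by exfalso; maxlia.
case: (ltnP _ (phiW t n i u)) => h4; first by exfalso; maxlia.
by case: fW.
Qed.

Lemma eW_cat t n i u v : eW t n i (u ++ v) =
  if phiW t n i u < epsW t n i v then omap (cat u) (eW t n i v)
  else omap (cat^~ v) (eW t n i u).
Proof.
elim: u => [|x u IH] /=.
  rewrite /phiW /=; case: posnP => [e0|_]; last by case: eW.
  (* For empty u the other branch is [None], so e_i must vanish on v when eps is 0; this has to hold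
     for invalid words too. *)
  suff -> : eW t n i v = None by [].
  elim: v e0 => //= x v IH; rewrite epsW_cons => h; rewrite ifF; last by maxlia.
  suff -> : eG t n i x = None by [].
  by move: h; rewrite /epsG /=; case: (eG t n i x) => //= y; maxlia.
rewrite IH epsW_cat phiW_cons.
case: (ltnP (phiG t n i x) (epsW t n i u)) => h1.
  case: (ltnP (maxn _ _) (epsW t n i v)) => h2.
    case: (ltnP _ (maxn _ _)) => h3; last by exfalso; maxlia.
    case: (ltnP (phiW t n i u) _) => h4; last by exfalso; maxlia.
    by case: eW.
  case: (ltnP _ (maxn _ _)) => h3; last by exfalso; maxlia.
  case: (ltnP (phiW t n i u) _) => h4; first by exfalso; maxlia.
  by case: eW.
case: (ltnP (maxn _ _) (epsW t n i v)) => h2.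
  case: (ltnP _ (maxn _ _)) => h3; last by exfalso; maxlia.
  case: (ltnP (phiW t n i u) _) => h4; last by exfalso; maxlia.
  by case: eW.
case: (ltnP _ (maxn _ _)) => h3; first by exfalso; maxlia.
by case: eG.
Qed.

(** A bar counts the positions from its own to the end. Hence e_i with i < n, which moves a bar one
    place to the right, and e_n, which deletes bars, both lower the height. *)
Fixpoint spin_height (C : seq bool) : nat :=
  if C is b :: C' then (if b then (size C).+1 else 0) + spin_height C' else 0.

Lemma spin_height_e t n i C C' : okn t n -> size C = n -> 0 < i <= n -> eS t n i C = Some C' ->
  spin_height C' < spin_height C.
Proof.
move=> on sC li; move: C'; move: n i C on sC li.
apply: spin_ind => [i C|b b' C on C'|m i b C sC on li IH C'].
- case: t; first by case: C => [|b [|]] //= _; case: i => [|[]] //= _ C';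
    rewrite /eS /=; case: b => // -[<-] //.
  case: C => [|b [|b' [|]]] //= _; case: i => [|[|[|]]] //= _ C';
    rewrite /eS /=; case: b; case: b' => // -[<-] //.
- rewrite /eS /=; case: b; case: b' => // -[<-] /=; lia.
- rewrite eS_shift //; case E: eS => [D|] //= [<-] /=; have := IH _ E.
  have [-> _ _] := eS_props on sC li E; rewrite sC; lia.
Qed.

Section Words.
Variables (t : ctype) (n : nat).
Hypothesis on : okn t n.

Lemma fW_props i w w' : 0 < i <= n -> valid_word t n w -> fW t n i w = Some w' ->
  [/\ valid_word t n w', size w' = size w, eW t n i w' = Some w,
   phiW t n i w = (phiW t n i w').+1 & epsW t n i w' = (epsW t n i w).+1].
Proof.
move=> li; elim: w w' => //= x v IH w' /andP[vx vv].
case: ltnP => h.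
  case E: fG => [y|] //= [<-].
  have [vy ey] := fG_props on li vx E; have := phiG_f on li vx; rewrite E => -[p1 p2].
  split => //=; first by rewrite vy.
  - rewrite ey ifF //; lia.
  - rewrite !phiW_cons; maxlia.
  - rewrite !epsW_cons; maxlia.
case E: fW => [v'|] //= [<-]; have [s1 s2 s3 s4 s5] := IH _ vv E.
split => /=; first by rewrite vx.
- by rewrite s2.
- by rewrite s3 ifT //=; lia.
- rewrite !phiW_cons; maxlia.
- rewrite !epsW_cons; maxlia.
Qed.

Lemma fW_None i w : 0 < i <= n -> valid_word t n w -> (fW t n i w = None <-> phiW t n i w = 0).
Proof.
move=> li; elim: w => //= x v IH /andP[vx vv]; rewrite phiW_cons.
have := phiG_f on li vx; have := IH vv.
case: ltnP => h.
  by case: fG => [y|] /= _ hy; split => // hm; [exfalso; maxlia|maxlia].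
by case: fW => [v'|] /= [h1 h2] hx; split => // hm; [exfalso; move/(_ (ltac:(maxlia))): h2|move: (h1 erefl); maxlia].
Qed.

Lemma eW_props i w w' : 0 < i <= n -> valid_word t n w -> eW t n i w = Some w' ->
  [/\ valid_word t n w', size w' = size w, fW t n i w' = Some w,
   epsW t n i w = (epsW t n i w').+1 & phiW t n i w' = (phiW t n i w).+1].
Proof.
move=> li; elim: w w' => //= x v IH w' /andP[vx vv].
case: ltnP => h; last first.
  case E: eG => [y|] //= [<-].
  have [vy ey] := eG_props on li vx E; have := epsG_e on li vx; rewrite E => -[p1 p2].
  split => //=; first by rewrite vy.
  - rewrite ey ifT //; lia.
  - rewrite !epsW_cons; maxlia.
  - rewrite !phiW_cons; maxlia.
case E: eW => [v'|] //= [<-]; have [s1 s2 s3 s4 s5] := IH _ vv E.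
split => /=; first by rewrite vx.
- by rewrite s2.
- by rewrite s3 ifF //=; lia.
- rewrite !epsW_cons; maxlia.
- rewrite !phiW_cons; maxlia.
Qed.

Lemma eW_None i w : 0 < i <= n -> valid_word t n w -> (eW t n i w = None <-> epsW t n i w = 0).
Proof.
move=> li; elim: w => //= x v IH /andP[vx vv]; rewrite epsW_cons.
have := epsG_e on li vx; have := IH vv.
case: ltnP => h; last first.
  by case: eG => [y|] /= _ hy; split => // hm; [exfalso; maxlia|maxlia].
by case: eW => [v'|] /= [h1 h2] hx; split => // hm; [exfalso; move/(_ (ltac:(maxlia))): h2|move: (h1 erefl); maxlia].
Qed.

Lemma valid_cstep u v : valid_word t n u -> cstep t n u v -> valid_word t n v /\ size v = size u.
Proof.
move=> vu [i [li [h|h]]]; first by have [] := fW_props li vu h.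
by have [] := eW_props li vu h.
Qed.

Lemma valid_conn u v : valid_word t n u -> conn t n u v -> valid_word t n v.
Proof.
move=> + h; elim: h => // [x y h v1|x y z _ h1 _ h2 /h1/h2 //].
by have [] := valid_cstep v1 h.
Qed.

Lemma size_conn u v : valid_word t n u -> conn t n u v -> size v = size u.
Proof.
move=> + h; elim: h => // [x y h v1|x y z h1 IH1 _ IH2 vx].
  by have [] := valid_cstep v1 h.
by rewrite IH2 ?IH1 //; apply: valid_conn h1.
Qed.

Lemma conn_sym u v : valid_word t n u -> conn t n u v -> conn t n v u.
Proof.
move=> + h; elim: h => [x y [i [li h]] vx|x vx|x y z h1 IH1 _ IH2 vx].
- apply: rt_step; exists i; split => //; case: h => h; [right|left].
    by have [] := fW_props li vx h.
  by have [] := eW_props li vx h.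
- exact: rt_refl.
- apply: rt_trans (IH1 vx); apply: IH2; exact: valid_conn h1.
Qed.

(** Each operator acts inside one tensor factor, so a path in the product splits into a path in each
    factor. *)
Lemma conn_cat u v w : valid_word t n (u ++ v) -> conn t n (u ++ v) w ->
  exists u' v', [/\ w = u' ++ v', conn t n u u' & conn t n v v'].
Proof.
move=> vw h; pose Q w := exists u' v', [/\ w = u' ++ v', conn t n u u' & conn t n v v'].
rewrite -/(Q w); have : Q (u ++ v) by exists u, v; split => //; exact: rt_refl.
elim: h => //= [x y [i [li h]] [u' [v' [xE c1 c2]]]|x y z _ IH1 _ IH2 /IH1 /IH2 //].
have st a b : fW t n i a = Some b \/ eW t n i a = Some b -> conn t n a b.
  by move=> h'; apply: rt_step; exists i.
move: h; rewrite {}xE => -[]; [rewrite fW_cat|rewrite eW_cat].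
  case: ltnP => _; case E: fW => [a|] //= [<-].
    by exists a, v'; split => //; apply: rt_trans c1 (st _ _ _); left.
  by exists u', a; split => //; apply: rt_trans c2 (st _ _ _); left.
case: ltnP => _; case E: eW => [a|] //= [<-].
  by exists u', a; split => //; apply: rt_trans c2 (st _ _ _); right.
by exists a, v'; split => //; apply: rt_trans c1 (st _ _ _); right.
Qed.

(** The tensor rule sends e_i to v exactly when eps_i(v) > phi_i(u), and then it does not vanish
    there. *)
Lemma highest_cat u v : valid_word t n (u ++ v) -> highest t n (u ++ v) ->
  highest t n u /\ forall i, 0 < i <= n -> epsW t n i v <= phiW t n i u.
Proof.
rewrite /valid_word all_cat => /andP[vu vv] h; split=> [i li|i li]; have := h i li; rewrite eW_cat.
  case: ltnP => h1; last by case: eW.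
  by case E: (eW t n i v) => [//|] _; move/(eW_None li vv): E; lia.
case: ltnP => // h1; case E: (eW t n i v) => [//|] _; move/(eW_None li vv): E; lia.
Qed.

Definition glet_height (g : gletter) : nat :=
  match g with V x => rank t n x | S C => spin_height C end.
Definition word_height (w : word) : nat := sumn (map glet_height w).

Lemma glet_height_e i g g' : 0 < i <= n -> valid_g t n g -> eG t n i g = Some g' ->
  glet_height g' < glet_height g.
Proof.
move=> li; case: g => [x|C] /=; last first.
  move=> /eqP v; case E: eS => [D|] //= [<-] /=; exact: spin_height_e on v li E.
case E: eL => [y|] //= v [<-] /=; move: v E.
case: t on x y => [] /= o [k||k] [l||l] //=; repeat case: ifP => //; intros;
 repeat match goal with H : Some _ = Some _ |- _ => case: H => ? end; subst; lia.
Qed.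

Lemma word_height_e i w w' : 0 < i <= n -> valid_word t n w -> eW t n i w = Some w' ->
  word_height w' < word_height w.
Proof.
move=> li; elim: w w' => //= x v IH w' /andP[vx vv].
case: ltnP => h.
  case E: eW => [v'|] //= [<-]; have := IH _ vv E; rewrite /word_height /=; lia.
case E: eG => [y|] //= [<-]; have := glet_height_e li vx E; rewrite /word_height /=; lia.
Qed.

Lemma fpath_conn js w w' : all (fun i => 0 < i <= n) js -> fpath t n js w = Some w' ->
  conn t n w w'.
Proof.
elim: js w' => [|i js IH] w' /=; first by move=> _ [<-]; exact: rt_refl.
case/andP=> li ljs; rewrite -/(fpath t n js w); case E: fpath => [u|] //= h.
by apply: rt_trans (IH _ ljs E) _; apply: rt_step; exists i; split => //; left.
Qed.

(** Raising terminates because every e_i lowers [word_height]. *)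
Lemma exists_highest w : valid_word t n w ->
  exists h js, [/\ highest t n h, all (fun i => 0 < i <= n) js, fpath t n js h = Some w & valid_word t n h].
Proof.
move: {2}(word_height w).+1 (ltnSn (word_height w)) => k; elim: k w => // k IH w hk vw.
case E: [exists i : 'I_n, isSome (eW t n i.+1 w)].
  case/existsP: E => i; case E: eW => [w'|] // _.
  have li : 0 < i.+1 <= n by have := ltn_ord i; lia.
  have [v' _ fw' _ _] := eW_props li vw E; have hl := word_height_e li vw E.
  have [|h [js [h1 h2 h3 h4]]] := IH w' _ v'; first by lia.
  exists h, (i.+1 :: js); split => //=; first by rewrite ltn_ord.
  by rewrite -/(fpath t n js h) h3.
exists w, [::]; split => // i li; move/negbT: E; rewrite negb_exists => /forallP.
have lt : i.-1 < n by lia.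
by move/(_ (Ordinal lt)) => /=; rewrite prednK; [case: eW|lia].
Qed.
End Words.

(** * Relations stable under the crystal operators *)

Section Congruence.
Variables (t : ctype) (n : nat).
Hypothesis on : okn t n.

(** Through [optrel] an operator must vanish on both words or on neither. This part of the condition
    is what forces related words to have the same eps and phi. *)
Definition crystal_closed (Q : word -> word -> Prop) : Prop :=
  forall u v i, Q u v -> 0 < i <= n ->
    optrel Q (fW t n i u) (fW t n i v) /\ optrel Q (eW t n i u) (eW t n i v).

(** eps_i is the number of times e_i applies, and e_i applies to both words alike; hence the
    induction on the value of eps. *)
Lemma closed_eps Q u v i : crystal_closed Q -> Q u v ->
  valid_word t n u -> valid_word t n v -> 0 < i <= n -> epsW t n i u = epsW t n i v.
Proof.
move=> cQ + + + li; move: {2}(epsW t n i u) (erefl (epsW t n i u)) => e.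
elim: e u v => [|e IH] u v eu Quv vu vv; have [_] := cQ _ _ _ Quv li.
  by move/(eW_None on li vu): (eu) => -> /=; case E: eW => // _; rewrite eu; apply/esym/(eW_None on li vv).
have := eW_None on li vu; case Eu: eW => [u'|] [h1 h2]; last by move: (h1 erefl); lia.
case Ev: eW => [v'|] //= Q'.
have [w1 _ _ w2 _] := eW_props on li vu Eu; have [w3 _ _ w4 _] := eW_props on li vv Ev.
by rewrite w2 w4 (IH u' v') //; lia.
Qed.

Lemma closed_phi Q u v i : crystal_closed Q -> Q u v ->
  valid_word t n u -> valid_word t n v -> 0 < i <= n -> phiW t n i u = phiW t n i v.
Proof.
move=> cQ + + + li; move: {2}(phiW t n i u) (erefl (phiW t n i u)) => e.
elim: e u v => [|e IH] u v eu Quv vu vv; have [+ _] := cQ _ _ _ Quv li.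
  by move/(fW_None on li vu): (eu) => -> /=; case E: fW => // _; rewrite eu; apply/esym/(fW_None on li vv).
have := fW_None on li vu; case Eu: fW => [u'|] [h1 h2]; last by move: (h1 erefl); lia.
case Ev: fW => [v'|] //= Q'.
have [w1 _ _ w2 _] := fW_props on li vu Eu; have [w3 _ _ w4 _] := fW_props on li vv Ev.
by rewrite w2 w4 (IH u' v') //; lia.
Qed.

Variable R : word -> word -> Prop.
Hypothesis R_valid : forall u v, R u v -> valid_word t n u /\ valid_word t n v.
Hypothesis R_closed : crystal_closed (fun u v => R u v \/ u = v).

Lemma congr_valid u v : congr R u v -> valid_word t n u = valid_word t n v.
Proof.
elim=> // [a b x y /R_valid[h1 h2]|x y z _ -> _ -> //].
by rewrite /valid_word !all_cat -!/(valid_word _ _ _) h1 h2.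
Qed.

Lemma congr_eps_phi i u v : 0 < i <= n -> congr R u v -> 
  epsW t n i u = epsW t n i v /\ phiW t n i u = phiW t n i v.
Proof.
move=> li; elim=> // [a b x y Rxy|x y _ [-> ->] //|x y z _ [-> ->] //].
have [vx vy] := R_valid Rxy.
have e := closed_eps R_closed (or_introl Rxy) vx vy li.
have p := closed_phi R_closed (or_introl Rxy) vx vy li.
by rewrite !(epsW_cat, phiW_cat) e p.
Qed.

(** Between a and b the tensor rule sees the middle word only through its eps and phi, which both
    sides of a generator share. So an operator acts on the same one of the three parts in both
    words. *)
Lemma congr_closed : crystal_closed (congr R).
Proof.
move=> u v i + li; elim=> {u v} [a b u v Ruv|w|u v _ [IH1 IH2]|u v w _ [IH1 IH2] _ [IH3 IH4]].
- have [e p] := congr_eps_phi li (cg_base [::] [::] Ruv); rewrite /= !cats0 in e p.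
  have [hf he] := R_closed (or_introl Ruv) li.
  rewrite !fW_cat !eW_cat !(epsW_cat, phiW_cat) e p; split.
    case: ifP => _; first by case: fW => //= a'; apply: cg_base.
    case: ifP => _; last by case: fW => //= b'; apply: cg_base.
    case: fW hf => [u'|]; case: fW => [v'|] //= [h|->]; [exact: cg_base|exact: cg_refl].
  case: ifP => _; last by case: eW => //= a'; apply: cg_base.
  case: ifP => _; first by case: eW => //= b'; apply: cg_base.
  case: eW he => [u'|]; case: eW => [v'|] //= [h|->]; [exact: cg_base|exact: cg_refl].
- by split; [case: (fW t n i w)|case: (eW t n i w)] => //= *; exact: cg_refl.
- split.
    by case: (fW t n i u) IH1 => [x|]; case: (fW t n i v) => [y|] //=; exact: cg_sym.
  by case: (eW t n i u) IH2 => [x|]; case: (eW t n i v) => [y|] //=; exact: cg_sym.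
- split.
    case: (fW t n i u) IH1 => [x|]; case: (fW t n i v) IH3 => [y|]; case: (fW t n i w) => [z|] //= h1 h2; exact: cg_trans h2 h1.
  case: (eW t n i u) IH2 => [x|]; case: (eW t n i v) IH4 => [y|]; case: (eW t n i w) => [z|] //= h1 h2; exact: cg_trans h2 h1.
Qed.

Lemma congr_conn u v u' : congr R u v -> conn t n u u' ->
  exists v', conn t n v v' /\ congr R u' v'.
Proof.
move=> + h; elim: h v => [x y [i [li h]] v c|x v c|x y z _ IH1 _ IH2 v c].
- have [cf ce] := congr_closed c li; case: h => h.
    move: cf; rewrite h; case E: fW => [v'|] //= c'; exists v'; split => //.
    by apply: rt_step; exists i; split => //; left.
  move: ce; rewrite h; case E: eW => [v'|] //= c'; exists v'; split => //.
  by apply: rt_step; exists i; split => //; right.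
- exists v; split => //; exact: rt_refl.
- have [v1 [c1 d1]] := IH1 _ c; have [v2 [c2 d2]] := IH2 _ d1.
  by exists v2; split => //; apply: rt_trans c1 c2.
Qed.

Lemma congr_fpath js u v u' : all (fun i => 0 < i <= n) js -> congr R u v ->
  fpath t n js u = Some u' -> exists v', fpath t n js v = Some v' /\ congr R u' v'.
Proof.
elim: js u' => [|i js IH] u' /=; first by move=> _ c [<-]; exists v.
case/andP=> li ljs c; rewrite -!/(fpath t n js _); case E: fpath => [u1|] //= h.
have [v1 [-> c1]] := IH _ ljs c E; have [+ _] := congr_closed c1 li; rewrite h /=.
by case: fW => // v' c'; exists v'.
Qed.

Lemma congr_highest u v : congr R u v -> highest t n u -> highest t n v.
Proof.
move=> c h i li; have [_] := congr_closed c li; rewrite h //; by case: eW.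
Qed.

Lemma congr_cat u u' v v' : congr R u u' -> congr R v v' -> congr R (u ++ v) (u' ++ v').
Proof.
move=> cu cv; apply: (cg_trans (v := u' ++ v)).
  elim: cu => [a b x y h|w|x y _ h|x y z _ h1 _ h2].
  - by rewrite -!catA; apply: cg_base.
  - exact: cg_refl.
  - exact: cg_sym.
  - exact: cg_trans h1 h2.
elim: cv => [a b x y h|w|x y _ h|x y z _ h1 _ h2].
- by rewrite !(catA u' a); apply: cg_base.
- exact: cg_refl.
- exact: cg_sym.
- exact: cg_trans h1 h2.
Qed.

Lemma congr_base u v : R u v -> congr R u v.
Proof. by move=> h; have := cg_base [::] [::] h; rewrite /= !cats0. Qed.

End Congruence.

(** * Words under the shift of rank, and inert factors *)

Definition letter_unshift (x : letter) : letter :=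
  match x with Pos k => Pos k.-1 | Zer => Zer | Neg k => Neg k.-1 end.

Lemma letter_shiftK : cancel letter_shift letter_unshift.
Proof. by case. Qed.

Lemma fW_shift t n i a w : okn t n -> 0 < i <= n ->
  fW t n.+1 i.+1 (map (glift a) w) = omap (map (glift a)) (fW t n i w) /\
  eW t n.+1 i.+1 (map (glift a) w) = omap (map (glift a)) (eW t n i w) /\
  epsphiW t n.+1 i.+1 (map (glift a) w) = epsphiW t n i w.
Proof.
move=> on li; elim: w => //= x v [IH1 [IH2 IH3]].
have eE : epsG t n.+1 i.+1 (glift a x) = epsG t n i x by apply: cnt_morph => g; exact: eG_shift.
have pE : phiG t n.+1 i.+1 (glift a x) = phiG t n i x by apply: cnt_morph => g; exact: fG_shift.
rewrite IH1 IH2 /epsW IH3 eE pE fG_shift // eG_shift //; split; [|split] => //.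
  by case: ifP => _; [case: fG|case: fW].
by case: ifP => _; [case: eW|case: eG].
Qed.

Lemma fW_phi0 t n i w : phiW t n i w = 0 -> fW t n i w = None.
Proof.
elim: w => //= x v IH; rewrite phiW_cons => h; rewrite IH; last by maxlia.
by rewrite ifF //; maxlia.
Qed.

Lemma inert_fe t n i w : epsW t n i w = 0 -> phiW t n i w = 0 -> fW t n i w = None /\ eW t n i w = None.
Proof.
move=> e p; split.
  exact: fW_phi0.
elim: w e p => //= x v IH; rewrite epsW_cons phiW_cons => h1 h2.
rewrite ifF; last by maxlia.
suff -> : eG t n i x = None by [].
have : epsG t n i x = 0 by maxlia.
by rewrite /epsG /=; case: eG.
Qed.

Lemma inert_catl t n i u v : epsW t n i u = 0 -> phiW t n i u = 0 ->
  fW t n i (u ++ v) = omap (cat u) (fW t n i v) /\ eW t n i (u ++ v) = omap (cat u) (eW t n i v).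
Proof.
move=> e p; rewrite fW_cat eW_cat p ltn0; split => //.
case: posnP => // h; have [_ ->] := inert_fe e p; rewrite /=.
suff -> : eW t n i v = None by [].
move: h; elim: (v) => //= x w IH; rewrite epsW_cons => h; rewrite ifF; last by maxlia.
suff -> : eG t n i x = None by [].
by move: h; rewrite /epsG /=; case: (eG t n i x) => //= y; maxlia.
Qed.

Lemma inert_catr t n i u v : epsW t n i v = 0 -> phiW t n i v = 0 ->
  fW t n i (u ++ v) = omap (cat^~ v) (fW t n i u) /\ eW t n i (u ++ v) = omap (cat^~ v) (eW t n i u).
Proof.
move=> e p; rewrite fW_cat eW_cat e ltn0; split => //.
case: posnP => // h; have [-> _] := inert_fe e p; rewrite /=.
by rewrite fW_phi0.
Qed.

Lemma size_fW t n i w w' : fW t n i w = Some w' -> size w' = size w.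
Proof.
elim: w w' => //= x v IH w'; case: ifP => _; first by case: fG => //= y [<-].
by case: fW IH => //= y IH [<-] /=; rewrite (IH y).
Qed.

Lemma size_eW t n i w w' : eW t n i w = Some w' -> size w' = size w.
Proof.
elim: w w' => //= x v IH w'; case: ifP => _; last by case: eG => //= y [<-].
by case: eW IH => //= y IH [<-] /=; rewrite (IH y).
Qed.

Lemma inert1 t n i x : okn t n -> 0 < i <= n -> x = Pos 1 \/ x = Neg 1 ->
  epsW t n.+1 i.+1 [:: V x] = 0 /\ phiW t n.+1 i.+1 [:: V x] = 0.
Proof.
case: i => // i; case: n => // n on li h.
have [e f] : eL t n.+2 i.+2 x = None /\ fL t n.+2 i.+2 x = None.
  case: t on => on; case: h => -> /=; repeat case: ifP => //; intros; exfalso; simpl in *; lia.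
by rewrite /epsW /phiW /= /epsG /phiG /= e f.
Qed.

(** * Bumping letters through spin columns: R6 and R7 *)

(* Bumping a letter through a spin column.  The input None is the carry entering from
   the left of the (partial) column, the output None a carry leaving it on the left. *)
Fixpoint spin_ins (t : ctype) (C : seq bool) (x : option letter) : option letter * seq bool :=
  match C with
  | [::] => (if x is None then Some Zer else None, [::])
  | b :: C' =>
    let last := if t is TD then nilp C' else false in
    match x with
    | None =>
        if ~~ b then (Some (Pos 1), true :: C')
        else if last then (Some (Neg 1), [:: false])
        else let r := spin_ins t C' None in (omap letter_shift r.1, true :: r.2)
    | Some (Pos 1) =>
        if ~~ b then (Some (Pos 1), false :: C')
        else if last then (None, [:: false])
        else let r := spin_ins t C' None in (omap letter_shift r.1, false :: r.2)
    | Some (Neg 1) =>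
        if b then (Some (Neg 1), true :: C') else (None, true :: C')
    | Some x' =>
        let r := spin_ins t C' (Some (letter_unshift x')) in
        match r.1 with
        | None => if b then (Some (Neg 1), false :: r.2) else (None, false :: r.2)
        | Some y => (Some (letter_shift y), b :: r.2)
        end
    end
  end.

Definition ins_out (r : option letter * seq bool) : word :=
  if r.1 is Some y then [:: V y; S r.2] else [:: S r.2].
Definition ins_in (C : seq bool) (x : option letter) : word :=
  S C :: (if x is Some y then [:: V y] else [::]).
(** A lone column is the carry case: its least letter, or 0 in type B when all positions are barred,
    leaves on the left, and a nonzero letter flips its position. Treating carries as words too lets
    one induction cover both kinds of input. *)
Definition ins_word (t : ctype) (w : word) : word :=
  match w with
  | [:: S C] => ins_out (spin_ins t C None)
  | [:: S C; V x] => ins_out (spin_ins t C (Some x))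
  | _ => w
  end.

Definition valid_oletter t n (x : option letter) := if x is Some y then valid_letter t n y else true.

Lemma valid_unshift t n x : valid_letter t n.+1 x -> x <> Pos 1 -> x <> Neg 1 ->
  exists y, valid_letter t n y /\ x = letter_shift y.
Proof.
case: x => [[|[|k]]||[|[|k]]] //= h _ _; [by exists (Pos k.+1)|exists Zer => //|by exists (Neg k.+1)].
Qed.

Lemma spin_ins_shift t b C x : (0 < match x with Pos k | Neg k => k | Zer => 1 end) ->
  spin_ins t (b :: C) (Some (letter_shift x)) =
  let r := spin_ins t C (Some x) in
        match r.1 with
        | None => if b then (Some (Neg 1), false :: r.2) else (None, false :: r.2)
        | Some y => (Some (letter_shift y), b :: r.2)
        end.
Proof. by case: x => [[|k]||[|k]]. Qed.

Lemma valid_shift t n x : valid_letter t n x -> valid_letter t n.+1 (letter_shift x).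
Proof. by case: x => [k||k] /=; lia. Qed.

Lemma spin_ins_valid t C x :
  (if t is TD then ~~ nilp C else true) -> valid_oletter t (size C) x ->
  valid_oletter t (size C) (spin_ins t C x).1 /\ size (spin_ins t C x).2 = size C /\
  (x = None -> (spin_ins t C x).1 <> None).
Proof.
elim: C x => [|b C IH] x; first by case: t => // _; case: x => [[]|] //=; lia.
move=> _ vx; have {}vx : valid_oletter t (size C).+1 x by [].
pose last := if t is TD then nilp C else false.
have {}IH x' : last = false -> valid_oletter t (size C) x' ->
  valid_oletter t (size C) (spin_ins t C x').1 /\ size (spin_ins t C x').2 = size C /\
  (x' = None -> (spin_ins t C x').1 <> None).
  by rewrite /last => E; apply: IH; case: t E {vx last} => // ->.
have vs y : valid_oletter t (size C) y -> valid_oletter t (size C).+1 (omap letter_shift y).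
  by case: y => //= y; apply: valid_shift.
case: x vx => [x|] vx.
  case: (eqVneq x (Pos 1)) => [->|n1].
    rewrite /=; case: b => //=; rewrite -/last; case E: last => //=.
      by move: E; rewrite /last; case: t {vx last IH vs} => // /nilP ->.
    by have [//|h1 [h2 h3]] := IH None E _; rewrite /= h2; split => //; apply: vs.
  case: (eqVneq x (Neg 1)) => [->|n2]; first by rewrite /=; case: b.
  have [y [vy ->]] := valid_unshift vx (elimN eqP n1) (elimN eqP n2).
  have E : last = false.
    by rewrite /last; case: t vy {vx last IH vs} => //; case: C => //; case: y => //= k; lia.
  have [h1 [h2 h3]] := IH (Some y) E vy.
  rewrite spin_ins_shift /=; last by case: y vy {h1 h2 h3} => //= k; lia.
  case: (spin_ins t C _) h1 h2 {h3} => [[z|] D] /= h1 h2; last by case: b; rewrite /= h2.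
  by rewrite h2; split => //; apply: (vs (Some z)).
case: b => //=; rewrite -/last; case E: last => //=.
  by move: E; rewrite /last; case: t {vx last IH vs} => // /nilP ->.
have [//|h1 [h2 h3]] := IH None E _; rewrite /= h2; split; [exact: vs|split => // _].
by move: (h3 erefl); case: (_.1).
Qed.

Definition ins_ok t n i C x :=
  fW t n i (ins_word t (ins_in C x)) = omap (ins_word t) (fW t n i (ins_in C x)) /\
  eW t n i (ins_word t (ins_in C x)) = omap (ins_word t) (eW t n i (ins_in C x)).

Lemma ins_ok_base t i C x : (if t is TD then size C = 2 else size C = 1) ->
  0 < i <= size C -> valid_oletter t (size C) x -> ins_ok t (size C) i C x.
Proof.
case: t.
  case: C => [|b []] //= _; case: i => [|[]] // _ vx.
  case: b; case: x vx => [[[|[|k]]||[|[|k]]]|] //= _; by split.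
case: C => [|b [|b' []]] //= _; case: i => [|[|[]]] // _ vx;
case: b; case: b'; case: x vx => [[[|[|[|k]]]||[|[|[|k]]]]|] //= _; by split.
Qed.

(** f_1 and e_1 see only the positions 1 and 2. Of the remaining positions just the shape of the
    letter they return matters, so the recursive call is generalised to an arbitrary valid result
    and finitely many cases are computed. *)
Lemma ins_ok_first t b b' C x : okn t (size C).+1 -> valid_oletter t (size C).+2 x ->
  ins_ok t (size C).+2 1 (b :: b' :: C) x.
Proof.
move=> on vx.
have on' : is_true (if t is TD then ~~ nilp C else true) by case: t on {vx} => //; case: C.
have P x' : valid_oletter t (size C) x' -> exists y D, spin_ins t C x' = (y, D) /\
   (valid_oletter t (size C) y /\ size D = size C /\ (x' = None -> y <> None)).
  move=> h; have := spin_ins_valid on' h; case: spin_ins => y D /= h'; by exists y, D.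
move: vx on' P {on}; case: t => vx nC P; case: b; case: b'; case: x vx => [[[|[|[|k]]]||[|[|[|k]]]]|] //= vx;
try (by split);
rewrite /ins_ok /ins_in /= ?(negbTE nC) /=;
match goal with |- context [spin_ins ?t C ?x] =>
  have [|[[[|k']||[|k']]|] [D [-> [h1 [h2 h3]]]]] := P x; rewrite ?(negbTE nC) ?/=;
  try (by move: vx; clear; simpl; lia);
  try (by split); try (by case: (h3 erefl)); try (exfalso; move: h1; clear; simpl; lia)
end.
Qed.

Lemma ins_in_shift b C x : ins_in (b :: C) (omap letter_shift x) = map (glift b) (ins_in C x).
Proof. by case: x. Qed.

Lemma ins_word_in t C x : ins_word t (ins_in C x) = ins_out (spin_ins t C x).
Proof. by case: x. Qed.

Lemma fe_ins_in t n i C x : okn t n -> 0 < i <= n -> size C = n -> valid_oletter t n x ->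
  (forall w, fW t n i (ins_in C x) = Some w ->
    exists C' x', [/\ w = ins_in C' x', size C' = n & valid_oletter t n x'] /\ (x' = None <-> x = None)) /\
  (forall w, eW t n i (ins_in C x) = Some w ->
    exists C' x', [/\ w = ins_in C' x', size C' = n & valid_oletter t n x'] /\ (x' = None <-> x = None)).
Proof.
move=> on li sC vx.
rewrite /ins_in; split => w /=.
  case: ifP => _.
    case E: fS => [C'|] //= [<-]; exists C', x; split => //; split => //.
    by have [] := fS_props on sC li E.
  case: x vx => //= x vx; case: ifP => _ //=; case E: fL => [y|] //= [<-].
  by exists C, (Some y); split => //; split => //; apply: valid_fL E.
case: ifP => _; last first.
  case E: eS => [C'|] //= [<-]; exists C', x; split => //; split => //.
  by have [] := eS_props on sC li E.
case: x vx => //= x vx; case E: eL => [y|] //= [<-].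
by exists C, (Some y); split => //; split => //; apply: valid_eL E.
Qed.

(** For f_(i+1) the letters 1 and \bar 1 split off as inert prefixes and suffixes; what remains is
    the bumping of lower rank, or the identity when position 1 settles everything. *)
Lemma ins_ok_step t n i b C x : size C = n -> okn t n -> 0 < i <= n ->
  (forall x, valid_oletter t n x -> ins_ok t n i C x) ->
  valid_oletter t n.+1 x -> ins_ok t n.+1 i.+1 (b :: C) x.
Proof.
move=> sC on li IH.
have nl : (if t is TD then nilp C else false) = false.
  by move: on; rewrite -sC; case: (t) => //; case: (C).
have nl' : is_true (if t is TD then ~~ nilp C else true).
  by move: nl; case: (t) => // ->.
(* The common form of all cases: [suf] and [pre] are the inert letters read and written at position
   1, [c] is the new first bit, and [G] is what happens to the other positions. *)
have lift x0 suf pre c G : valid_oletter t n x0 ->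
  epsW t n.+1 i.+1 suf = 0 /\ phiW t n.+1 i.+1 suf = 0 ->
  epsW t n.+1 i.+1 pre = 0 /\ phiW t n.+1 i.+1 pre = 0 ->
  fW t n i (G (ins_in C x0)) = omap G (fW t n i (ins_in C x0)) /\
  eW t n i (G (ins_in C x0)) = omap G (eW t n i (ins_in C x0)) ->
  (forall C1 x1, size C1 = n -> valid_oletter t n x1 -> (x1 = None <-> x0 = None) ->
     size (G (ins_in C1 x1)) = size (G (ins_in C x0)) ->
     ins_word t (map (glift b) (ins_in C1 x1) ++ suf) = pre ++ map (glift c) (G (ins_in C1 x1))) ->
  let W := map (glift b) (ins_in C x0) ++ suf in
  fW t n.+1 i.+1 (ins_word t W) = omap (ins_word t) (fW t n.+1 i.+1 W) /\
  eW t n.+1 i.+1 (ins_word t W) = omap (ins_word t) (eW t n.+1 i.+1 W).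
  move=> vx0 [s1 s2] [p1 p2] [Gf Ge] H W; rewrite /W {W}.
  have [Hf He] := fe_ins_in on li sC vx0.
  rewrite (H C x0) //.
  have [-> ->] := inert_catl (map (glift c) (G (ins_in C x0))) p1 p2.
  have [-> ->] := inert_catr (map (glift b) (ins_in C x0)) s1 s2.
  have [-> [-> _]] := fW_shift c (G (ins_in C x0)) on li.
  have [-> [-> _]] := fW_shift b (ins_in C x0) on li.
  split.
    rewrite Gf; case E: (fW t n i (ins_in C x0)) => [w|] //=.
    have [C1 [x1 [[wE sC1 vx1] xN]]] := Hf _ E; rewrite wE H //.
    by rewrite -wE; apply: (@size_fW t n i); rewrite Gf E.
  rewrite Ge; case E: (eW t n i (ins_in C x0)) => [w|] //=.
  have [C1 [x1 [[wE sC1 vx1] xN]]] := He _ E; rewrite wE H //.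
  by rewrite -wE; apply: (@size_eW t n i); rewrite Ge E.
have ip : epsW t n.+1 i.+1 [:: V (Pos 1)] = 0 /\ phiW t n.+1 i.+1 [:: V (Pos 1)] = 0.
  by apply: inert1 => //; left.
have im : epsW t n.+1 i.+1 [:: V (Neg 1)] = 0 /\ phiW t n.+1 i.+1 [:: V (Neg 1)] = 0.
  by apply: inert1 => //; right.
have nl1 C1 : size C1 = n -> (if t is TD then nilp C1 else false) = false.
  by move=> s1; rewrite -nl; case: (t) => //; rewrite /nilp s1 sC.
have oi D : fW t n i (id D) = omap id (fW t n i D) /\ eW t n i (id D) = omap id (eW t n i D).
  by split; [case: fW|case: eW].
rewrite /ins_ok; case: x => [x|] vx; last first.
  rewrite -[ins_in (b :: C) None]cats0 (ins_in_shift b C None).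
  case: b lift => [|] lift; last first.
    by apply: (lift None [::] [:: V (Pos 1)] true id) => // C1 [//|] _ _ [_ //].
  apply: (lift None [::] [::] true (ins_word t)) => //; first exact: IH.
  move=> C1 [x1|] s1 vx1 hx _; first by move: (hx.2 erefl).
  by rewrite /= nl1 //=; case: (spin_ins t C1 None) => [[y|] D].
case: (eqVneq x (Pos 1)) vx => [-> _|n1 vx].
  rewrite -[ins_in (b :: C) _]/(map (glift b) (ins_in C None) ++ [:: V (Pos 1)]).
  case: b lift => [|] lift.
    apply: (lift None [:: V (Pos 1)] [::] false (ins_word t)) => //; first exact: IH.
    move=> C1 [x1|] s1 vx1 hx _; first by move: (hx.2 erefl).
    by rewrite /= nl1 //=; case: (spin_ins t C1 None) => [[y|] D].
  by apply: (lift None [:: V (Pos 1)] [:: V (Pos 1)] false id) => // C1 [x1 _ _ hx|//]; move: (hx.2 erefl).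
case: (eqVneq x (Neg 1)) vx => [-> _|n2 vx].
  rewrite -[ins_in (b :: C) _]/(map (glift b) (ins_in C None) ++ [:: V (Neg 1)]).
  case: b lift => [|] lift.
    by apply: (lift None [:: V (Neg 1)] [:: V (Neg 1)] true id) => // C1 [x1 _ _ hx|//]; move: (hx.2 erefl).
  by apply: (lift None [:: V (Neg 1)] [::] true id) => // C1 [x1 _ _ hx|//]; move: (hx.2 erefl).
have [y [vy ->]] := valid_unshift vx (elimN eqP n1) (elimN eqP n2).
rewrite -[ins_in (b :: C) _]cats0 (ins_in_shift b C (Some y)).
(* Whether the other positions absorb the letter decides what position 1 does. The length of the
   result records this, and operators preserve length, so the image under an operator falls into the
   same case. *)
case R: (spin_ins t C (Some y)) => [[z|] D].
  apply: (lift (Some y) [::] [::] b (ins_word t)) => //; first exact: IH.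
  move=> C1 [x1|] s1 vx1 hx; last by move: (hx.1 erefl).
  rewrite !ins_word_in R cats0 -(ins_in_shift b C1 (Some x1)) ins_word_in.
  rewrite [omap _ _]/= spin_ins_shift; last by case: x1 vx1 {hx} => //= k; lia.
  by case: (spin_ins t C1 (Some x1)) => [[u|] D1].
apply: (lift (Some y) [::] (if b then [:: V (Neg 1)] else [::]) false (ins_word t)) => //.
- by case: (b).
- exact: IH.
move=> C1 [x1|] s1 vx1 hx; last by move: (hx.1 erefl).
rewrite !ins_word_in R cats0 -(ins_in_shift b C1 (Some x1)) ins_word_in.
rewrite [omap _ _]/= spin_ins_shift; last by case: x1 vx1 {hx} => //= k; lia.
by case: (spin_ins t C1 (Some x1)) => [[u|] D1] //= _; case: (b).
Qed.

Lemma spin_ins_crystal t n i C x : okn t n -> 0 < i <= n -> size C = n -> valid_oletter t n x ->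
  ins_ok t n i C x.
Proof.
move=> on li sC; move: n i C on sC li x.
apply: spin_ind => [i C sC li x vx|b b' C on x vx|n i b C sC on li IH x].
- exact: ins_ok_base.
- exact: ins_ok_first.
- exact: ins_ok_step.
Qed.

Definition wt2O (x : option letter) (j : nat) : int := if x is Some y then wt2L y j else 0%R.

Lemma wt2L_shift x j : wt2L (letter_shift x) j.+1 = wt2L x j.
Proof. by case: x. Qed.

Lemma wt2O_shift x j : wt2O (omap letter_shift x) j.+1 = wt2O x j.
Proof. by case: x => //= x; rewrite wt2L_shift. Qed.

Lemma spin_ins_wt t C x j : (if t is TD then ~~ nilp C else true) -> valid_oletter t (size C) x ->
  0 < j <= size C ->
  (wt2S (spin_ins t C x).2 j + wt2O (spin_ins t C x).1 j = wt2S C j + wt2O x j)%R.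
Proof.
elim: C x j => [|b C IH] x j; first by case: j.
move=> _ vx lj; have {}vx : valid_oletter t (size C).+1 x by [].
pose last := if t is TD then nilp C else false.
have {}IH x' j' : last = false -> valid_oletter t (size C) x' -> 0 < j' <= size C ->
  (wt2S (spin_ins t C x').2 j' + wt2O (spin_ins t C x').1 j' = wt2S C j' + wt2O x' j')%R.
  by rewrite /last => E; apply: IH; case: t E {vx last} => // ->.
have S1 c D k : wt2S (c :: D) k.+2 = wt2S D k.+1 by [].
case: j lj => // j lj; have {}lj : j <= size C by [].
case: x vx => [x|] vx; last first.
  rewrite /= -/last; case: b => /=; last by case: j {lj} => [|j]; rewrite /wt2S /=; lia.
  case E: last; first by move: E lj; rewrite /last; case: (t) => // /nilP -> /=; case: j.
  case: j lj => [|j] lj /=; last by have := IH None j.+1 E isT lj; rewrite !S1 wt2O_shift.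
  have [] := @spin_ins_valid t C None; rewrite //; first by move: E; rewrite /last; case: (t) => // ->.
  by case: (_.1) => [[[|k]||[|k]]|] //= _ _; rewrite /wt2S /=; lia.
case: (eqVneq x (Pos 1)) => [->|n1].
  rewrite /= -/last; case: b => /=; last by case: j {lj} => [|j]; rewrite /wt2S /=; lia.
  case E: last; first by move: E lj; rewrite /last; case: (t) => // /nilP -> /=; case: j.
  case: j lj => [|j] lj /=; last by have := IH None j.+1 E isT lj; rewrite !S1 wt2O_shift /=.
  have [] := @spin_ins_valid t C None; rewrite //; first by move: E; rewrite /last; case: (t) => // ->.
  by case: (_.1) => [[[|k]||[|k]]|] //= _ _; rewrite /wt2S /=; lia.
case: (eqVneq x (Neg 1)) => [->|n2].
  by rewrite /=; case: b; case: j {lj} => [|j]; rewrite /wt2S /=; lia.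
have [y [vy ->]] := valid_unshift vx (elimN eqP n1) (elimN eqP n2).
have E : last = false.
  by rewrite /last; case: (t) vy => //; case: (C) => //; case: (y) => //= k; lia.
rewrite spin_ins_shift; last by case: y vy {vx} => //= k; lia.
have [] := @spin_ins_valid t C (Some y) _ vy; first by move: E; rewrite /last; case: (t) => // ->.
have := IH (Some y) j E vy; rewrite [wt2O (Some (letter_shift y)) _]/= wt2L_shift.
case: (spin_ins t C (Some y)) => [[z|] D] /= h vz _; case: j lj h => [|j] lj h.
- case: z vz {h} => [[|k]||[|k]] // vz; case: y vy {vx} => [[|l]||[|l]] // vy; rewrite /wt2S /=; lia.
- by rewrite !S1 wt2L_shift; apply: h; lia.
- by case: b; case: y vy {h vx} => [[|l]||[|l]] // vy; rewrite /wt2S /=; lia.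
- by move: (h lj); case: b => /=; rewrite !S1; lia.
Qed.

Lemma leL_shift t n x y : valid_letter t n x -> valid_letter t n y ->
  leL t n.+1 (letter_shift x) (letter_shift y) = leL t n x y.
Proof.
move=> vx vy; rewrite /leL /ltL; congr (_ || _).
  by apply/eqP/eqP => [h|-> //]; rewrite -(letter_shiftK x) h letter_shiftK.
by case: t vx vy; case: x => [k||k]; case: y => [l||l] //=; lia.
Qed.

Lemma leL_1 t n y : 0 < n -> valid_letter t n y ->
  [/\ leL t n.+1 (Pos 1) (letter_shift y), leL t n.+1 (letter_shift y) (Neg 1),
      leL t n.+1 (letter_shift y) (Pos 1) = false & leL t n.+1 (Neg 1) (letter_shift y) = false].
Proof.
move=> n0 vy; rewrite /leL /ltL.
have [/negbTE -> /negbTE ->] : letter_shift y != Pos 1 /\ letter_shift y != Neg 1.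
  by case: y vy => [[|k]||[|k]].
rewrite ![Neg 1 == _]eq_sym ![Pos 1 == _]eq_sym.
have [/negbTE -> /negbTE ->] : letter_shift y != Pos 1 /\ letter_shift y != Neg 1.
  by case: y vy => [[|k]||[|k]].
by case: t vy; case: y => [k||k] //= vy; split; lia.
Qed.

Lemma leL_1N t n : 0 < n -> leL t n.+1 (Pos 1) (Neg 1) /\ leL t n.+1 (Neg 1) (Pos 1) = false.
Proof. by move=> n0; rewrite /leL /ltL; case: t => /=; split; lia. Qed.

Lemma leLxx t n x : leL t n x x.
Proof. by rewrite /leL eqxx. Qed.

Lemma in_spin_cons n b C y : in_spin n.+1 (b :: C) y ->
  y = (if b then Neg 1 else Pos 1) \/ exists z, in_spin n C z /\ y = letter_shift z.
Proof.
case: y => [[|[|k]]||[|[|k]]] //=; try by (case: b; left).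
  by move=> h; right; exists (Pos k.+1).
by move=> h; right; exists (Neg k.+1).
Qed.

Lemma in_spin_shift n b C z : in_spin n C z -> in_spin n.+1 (b :: C) (letter_shift z).
Proof. by case: z => [[|k]||[|k]]. Qed.

Lemma in_spin_valid t n C z : in_spin n C z -> valid_letter t n z.
Proof. by case: z => [k||k] //= /andP[]. Qed.

(** In type B the letter 0 joins the candidates for the output when x is unbarred, as in R7, and
    when a carry enters. *)
Definition ins_out_mem (t : ctype) (n : nat) (C : seq bool) (x : option letter) (y : letter) : bool :=
  in_spin n C y || (if t is TB then (if x is Some x' then (if x' is Pos _ then true else false) else true) && (y == Zer) else false).

Definition ins_spec t n C (x : option letter) (r : option letter) : Prop :=
  match x, r with
  | Some x', Some y => [/\ ins_out_mem t n C x y, leL t n x' y,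
      (forall z, in_spin n C z -> leL t n x' z -> leL t n y z) &
      (forall k, t = TB -> x' = Pos k -> leL t n y Zer)]
  | Some x', None => [/\ forall z, in_spin n C z -> ~~ leL t n x' z & (t = TB -> forall k, x' <> Pos k)]
  | None, Some y => [/\ ins_out_mem t n C x y, (forall z, in_spin n C z -> leL t n y z) & (t = TB -> leL t n y Zer)]
  | None, None => False
  end.

(** Position 1 holds either the least letter 1 or the greatest letter \bar 1. So 1 is the first
    choice for the minimum, and \bar 1 is the last one, taken only after the inner positions have
    been searched in vain. *)
Lemma spin_ins_spec t C x : (if t is TD then ~~ nilp C else true) -> valid_oletter t (size C) x ->
  ins_spec t (size C) C x (spin_ins t C x).1.
Proof.
elim: C x => [|b C IH] x.
  case: t => // _; case: x => [[k|| k]|] //=; try lia; split => //; case=> [k||k] //=; lia.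
move=> _ vx; have {}vx : valid_oletter t (size C).+1 x by [].
case: (posnP (size C)) => [/size0nil C0|n0].
  subst C; clear IH; case: t vx => vx.
    case: b; case: x vx => [[[|[|k]]||[|[|k]]]|] //= _; split => //; case=> [[|[|k]]||[|[|k]]] //.
  by case: b; case: x vx => [[[|[|k]]||[|[|k]]]|] //= _; split => //; case=> [[|[|k]]||[|[|k]]] //.
have nl : (if t is TD then nilp C else false) = false by case: (t) => //; case: (C) n0.
have nl' : is_true (if t is TD then ~~ nilp C else true) by case: (t) => //; case: (C) n0.
have ZV : t = TB -> valid_letter t (size C) Zer by move=> ->.
have [pn np] := leL_1N t n0.
have [v [_ vN]] := spin_ins_valid nl' (x := None) isT.
case RN: (spin_ins t C None).1 v vN (IH None nl' isT) => [y|] vy vN HN; last by case: (vN erefl).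
have {vN vy} [vy [m1 m2 m3]] : valid_letter t (size C) y /\ ins_spec t (size C) C None (Some y) by [].
have [l1 l2 l3 l4] := leL_1 n0 vy.
have B1 z : in_spin (size C).+1 (true :: C) z -> leL t (size C).+1 (letter_shift y) z.
  case/in_spin_cons => [->//|[u [hu ->]]]; rewrite leL_shift ?m2 //.
  exact: in_spin_valid hu.
have B2 : t = TB -> leL t (size C).+1 (letter_shift y) Zer.
  by move=> E; rewrite -[Zer]/(letter_shift Zer) leL_shift ?m3 ?ZV.
have B3 x1 : (if x1 is Some x' then (if x' is Pos _ then true else false) else true) ->
    ins_out_mem t (size C).+1 (true :: C) x1 (letter_shift y).
  move=> hx; move: m1; rewrite /ins_out_mem; case/orP => [h|]; first by rewrite in_spin_shift.
  by case: (t) => // /eqP ->; rewrite hx eqxx orbT.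
have Z1 : t = TB -> leL t (size C).+1 (Pos 1) Zer by move=> ->; rewrite /leL /ltL /=.
case: x vx => [x|] vx; last first.
  rewrite /= nl; case: b => /=; first by rewrite RN; split; [exact: B3|exact: B1|exact: B2].
  split; [by []| |exact: Z1] => z; case/in_spin_cons => [->|[u [hu ->]]]; first exact: leLxx.
  by have [] := leL_1 n0 (in_spin_valid t hu).
case: (eqVneq x (Pos 1)) => [->|n1].
  rewrite /= nl; case: b => /=; last first.
    by split; rewrite ?leLxx // => k E _; apply: Z1.
  by rewrite RN /=; split => //; [exact: B3|move=> z hz _; exact: B1|move=> k E _; exact: B2].
case: (eqVneq x (Neg 1)) => [->|n2].
  rewrite /=; case: b => /=.
    by split; rewrite ?leLxx.
  split; last by [].
  move=> z; case/in_spin_cons => [->|[u [hu ->]]]; first by rewrite np.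
  by have [_ _ _ ->] := leL_1 n0 (in_spin_valid t hu).
have [x0 [vx0 xE]] := valid_unshift vx (elimN eqP n1) (elimN eqP n2).
have xp : 0 < match x0 with Pos k | Neg k => k | Zer => 1 end by case: x0 vx0 {xE} => [[|k]||[|k]].
have := IH (Some x0) nl' vx0; have [] := spin_ins_valid nl' (x := Some x0) vx0.
rewrite xE spin_ins_shift //=.
have [k1 k2 k3 k4] := leL_1 n0 vx0.
case: (spin_ins t C (Some x0)).1 => [z|] vz _ /= ; last first.
  move=> [h1 h2]; case: b => /=; split => //.
  - move=> u; case/in_spin_cons => [-> _|[u' [hu ->]]]; first exact: leLxx.
    by rewrite leL_shift ?(negbTE (h1 _ hu)) //; exact: in_spin_valid hu.
  - by move=> k E; move/(_ E): h2; case: (x0) => [l||l] // /(_ l).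
  - move=> u; case/in_spin_cons => [->|[u' [hu ->]]]; first by rewrite k3.
    by rewrite leL_shift ?h1 //; exact: in_spin_valid hu.
  - by move=> E k; move/(_ E): h2; case: (x0) => [l||l] // /(_ l).
have [j1 j2 j3 j4] := leL_1 n0 vz.
move=> [h1 h2 h3 h4]; split => //.
- move: h1; rewrite /ins_out_mem; case/orP => [h|]; first by rewrite in_spin_shift.
  by case: (t) => // /andP[hx /eqP ->]; rewrite eqxx andbT; case: (x0) hx => // *; rewrite orbT.
- by rewrite leL_shift.
- move=> u; case/in_spin_cons => [->|[u' [hu ->]]]; first by case: b; rewrite ?k3.
  by rewrite !leL_shift ?(in_spin_valid t hu) //; exact: h3.
- move=> k E xk; rewrite -[Zer]/(letter_shift Zer) leL_shift ?ZV //.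
  by case: (x0) xk h4 => [l||l] // _ /(_ l); apply.
Qed.

Lemma spin_greatest_ex t n C : okn t n -> size C = n -> exists z, spin_greatest t n C z.
Proof.
move=> on sC; subst n; elim: C on => [|b C IH]; first by case: t.
move=> on; have {}on : okn t (size C).+1 by [].
case: (posnP (size C)) => [/size0nil ->|n0].
  exists (if b then Neg 1 else Pos 1); split; first by case: b.
  by case=> [[|[|k]]||[|[|k]]]; case: b => //= _; rewrite leLxx.
case: b.
  exists (Neg 1); split => // y /in_spin_cons [->|[u [hu ->]]]; first exact: leLxx.
  by have [_ ->] := leL_1 n0 (in_spin_valid t hu).
have [z [hz h]] : exists z, spin_greatest t (size C) C z.
  move: on; rewrite /=; case E: (okn t (size C)) => on; first exact: IH.
  case: C n0 E on {IH} => [|c [|c' C]] //=; case: t => // _ _ _.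
  exists (if c then Neg 1 else Pos 1); split; first by case: c.
  by case=> [[|[|k]]||[|[|k]]]; case: c => //= _; rewrite leLxx.
exists (letter_shift z); split; first exact: in_spin_shift.
move=> y /in_spin_cons [->|[u [hu ->]]]; first by have [] := leL_1 n0 (in_spin_valid t hz).
by rewrite leL_shift ?h //; [exact: in_spin_valid hu|exact: in_spin_valid hz].
Qed.

Lemma leL_trans t n x y z : leL t n x y -> leL t n y z -> leL t n x z.
Proof.
rewrite /leL /ltL => /orP[/eqP -> //|h] /orP[/eqP <-|h']; first by rewrite h orbT.
by rewrite (ltn_trans h h') orbT.
Qed.

Lemma leL_anti t n x y : leL t n x y -> leL t n y x -> x = y.
Proof.
rewrite /leL /ltL => /orP[/eqP -> //|h] /orP[/eqP -> //|h']; lia.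
Qed.

Lemma wt2S_inj n C D : size C = n -> size D = n -> (forall j, 0 < j <= n -> wt2S C j = wt2S D j) -> C = D.
Proof.
move=> sC sD h; apply: (@eq_from_nth _ false); first by rewrite sC sD.
move=> i; rewrite sC => li; have := h i.+1; rewrite /wt2S /= li => /(_ isT).
by case: (nth false C i); case: (nth false D i).
Qed.

Lemma tri_spin_ins t n C x : okn t n -> size C = n -> valid_letter t n x ->
  tri t n x C <-> (spin_ins t C (Some x)).1 = None.
Proof.
move=> on sC vx; have nl' : is_true (if t is TD then ~~ nilp C else true).
  by move: on; rewrite -sC; case: (t) => //; case: (C).
have := @spin_ins_spec t C (Some x) nl'; rewrite sC => /(_ vx).
case: (_.1) => [y|] /=; last first.
  move=> [h1 h2]; split => // _; have [z [hz gz]] := spin_greatest_ex on sC.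
  by exists z; split => //; exact: h1.
move=> [h1 h2 h3 h4]; split => // -[z [[hz gz] nz]]; exfalso.
move/orP: h1 => [h1|h1]; first by move: nz; rewrite (leL_trans h2 (gz _ h1)).
(* The output is 0, so x is an unbarred letter k. One of k and \bar k lies in the column, and both
   are at least x, which contradicts [tri]. *)
case: t on vx nl' gz nz h1 h2 h3 h4 => // on; case: x => [k||k] // vx _ gz nz _ _ _ _.
case E: (in_spin n C (Pos k)); first by move: nz; rewrite (gz _ E).
have E' : in_spin n C (Neg k) by move: vx E => /=; case: (nth false C k.-1); case: (0 < k <= n).
move: nz; rewrite (leL_trans _ (gz _ E')) //; move: vx; rewrite /leL /ltL /=; lia.
Qed.

(** R6 and R7 in one relation: the minimality of x' and the weight of the new column leave only one
    possible right hand side, the result of bumping. *)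
Definition spin_rel (t : ctype) (n : nat) (u v : word) : Prop :=
  exists C x, [/\ size C = n, valid_letter t n x, u = ins_in C (Some x) & v = ins_word t u].

Lemma spin_rel_closed t n : okn t n -> crystal_closed t n (spin_rel t n).
Proof.
move=> on u v i [C [x [sC vx -> ->]]] li.
have [-> ->] := spin_ins_crystal on li sC (x := Some x) vx.
have [Hf He] := fe_ins_in on li sC (x := Some x) vx.
split.
  case E: (fW t n i _) => [w|] //=; have [C1 [[x1|] [[-> s1 v1] h]]] := Hf _ E.
    by exists C1, x1; split.
  by move: (h.1 erefl).
case E: (eW t n i _) => [w|] //=; have [C1 [[x1|] [[-> s1 v1] h]]] := He _ E.
  by exists C1, x1; split.
by move: (h.1 erefl).
Qed.

Lemma spin_rel_R6 t n C x C' : okn t n -> size C = n -> valid_letter t n x -> size C' = n ->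
  tri t n x C -> (forall j, (0 < j <= n)%N -> wt2S C' j = wt2S C j + wt2L x j)%R ->
  spin_rel t n [:: S C; V x] [:: S C'].
Proof.
move=> on sC vx sC' tr hw; exists C, x; split => //.
have nl' : is_true (if t is TD then ~~ nilp C else true).
  by move: on; rewrite -sC; case: (t) => //; case: (C).
rewrite -/(ins_in C (Some x)) ins_word_in; move/(tri_spin_ins on sC vx): tr.
have := @spin_ins_valid t C (Some x) nl'; have := @spin_ins_wt t C (Some x); rewrite sC.
case: (spin_ins t C _) => y D /= h1 h2 yN; subst y; rewrite /ins_out /=; do 2 f_equal.
have [_ [sD _]] := h2 vx.
apply: (wt2S_inj sC' sD) => j lj; have := h1 j nl' vx lj; rewrite hw //= => <-; lia.
Qed.

Lemma spin_rel_R7 t n C x x' C' : okn t n -> size C = n -> valid_letter t n x -> size C' = n ->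
  ~ tri t n x C -> 
  ins_out_mem t n C (Some x) x' -> leL t n x x' ->
  (forall y, ins_out_mem t n C (Some x) y -> leL t n x y -> leL t n x' y) ->
  (forall j, (0 < j <= n)%N -> wt2S C' j = wt2S C j + wt2L x j - wt2L x' j)%R ->
  spin_rel t n [:: S C; V x] [:: V x'; S C'].
Proof.
move=> on sC vx sC' tr mx lx mn hw; exists C, x; split => //.
have nl' : is_true (if t is TD then ~~ nilp C else true).
  by move: on; rewrite -sC; case: (t) => //; case: (C).
rewrite -/(ins_in C (Some x)) ins_word_in; have tN := (tri_spin_ins on sC vx).2.
have := @spin_ins_valid t C (Some x) nl'; have := @spin_ins_wt t C (Some x).
have := @spin_ins_spec t C (Some x) nl'; rewrite sC.
case: (spin_ins t C _) tN => -[y|] D /= tN h0 h1 h2; last by case: tr; exact: tN.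
have [_ [sD _]] := h2 vx; have [g1 g2 g3 g4] := h0 vx.
have yx : x' = y.
  apply: (@leL_anti t n); first exact: mn.
  move/orP: mx => [hx|hx]; first exact: g3.
  by case: (t) x vx hx g4 {mn hw tr lx tN h0 h1 h2 g1 g2 g3} => // -[k||k] // _ /eqP -> h; exact: (h k).
subst y; rewrite /ins_out /=; do 3 f_equal.
apply: (wt2S_inj sC' sD) => j lj; have := h1 j nl' vx lj; rewrite hw //=; lia.
Qed.

(** * Columns as state sequences *)

(* A column is coded by the pairs (k in C, \bar k in C) for k = 1, 2, ... and by its core: the
   c letters 0 in type B, and in type D an alternating string of c letters n, \bar n (of index 1
   after shifting), starting with \bar n when b holds; n itself is then not a state. *)
Fixpoint alt (b : bool) (c : nat) : seq letter :=
  if c is c'.+1 then (if b then Neg 1 else Pos 1) :: alt (~~ b) c' else [::].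

Definition core t b c : seq letter := if t is TD then alt b c else nseq c Zer.

Fixpoint colw (st : seq (bool * bool)) (co : seq letter) : seq letter :=
  if st is s :: st' then
    nseq s.1 (Pos 1) ++ map letter_shift (colw st' co) ++ nseq s.2 (Neg 1)
  else co.

Definition cdata := (seq (bool * bool) * bool * nat)%type.
Definition cword (t : ctype) (x : cdata) : word := Vw (colw x.1.1 (core t x.1.2 x.2)).
Definition dcons (s : bool * bool) (x : cdata) : cdata := (s :: x.1.1, x.1.2, x.2).

(** f_1 on the states of positions 1 and 2. The column reads 1, 2, a block of further letters, \bar
    2, \bar 1, with each outer letter present or absent; the block is inert for node 1, so a table
    suffices. *)
Definition f2 (s1 s2 : bool * bool) : option ((bool * bool) * (bool * bool)) :=
  match s1, s2 with
  | (true, false), (false, false) => Some ((false, false), (true, false))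
  | (false, false), (false, true) => Some ((false, true), (false, false))
  | (true, false), (false, true) => Some ((false, false), (true, true))
  | (false, false), (true, true) => Some ((false, true), (true, false))
  | (true, false), (true, true) => Some ((true, true), (true, false))
  | (true, true), (false, true) => Some ((false, true), (true, true))
  | _, _ => None
  end.

Definition e2 (s1 s2 : bool * bool) : option ((bool * bool) * (bool * bool)) :=
  match s1, s2 with
  | (false, false), (true, false) => Some ((true, false), (false, false))
  | (false, true), (false, false) => Some ((false, false), (false, true))
  | (false, false), (true, true) => Some ((true, false), (false, true))
  | (false, true), (true, false) => Some ((false, false), (true, true))
  | (true, true), (true, false) => Some ((true, false), (true, true))
  | (false, true), (true, true) => Some ((true, true), (false, true))
  | _, _ => None
  end.

Definition flastB (s : bool * bool) (c : nat) : option cdata :=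
  match s, c with
  | (true, false), _ => Some ([:: (false, false)], false, c.+1)
  | (false, false), c'.+1 => Some ([:: (false, true)], false, c')
  | _, _ => None
  end.

Definition elastB (s : bool * bool) (c : nat) : option cdata :=
  match s, c with
  | (false, true), _ => Some ([:: (false, false)], false, c.+1)
  | (false, false), c'.+1 => Some ([:: (true, false)], false, c')
  | _, _ => None
  end.

(* f_1 and e_1 for rank 2 in type D; b tells whether the alternating core starts with a bar *)
Definition flastD (s : bool * bool) (b : bool) (c : nat) : option cdata :=
  match s, b, odd c with
  | (false, false), false, false => if c is c'.+1 then Some ([:: (false, true)], false, c') else None
  | (false, false), true, true => Some ([:: (false, true)], true, c.-1)
  | (true, false), false, false => if c is c'.+1 then Some ([:: (true, true)], false, c')
                                   else Some ([:: (false, false)], false, 1)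
  | (true, false), true, _ => Some ([:: (false, false)], false, c.+1)
  | (true, true), true, true => Some ([:: (false, true)], false, c.+1)
  | _, _, _ => None
  end.

Definition elastD (s : bool * bool) (b : bool) (c : nat) : option cdata :=
  match s, b, odd c with
  | (false, false), false, _ => if c is c'.+1 then Some ([:: (true, false)], true, c') else None
  | (false, true), false, false => if c is c'.+1 then Some ([:: (true, true)], true, c')
                                   else Some ([:: (false, false)], true, 1)
  | (false, true), false, true => Some ([:: (false, false)], false, c.+1)
  | (false, true), true, false => Some ([:: (false, false)], true, c.+1)
  | (true, true), false, true => Some ([:: (true, false)], false, c.+1)
  | _, _, _ => None
  end.

(** The diagram automorphism of type D exchanges the nodes n-1 and n and the letters n and \bar n.
    So the table for node n is the one for node n-1 conjugated by this flip of the core. *)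
Definition dflip (x : cdata) : cdata := (x.1.1, ~~ x.1.2, x.2).

Definition flast t i s b c : option cdata :=
  if t is TB then flastB s c
  else if i == 1 then flastD s b c else omap dflip (flastD s (~~ b) c).
Definition elast t i s b c : option cdata :=
  if t is TB then elastB s c
  else if i == 1 then elastD s b c else omap dflip (elastD s (~~ b) c).

Fixpoint fcol (t : ctype) (i : nat) (st : seq (bool * bool)) (b : bool) (c : nat) : option cdata :=
  match st with
  | [::] => None
  | s :: st' =>
    match st' with
    | [::] => flast t i s b c
    | s' :: st'' =>
      if i == 1 then omap (fun q => (q.1 :: q.2 :: st'', b, c)) (f2 s s')
      else omap (dcons s) (fcol t i.-1 st' b c)
    end
  end.

Fixpoint ecol (t : ctype) (i : nat) (st : seq (bool * bool)) (b : bool) (c : nat) : option cdata :=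
  match st with
  | [::] => None
  | s :: st' =>
    match st' with
    | [::] => elast t i s b c
    | s' :: st'' =>
      if i == 1 then omap (fun q => (q.1 :: q.2 :: st'', b, c)) (e2 s s')
      else omap (dcons s) (ecol t i.-1 st' b c)
    end
  end.

Lemma Vw_cat u v : Vw (u ++ v) = Vw u ++ Vw v.
Proof. exact: map_cat. Qed.

Lemma Vw_shift a u : Vw (map letter_shift u) = map (glift a) (Vw u).
Proof. by rewrite /Vw -!map_comp. Qed.

Lemma cword_cons t s x : cword t (dcons s x) =
  Vw (nseq s.1 (Pos 1)) ++ (map (glift false) (cword t x) ++ Vw (nseq s.2 (Neg 1))).
Proof. by rewrite /cword /= !Vw_cat (Vw_shift false). Qed.

Lemma fe_mid t n i X M Y : epsW t n i M = 0 -> phiW t n i M = 0 ->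
  fW t n i (X ++ M ++ Y) = (if epsW t n i Y < phiW t n i X
     then omap (fun X' => X' ++ M ++ Y) (fW t n i X) else omap (fun Y' => X ++ M ++ Y') (fW t n i Y)) /\
  eW t n i (X ++ M ++ Y) = (if phiW t n i X < epsW t n i Y
     then omap (fun Y' => X ++ M ++ Y') (eW t n i Y) else omap (fun X' => X' ++ M ++ Y) (eW t n i X)).
Proof.
move=> e p; rewrite fW_cat eW_cat.
have [-> ->] := inert_catl Y e p.
have -> : epsW t n i (M ++ Y) = epsW t n i Y by rewrite epsW_cat e p; maxlia.
by split; case: ifP => _ //; [case: (fW t n i Y)|case: (eW t n i Y)].
Qed.

Lemma inert_core2 t n w : (forall x, x \in w -> match x with Pos k | Neg k => 0 < k | Zer => true end) ->
  epsW t n.+2 1 (map (glift false) (map (glift false) (Vw w))) = 0 /\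
  phiW t n.+2 1 (map (glift false) (map (glift false) (Vw w))) = 0.
Proof.
elim: w => [|x w IH] h //=; have [|e p] := IH; first by move=> y hy; apply: h; rewrite inE hy orbT.
rewrite epsW_cons phiW_cons e p.
have hx := h x (mem_head _ _).
have -> : epsG t n.+2 1 (V (letter_shift (letter_shift x))) = 0.
  by rewrite /epsG; case: t {IH h e p}; case: x hx => [[|k]||[|k]].
have -> : phiG t n.+2 1 (V (letter_shift (letter_shift x))) = 0.
  by rewrite /phiG; case: t {IH h e p}; case: x hx => [[|k]||[|k]].
by rewrite !maxnE; lia.
Qed.

Definition lpos (x : letter) : bool := match x with Pos k | Neg k => 0 < k | Zer => true end.

Lemma alt_lpos b c : all lpos (alt b c).
Proof. by elim: c b => //= c IH b; rewrite IH; case: b. Qed.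

Lemma colw_lpos st co : all lpos co -> all lpos (colw st co).
Proof.
move=> h; elim: st => //= -[a b] st IH; rewrite !all_cat all_map; apply/and3P; split.
- by case: a.
- by apply: sub_all IH => -[k||k].
- by case: b.
Qed.

Lemma core_lpos t b c : all lpos (core t b c).
Proof. by case: t => /=; [elim: c|exact: alt_lpos]. Qed.

Lemma colf_first t n s s' x : 
  fW t n.+2 1 (cword t (dcons s (dcons s' x))) =
    omap (fun q => cword t (dcons q.1 (dcons q.2 x))) (f2 s s') /\
  eW t n.+2 1 (cword t (dcons s (dcons s' x))) =
    omap (fun q => cword t (dcons q.1 (dcons q.2 x))) (e2 s s').
Proof.
have [|e p] := @inert_core2 t n (colw x.1.1 (core t x.1.2 x.2)).
  by move=> y; move/(allP (colw_lpos _ (core_lpos _ _ _))).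
rewrite -/(cword t x) in e p; move: e p.
set M := map _ _ => e p.
have wE q1 q2 : cword t (dcons q1 (dcons q2 x)) =
  ((Vw (nseq q1.1 (Pos 1)) ++ Vw (nseq q2.1 (Pos 2))) ++ M ++ (Vw (nseq q2.2 (Neg 2)) ++ Vw (nseq q1.2 (Neg 1)))).
  rewrite !cword_cons -!catA !map_cat -!catA -/M; congr (_ ++ (_ ++ (_ ++ (_ ++ _)))).
    by case: q2 => [[] []].
  by case: q2 => [[] []].
rewrite wE; have [-> ->] := fe_mid (Vw (nseq s.1 (Pos 1)) ++ Vw (nseq s'.1 (Pos 2)))
  (Vw (nseq s'.2 (Neg 2)) ++ Vw (nseq s.2 (Neg 1))) e p.
clear e p; clearbody M.
by case: s => [[] []]; case: s' => [[] []]; case: t x wE => x wE; rewrite /= ?wE; split.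
Qed.

(** Neighbouring zeros cancel in the tensor rule, so a nonempty block has eps = phi = 1 whatever its
    length; f_n moves its last zero and e_n its first. *)
Lemma zeros_fe c : let w := Vw (nseq c Zer) in
  [/\ epsW TB 1 1 w = (0 < c), phiW TB 1 1 w = (0 < c),
      fW TB 1 1 w = (if c is c'.+1 then Some (Vw (nseq c' Zer) ++ [:: V (Neg 1)]) else None) &
      eW TB 1 1 w = (if c is c'.+1 then Some (V (Pos 1) :: Vw (nseq c' Zer)) else None)].
Proof.
elim: c => //= c [e p f h]; rewrite epsW_cons phiW_cons e p f.
have -> : epsG TB 1 1 (V Zer) = 1 by [].
have -> : phiG TB 1 1 (V Zer) = 1 by [].
by case: c {e p f h} => [|c].
Qed.

Lemma collast_B s b c :
  fW TB 1 1 (cword TB ([:: s], b, c)) = omap (cword TB) (flastB s c) /\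
  eW TB 1 1 (cword TB ([:: s], b, c)) = omap (cword TB) (elastB s c).
Proof.
have zs k : map letter_shift (nseq k Zer) = nseq k Zer by elim: k => //= k ->.
have zr k : Vw (nseq k Zer) ++ [:: V Zer] = V Zer :: Vw (nseq k Zer) by elim: k => //= k ->.
have [e p f h] := zeros_fe c.
rewrite /cword /= !Vw_cat zs.
rewrite fW_cat eW_cat epsW_cat (fW_cat _ _ _ (Vw (nseq c Zer))) (eW_cat _ _ _ (Vw (nseq c Zer))) e p f h.
case: s => [[] []] /=.
- by case: c {e p f h} => [|c] /=.
- by case: c {e p f h} => [|c] /=; rewrite ?zs ?cats0.
- case: c {e p f h} => [|c] //=; split => //; congr Some; rewrite zs.
  by rewrite /= zr cats0.
- by case: c {e p f h} => [|c] /=; rewrite ?zs ?Vw_cat ?cats0.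
Qed.

(** In rank 2 a neighbouring pair \bar 2, 2 cancels for node 1. Thus only a leading 2 can be raised
    and only a final \bar 2 lowered. *)
Lemma alt_fe c b : let w := Vw (map letter_shift (alt b c)) in
  [/\ epsW TD 2 1 w = ~~ b && (0 < c), phiW TD 2 1 w = (0 < c) && (b == odd c),
      fW TD 2 1 w = (if (0 < c) && (b == odd c)
        then Some (Vw (map letter_shift (alt b c.-1)) ++ [:: V (Neg 1)]) else None) &
      eW TD 2 1 w = (if ~~ b && (0 < c) then Some (V (Pos 1) :: Vw (map letter_shift (alt (~~ b) c.-1))) else None)].
Proof.
elim: c b => [|c IH] b; first by case: b; split.
have [e p f h] := IH (~~ b); rewrite /= epsW_cons phiW_cons e p f h.
case: b {IH e p f h} => /=.
  have -> : epsG TD 2 1 (V (Neg 2)) = 0 by [].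
  have -> : phiG TD 2 1 (V (Neg 2)) = 1 by [].
  by case: c => [|c] //=; case: (odd c).
have -> : epsG TD 2 1 (V (Pos 2)) = 1 by [].
have -> : phiG TD 2 1 (V (Pos 2)) = 0 by [].
by case: c => [|c] //=; case: (odd c).
Qed.

Lemma alt_rcons b c : alt b c.+1 = alt b c ++ [:: if b (+) odd c then Neg 1 else Pos 1].
Proof.
elim: c b => [|c IH] b; first by case: b.
rewrite -[alt b c.+2]/((if b then Neg 1 else Pos 1) :: alt (~~ b) c.+1) IH /=.
by case: b; case: (odd c).
Qed.

Lemma collast_D1 s b c :
  fW TD 2 1 (cword TD ([:: s], b, c)) = omap (cword TD) (flastD s b c) /\
  eW TD 2 1 (cword TD ([:: s], b, c)) = omap (cword TD) (elastD s b c).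
Proof.
have [e p f h] := alt_fe c b.
rewrite /cword /= !Vw_cat.
rewrite fW_cat eW_cat epsW_cat (fW_cat _ _ _ (Vw (map _ _))) (eW_cat _ _ _ (Vw (map _ _))) e p f h.
have sr k b' : Vw (map letter_shift (alt b' k)) ++ [:: V (if b' (+) odd k then Neg 2 else Pos 2)] =
    Vw (map letter_shift (alt b' k.+1)).
  by rewrite alt_rcons map_cat Vw_cat; case: ifP.
have := sr c b; have oS k : odd k.+1 = ~~ odd k by [].
case: s => [[] []]; case: b {e p f h}; case: c sr => [|c] sr; rewrite /flastD /elastD ?oS;
  try (case oc: (odd c)); rewrite /= ?oc /= ?Vw_cat ?cats0 /=; try (by split); by move=> E; split; rewrite ?E.
Qed.

Definition swap2 (x : letter) : letter :=
  match x with Pos 2 => Neg 2 | Neg 2 => Pos 2 | _ => x end.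

Lemma swap2_crystal w :
  [/\ epsW TD 2 2 (Vw (map swap2 w)) = epsW TD 2 1 (Vw w),
      phiW TD 2 2 (Vw (map swap2 w)) = phiW TD 2 1 (Vw w),
      forall w', fW TD 2 1 (Vw w) = Some (Vw w') -> fW TD 2 2 (Vw (map swap2 w)) = Some (Vw (map swap2 w')) &
      forall w', eW TD 2 1 (Vw w) = Some (Vw w') -> eW TD 2 2 (Vw (map swap2 w)) = Some (Vw (map swap2 w'))] /\
  (fW TD 2 1 (Vw w) = None -> fW TD 2 2 (Vw (map swap2 w)) = None) /\
  (eW TD 2 1 (Vw w) = None -> eW TD 2 2 (Vw (map swap2 w)) = None).
Proof.
elim: w => [|x w [[e p f h] [fn en]]] //.
have eE : epsG TD 2 2 (V (swap2 x)) = epsG TD 2 1 (V x) by clear; case: x => [[|[|[|k]]]||[|[|[|k]]]].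
have pE : phiG TD 2 2 (V (swap2 x)) = phiG TD 2 1 (V x) by clear; case: x => [[|[|[|k]]]||[|[|[|k]]]].
have fE : fL TD 2 2 (swap2 x) = omap swap2 (fL TD 2 1 x) by clear; case: x => [[|[|[|k]]]||[|[|[|k]]]].
have hE : eL TD 2 2 (swap2 x) = omap swap2 (eL TD 2 1 x) by clear; case: x => [[|[|[|k]]]||[|[|[|k]]]].
have Vinj : injective Vw by apply: inj_map => a b [].
have Vf w' : fW TD 2 1 (Vw w) = Some w' -> exists w1, w' = Vw w1.
  elim: (w) w' => //= y v IH w'; case: ifP => _.
    by case: fL => //= z [<-]; exists (z :: v).
  by case E: fW => [v'|] //= [<-]; have [w1 ->] := IH _ E; exists (y :: w1).
have Ve w' : eW TD 2 1 (Vw w) = Some w' -> exists w1, w' = Vw w1.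
  elim: (w) w' => //= y v IH w'; case: ifP => _; last first.
    by case: eL => //= z [<-]; exists (z :: v).
  by case E: eW => [v'|] //= [<-]; have [w1 ->] := IH _ E; exists (y :: w1).
rewrite [map swap2 _]/= ![Vw (_ :: _)]/=; split; [split|split].
- by rewrite !epsW_cons e eE pE.
- by rewrite !phiW_cons e p pE.
- rewrite /= e pE fE => w'; case: ifP => _.
    case: fL => //= y [hw]; rewrite -[V y :: _]/(Vw (y :: w)) in hw; by rewrite -(Vinj _ _ hw).
  case E: (fW TD 2 1 (Vw w)) => [v|] //=; have [v' vE] := Vf _ E; subst v; rewrite (f _ E) /= => -[hw].
  rewrite -[V x :: _]/(Vw (x :: v')) in hw; by rewrite -(Vinj _ _ hw).
- rewrite /= e pE hE => w'; case: ifP => _; last first.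
    case: eL => //= y [hw]; rewrite -[V y :: _]/(Vw (y :: w)) in hw; by rewrite -(Vinj _ _ hw).
  case E: (eW TD 2 1 (Vw w)) => [v|] //=; have [v' vE] := Ve _ E; subst v; rewrite (h _ E) /= => -[hw].
  rewrite -[V x :: _]/(Vw (x :: v')) in hw; by rewrite -(Vinj _ _ hw).
- rewrite /= e pE fE; case: ifP => _; first by case: fL.
  by case E: (fW TD 2 1 (Vw w)) => [v|] //= _; rewrite fn.
- rewrite /= e pE hE; case: ifP => _; last by case: eL.
  by case E: (eW TD 2 1 (Vw w)) => [v|] //= _; rewrite en.
Qed.

Lemma swap2_cword s b c : map swap2 (colw [:: s] (alt b c)) = colw [:: s] (alt (~~ b) c).
Proof.
case: s => p q; rewrite /= !map_cat; congr (_ ++ (_ ++ _)); [by case: p| |by case: q].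
by elim: c b => //= c IH b; rewrite IH; case: b.
Qed.

Lemma flastD_size s b c x : flastD s b c = Some x -> exists s', x.1.1 = [:: s'].
Proof.
by case: s => [[] []]; case: b; case: c => [|c] //=; try (case: (odd c)) => //=; case=> <- /=; eexists.
Qed.
Lemma elastD_size s b c x : elastD s b c = Some x -> exists s', x.1.1 = [:: s'].
Proof.
by case: s => [[] []]; case: b; case: c => [|c] //=; try (case: (odd c)) => //=; case=> <- /=; eexists.
Qed.

Lemma collast_D2 s b c :
  fW TD 2 2 (cword TD ([:: s], b, c)) = omap (cword TD) (flast TD 2 s b c) /\
  eW TD 2 2 (cword TD ([:: s], b, c)) = omap (cword TD) (elast TD 2 s b c).
Proof.
have [f1 e1] := collast_D1 s (~~ b) c; rewrite /flast /elast [2 == 1]/=.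
have [[_ _ f h] [fn en]] := swap2_crystal (colw [:: s] (alt (~~ b) c)).
rewrite swap2_cword negbK in f h fn en; split.
  rewrite /cword /= in f1 fn f *; case E: flastD f1 => [x|] /= f1; last by rewrite fn.
  have [s' xs] := flastD_size E; rewrite xs in f1.
  by rewrite (f _ f1) /= xs swap2_cword.
rewrite /cword /= in e1 en h *; case E: elastD e1 => [x|] /= e1; last by rewrite en.
have [s' xs] := elastD_size E; rewrite xs in e1.
by rewrite (h _ e1) /= xs swap2_cword.
Qed.

Definition crk (t : ctype) (st : seq (bool * bool)) := size st + (if t is TD then 1 else 0).

Lemma col_step t n i s x : okn t n -> 0 < i <= n ->
  fW t n.+1 i.+1 (cword t (dcons s x)) = omap (fun w => Vw (nseq s.1 (Pos 1)) ++ (map (glift false) w ++ Vw (nseq s.2 (Neg 1)))) (fW t n i (cword t x)) /\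
  eW t n.+1 i.+1 (cword t (dcons s x)) = omap (fun w => Vw (nseq s.1 (Pos 1)) ++ (map (glift false) w ++ Vw (nseq s.2 (Neg 1)))) (eW t n i (cword t x)).
Proof.
move=> on li; rewrite cword_cons.
have [p1 p2] : epsW t n.+1 i.+1 (Vw (nseq s.1 (Pos 1))) = 0 /\ phiW t n.+1 i.+1 (Vw (nseq s.1 (Pos 1))) = 0.
  by case: (s.1) => //; apply: inert1 => //; left.
have [q1 q2] : epsW t n.+1 i.+1 (Vw (nseq s.2 (Neg 1))) = 0 /\ phiW t n.+1 i.+1 (Vw (nseq s.2 (Neg 1))) = 0.
  by case: (s.2) => //; apply: inert1 => //; right.
have [-> ->] := inert_catl (map (glift false) (cword t x) ++ Vw (nseq s.2 (Neg 1))) p1 p2.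
have [-> ->] := inert_catr (map (glift false) (cword t x)) q1 q2.
have [-> [-> _]] := fW_shift false (cword t x) on li.
by split; [case: fW|case: eW].
Qed.

Lemma col_crystal t n i st b c : okn t n -> crk t st = n -> 0 < i <= n ->
  fW t n i (cword t (st, b, c)) = omap (cword t) (fcol t i st b c) /\
  eW t n i (cword t (st, b, c)) = omap (cword t) (ecol t i st b c).
Proof.
move=> on sE; subst n; move=> li; elim: st i on li => [|s st IH] i on li; first by case: t on li.
case: st IH on li => [|s' st] IH on li.
  case: t on li {IH} => /= on li; first by have i1 : i = 1; [move: li; rewrite /crk /=; lia|subst i; exact: collast_B].
  by case: i li => [|[|[|i]]] // _; [exact: collast_D1|exact: collast_D2].
have on' : okn t (crk t (s' :: st)) by case: (t); rewrite /crk /=; lia.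
case: (eqVneq i 1) => [->|i1].
  have -> : crk t [:: s, s' & st] = (crk t st).+2 by rewrite /crk /=; lia.
  have [-> ->] := colf_first t (crk t st) s s' (st, b, c); rewrite /=.
  by split; [case: f2|case: e2].
case: i li i1 => // i li i1; have li' : 0 < i <= crk t (s' :: st).
  by move: li i1; rewrite /crk /=; lia.
have -> : crk t [:: s, s' & st] = (crk t (s' :: st)).+1 by rewrite /crk /=; lia.
rewrite -[([:: s, s' & st], b, c)]/(dcons s (s' :: st, b, c)).
have [-> ->] := col_step s (s' :: st, b, c) on' li'; have [-> ->] := IH i on' li'.
rewrite [fcol t i.+1 _ _ _]/= [ecol t i.+1 _ _ _]/= (negbTE i1).
rewrite -/(fcol t i (s' :: st) b c) -/(ecol t i (s' :: st) b c).
split; [case: fcol|case: ecol] => //= x; by rewrite -cword_cons.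
Qed.

(** The number of indices that are left to the core: the index n in type D, none in type B. It is
    also the extra length that an admissible core may have. *)
Definition dl (t : ctype) : nat := if t is TD then 1 else 0.

(** * Admissibility and the contraction relation R5 *)

(* g is the number of free positions minus the number of pairs seen so far; the column is
   admissible when this walk stays nonnegative.  til erases the first pair (or core letters)
   making it negative, provided the part of the column after it is admissible. *)
Fixpoint adm t (g : nat) (st : seq (bool * bool)) (c : nat) : bool :=
  match st with
  | [::] => c <= g + dl t
  | (true, true) :: st' => if g is g'.+1 then adm t g' st' c else false
  | (false, false) :: st' => adm t g.+1 st' c
  | _ :: st' => adm t g st' c
  end.

Fixpoint til t (g : nat) (st : seq (bool * bool)) (c : nat) : option (seq (bool * bool) * nat) :=
  match st with
  | [::] => if c == g.+1 + dl t then Some ([::], g) else None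
  | s :: st' =>
    let k r := omap (fun q : seq (bool * bool) * nat => (s :: q.1, q.2)) r in
    match s with
    | (true, true) =>
      if g is g'.+1 then k (til t g' st' c)
      else if adm t 0 st' c then Some ((false, false) :: st', c) else None
    | (false, false) => k (til t g.+1 st' c)
    | _ => k (til t g st' c)
    end
  end.

Lemma adm_last t i g s b c x : adm t g [:: s] c -> 
  flast t i s b c = Some x \/ elast t i s b c = Some x -> adm t g x.1.1 x.2.
Proof.
case: t; rewrite /flast /elast.
  move=> a [h|h]; move: a; case: s h => [[] []] //=; case: c => [|c] //= [<-] /=; case: g => [|g] //=; lia.
case: (i == 1);
 (move=> a [h|h]; move: a h; case: s => [[] []]; case: b => //=; case: c => [|c] //=;
  try (case oc: (odd c)) => //=; case: g => [|g] //= a; try (case=> <- /=); try lia;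
  by case: c a oc => [|c] a oc //; lia).
Qed.

(** At two neighbouring positions each entry of [f2] and [e2] keeps the net change of the walk and
    its minimum, the starting value included. *)
Lemma adm_closed t i g st b c x : adm t g st c ->
  fcol t i st b c = Some x \/ ecol t i st b c = Some x -> adm t g x.1.1 x.2.
Proof.
elim: st i g x => [|s st IH] i g x; first by move=> _ [].
case: st IH => [|s' st] IH; first exact: adm_last.
rewrite [fcol _ _ _ _ _]/= [ecol _ _ _ _ _]/=; case: ifP => _.
  clear IH => a [h|h]; move: a h; case: s => [[] []]; case: s' => [[] []] //=; case: g => [|g] //= a [<-] //=.
rewrite -/(fcol t i.-1 (s' :: st) b c) -/(ecol t i.-1 (s' :: st) b c).
move=> a h.
have {h} [y [-> h]] : exists y, x = dcons s y /\
   (fcol t i.-1 (s' :: st) b c = Some y \/ ecol t i.-1 (s' :: st) b c = Some y).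
  case: h; [case: (fcol t i.-1 (s' :: st) b c)|case: (ecol t i.-1 (s' :: st) b c)] => //= y [<-].
    by exists y; split => //; left.
  by exists y; split => //; right.
move: a; move: (s' :: st) IH h => u IH h; rewrite /dcons.
by case: s => [[] []]; [case: g => [|g] //| | |]; move=> a; exact: (IH _ _ _ a h).
Qed.

(** The bit b has no meaning for an empty core, nor anywhere in type B; so column data are compared
    through the core words that they denote. *)
Definition ceq t (x y : cdata) : Prop :=
  [/\ x.1.1 = y.1.1, x.2 = y.2 & core t x.1.2 x.2 = core t y.1.2 y.2].

Lemma ceq_cword t x y : ceq t x y -> cword t x = cword t y.
Proof. by case=> h1 h2 h3; rewrite /cword h3 h1. Qed.

Definition tilmatch t g (ox ox' : option cdata) : Prop :=
  match ox, ox' with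
  | Some x, Some x' => til t g x.1.1 x.2 = Some (x'.1.1, x'.2) /\ core t x.1.2 x'.2 = core t x'.1.2 x'.2
  | None, None => True
  | _, _ => False
  end.

Lemma til_last t i g s b c st' c' : 0 < i -> til t g [:: s] c = Some (st', c') ->
  tilmatch t g (flast t i s b c) (fcol t i st' b c') /\
  tilmatch t g (elast t i s b c) (ecol t i st' b c').
Proof.
move=> _ h.
have : exists s', st' = [:: s'] by case: s h => [[] []] /=; case: g => [|g] /=; case: ifP => // _ [<- _]; eexists.
case=> s' st'E; subst st'.
rewrite [fcol _ _ _ _ _]/= [ecol _ _ _ _ _]/=.
case: t h => h.
  case: s h => [[] []] /=; case: g => [|g] /=; case: ifP => // hc [<- <-]; move: hc; rewrite ?addn0 ?addn1 => hc;
  try (move/eqP: hc => hc; subst c); split; rewrite /tilmatch //= ?addn0 ?eqxx //=;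
  by move: hc; rewrite leqn0 => /eqP ->.
rewrite /flast /elast; case: (i == 1);
case: s h => [[] []] /=; case: g => [|g] /=; case: ifP => // hc [<- <-]; move: hc; rewrite ?addn0 ?addn1 => hc;
  try (move/eqP: hc => hc; subst c);
  case: b; try (case oc: (odd g));
  split; rewrite /tilmatch /= ?oc /= ?oc /= ?addn0 ?addn1 ?eqxx //=;
  by clear -hc; case: c hc => [|[|c]].
Qed.

Lemma til_closed t i g st b c st' c' : 0 < i -> til t g st c = Some (st', c') ->
  tilmatch t g (fcol t i st b c) (fcol t i st' b c') /\
  tilmatch t g (ecol t i st b c) (ecol t i st' b c').
Proof.
elim: st i g st' => [|s st IH] i g st' i0; first by rewrite /=; case: ifP => // _ [<- _].
case: st IH => [|s' st] IH; first exact: til_last.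
case: (eqVneq i 1) => [->|i1] h.
  clear IH; move: h; case: s => [[] []]; case: s' => [[] []] /=; case: g => [|[|g]] //=;
  try match goal with |- context [adm ?a ?b ?c ?d] => case E: (adm a b c d) => //= end;
  try match goal with |- context [til ?a ?b ?c ?d] => case E': (til a b c d) => [[st1 c1]|] //= end;
  try (case=> <- <-; split; rewrite /tilmatch /= ?E ?E' //=).
rewrite [fcol t i [:: s, s' & st] _ _]/= [ecol t i [:: s, s' & st] _ _]/= (negbTE i1).
rewrite -/(fcol t i.-1 (s' :: st) b c) -/(ecol t i.-1 (s' :: st) b c).
have i0' : 0 < i.-1 by lia.
(* Either the erased pair stands at the first position, and the rest stays admissible under the
   operator by [adm_closed], or the erasure happens further right and the induction hypothesis
   applies. *)
have [[h1 h2 h3]|[g' [st1 [h1 h2 h3]]]] :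
   [/\ g = 0 /\ s = (true, true), st' = (false, false) :: s' :: st /\ c' = c & adm t 0 (s' :: st) c] \/
   exists g' st1, [/\ til t g' (s' :: st) c = Some (st1, c'), st' = s :: st1 &
     forall x y, til t g' x.1.1 x.2 = Some (y.1.1, y.2) -> til t g (dcons s x).1.1 x.2 = Some ((dcons s y).1.1, y.2)].
- clear -h; move: (s' :: st) h => u h.
  case: s h => [[] []] /=; [case: g => [|g']| | |] => h.
  + by move: h; case E: (adm t 0 u c) => // -[<- <-]; left.
  + right; exists g'; move: h; case E: (til t g' u c) => [[st1 c1]|] //= [<- <-]; exists st1.
    by split => // x y ->.
  + right; exists g; move: h; case E: (til t g u c) => [[st1 c1]|] //= [<- <-]; exists st1.
    by split => // x y ->.
  + right; exists g; move: h; case E: (til t g u c) => [[st1 c1]|] //= [<- <-]; exists st1.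
    by split => // x y ->.
  + right; exists g.+1; move: h; case E: (til t g.+1 u c) => [[st1 c1]|] //= [<- <-]; exists st1.
    by split => // x y ->.
- case: h1 => -> ->; case: h2 => -> ->.
  rewrite [fcol t i [:: _, s' & st] _ _]/= [ecol t i [:: _, s' & st] _ _]/= (negbTE i1).
  rewrite -/(fcol t i.-1 (s' :: st) b c) -/(ecol t i.-1 (s' :: st) b c).
  split; rewrite /tilmatch.
    case E: (fcol t i.-1 (s' :: st) b c) => [x|] //=.
    by rewrite (@adm_closed t i.-1 0 (s' :: st) b c) //; left.
  case E: (ecol t i.-1 (s' :: st) b c) => [x|] //=.
  by rewrite (@adm_closed t i.-1 0 (s' :: st) b c) //; right.
have [r1 r2] := IH i.-1 _ _ i0' h1; rewrite h2.
have : st1 <> [::].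
  clear -h1; case: s' h1 => [[] []] /=; case: g' => [|g] /=;
  try match goal with |- context [adm ?a ?b ?c ?d] => case: (adm a b c d) => //= end;
  try match goal with |- context [til ?a ?b ?c ?d] => case: (til a b c d) => [[st2 c1]|] //= end;
  by case=> <-.
clear h2; case: st1 h1 r1 r2 => // s1 st1 h1 r1 r2 _.
rewrite [fcol t i [:: s, s1 & st1] _ _]/= [ecol t i [:: s, s1 & st1] _ _]/= (negbTE i1).
rewrite -/(fcol t i.-1 (s1 :: st1) b c') -/(ecol t i.-1 (s1 :: st1) b c').
split; [move: r1|move: r2]; rewrite /tilmatch.
  case: (fcol t i.-1 (s' :: st) b c) => [x|]; case: (fcol t i.-1 (s1 :: st1) b c') => [y|] //= [e1 e2].
  by split; [exact: (h3 x y e1)|exact: e2].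
case: (ecol t i.-1 (s' :: st) b c) => [x|]; case: (ecol t i.-1 (s1 :: st1) b c') => [y|] //= [e1 e2].
by split; [exact: (h3 x y e1)|exact: e2].
Qed.

Lemma til_size t g st c st' c' : til t g st c = Some (st', c') -> size st' = size st.
Proof.
elim: st g st' => [|s st IH] g st' /=; first by case: ifP => // _ [<- _].
case: s => [[] []]; [case: g => [|g]|case: g IH => [|g] IH|case: g IH => [|g] IH|];
try match goal with |- context [adm ?a ?b ?c ?d] => case: (adm a b c d) => //= end;
try match goal with |- context [til ?a ?b ?c ?d] => case E: (til a b c d) => [[st2 c1]|] //= end;
(case=> <- h; subst c'; rewrite /= ?(IH _ _ E) //).
Qed.

Definition til_rel (t : ctype) (n : nat) (u v : word) : Prop :=
  exists st b c st' c', [/\ crk t st = n, til t 0 st c = Some (st', c'),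
     u = cword t (st, b, c) & v = cword t (st', b, c')].

Lemma fcol_size t i st b c x : fcol t i st b c = Some x \/ ecol t i st b c = Some x ->
  size x.1.1 = size st.
Proof.
elim: st i x => [|s [|s' st] IH] i x; first by case.
- case: t {IH} => /=; rewrite /flast /elast.
    by case=> h; move: h; case: s => [[] []] //=; case: c => [|c] //= [<-].
  case: (i == 1); case=> h; move: h.
  + by move/flastD_size => [s' ->].
  + by move/elastD_size => [s' ->].
  + by case E: flastD => [y|] //= [<-] /=; have [s' ->] := flastD_size E.
  + by case E: elastD => [y|] //= [<-] /=; have [s' ->] := elastD_size E.
- rewrite [fcol _ _ _ _ _]/= [ecol _ _ _ _ _]/= -/(fcol t i.-1 (s' :: st) b c) -/(ecol t i.-1 (s' :: st) b c).
  case: ifP => _.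
    by case; [case: f2|case: e2] => //= q [<-].
  case; [case E: (fcol t i.-1 (s' :: st) b c) => [y|] //= [<-]|case E: (ecol t i.-1 (s' :: st) b c) => [y|] //= [<-]].
    by rewrite /= (IH _ _ (or_introl E)).
  by rewrite /= (IH _ _ (or_intror E)).
Qed.

Lemma til_rel_closed t n : okn t n -> crystal_closed t n (til_rel t n).
Proof.
move=> on u v i [st [b [c [st' [c' [sn h -> ->]]]]]] li.
have sn' : crk t st' = n by rewrite /crk (til_size h).
have [-> ->] := col_crystal b c on sn li; have [-> ->] := col_crystal b c' on sn' li.
have i0 : 0 < i by case/andP: li.
have [r1 r2] := til_closed b i0 h; split.
  move: r1; case E: (fcol t i st b c) => [[[x1 x2] x3]|]; case: (fcol t i st' b c') => [[[y1 y2] y3]|] //= [e1 e2].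
  exists x1, x2, x3, y1, y3; split => //; first by rewrite /crk (fcol_size (or_introl E)).
  by rewrite /cword /= e2.
move: r2; case E: (ecol t i st b c) => [[[x1 x2] x3]|]; case: (ecol t i st' b c') => [[[y1 y2] y3]|] //= [e1 e2].
exists x1, x2, x3, y1, y3; split => //; first by rewrite /crk (fcol_size (or_intror E)).
by rewrite /cword /= e2.
Qed.

(** * Pairs of spin columns: R8 *)

(* Position by position, a pair of spin columns is a bracket word: (1,0) opens,
   (0,1) closes; a closed bracket gives a pair, the d open ones end up in the core. *)
Definition dm_core (d : nat) (even_len : bool) : nat := if odd d (+) even_len then d else d.+1.

Definition dm_step (b1 b2 : bool) (d : nat) : (bool * bool) * nat :=
  match b1, b2 with
  | false, false => ((true, false), d)
  | true, true => ((false, true), d)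
  | true, false => ((false, false), d.+1)
  | false, true => if d is d'.+1 then ((true, true), d') else ((false, false), 0)
  end.

(** In type D the last position gives no state. A nonempty core starts with the last bit of [C1] and
    ends with the last bit of [C2], so its length is even exactly when these bits differ; [dm_core]
    takes whichever of d and d+1 has this parity. *)
Fixpoint dm (t : ctype) (d : nat) (C1 C2 : seq bool) : cdata :=
  match C1, C2 with
  | b1 :: C1', b2 :: C2' =>
    if (if t is TD then nilp C1' else false) then ([::], b1, dm_core d (b1 != b2))
    else let r := dm_step b1 b2 d in dcons r.1 (dm t r.2 C1' C2')
  | _, _ => ([::], false, d)
  end.

(** The number d of open brackets never exceeds the height g of the walk: both rise by 1 at an
    opening bracket and drop by 1 at a match, and an unmatched closing bracket raises g alone. *)
Lemma dm_adm t d g C1 C2 : size C1 = size C2 -> d <= g -> 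
  (if t is TD then 0 < size C1 else true) ->
  adm t g (dm t d C1 C2).1.1 (dm t d C1 C2).2 /\ crk t (dm t d C1 C2).1.1 = size C1.
Proof.
elim: C1 C2 d g => [|b1 C1 IH] [|b2 C2] d g //=.
  by case: t => // _ h _; rewrite /crk /=; split => //; lia.
move=> [sC] dg _; case: ifP => [l|l].
  have C0 : size C1 = 0 by case: t l {IH} => // /nilP ->.
  case: t l {IH} => // l; rewrite C0 /crk /=; split => //.
  rewrite /dm_core; case: ifP => _; lia.
have nl : is_true (if t is TD then 0 < size C1 else true) by case: t l {IH} => //; case: (C1).
have IH' d' g' := IH C2 d' g' sC.
case: b1; case: b2; rewrite /= /crk /=.
- by have [h1 h2] := IH' d g dg nl; rewrite /crk in h2; split => //; lia.
- by have [h1 h2] := IH' d.+1 g.+1 dg nl; rewrite /crk in h2; split => //; lia.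
- case: d dg => [|d] dg; last first.
    case: g dg => // g dg; have [h1 h2] := IH' d g dg nl; rewrite /crk in h2; split => //=; lia.
  by have [h1 h2] := IH' 0 g.+1 isT nl; rewrite /crk in h2; split => //=; lia.
- by have [h1 h2] := IH' d g dg nl; rewrite /crk in h2; split => //; lia.
Qed.

Definition dm_match t d (ow : option word) (ox : option cdata) : Prop :=
  match ow, ox with
  | Some [:: S D1; S D2], Some x => ceq t (dm t d D1 D2) x
  | None, None => True
  | _, _ => False
  end.

Lemma dm_last t d C1 C2 i : (if t is TD then size C1 = 2 else size C1 = 1) ->
  size C2 = size C1 -> 0 < i <= size C1 ->
  let x := dm t d C1 C2 in
  dm_match t d (fW t (size C1) i [:: S C1; S C2]) (fcol t i x.1.1 x.1.2 x.2) /\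
  dm_match t d (eW t (size C1) i [:: S C1; S C2]) (ecol t i x.1.1 x.1.2 x.2).
Proof.
case: t.
  case: C1 => [|b1 []] //; case: C2 => [|b2 []] //= _ _; case: i => [|[|]] // _.
  by case: b1; case: b2; case: d => [|d]; split.
case: C1 => [|b1 [|b1' []]] //; case: C2 => [|b2 [|b2' []]] //= _ _; case: i => [|[|[|]]] // _.
all: case: b1; case: b2; case: b1'; case: b2'; case: d => [|d]; rewrite /= /dm_core; try (case oc: (odd d));
  rewrite /= ?oc /= ?oc /= ?oc /= ?oc /=; by split.
Qed.

Lemma pair_shift t n i a a' C1 C2 : okn t n -> 0 < i <= n ->
  let up w := match w with [:: S D1; S D2] => [:: S (a :: D1); S (a' :: D2)] | _ => w end in
  fW t n.+1 i.+1 [:: S (a :: C1); S (a' :: C2)] = omap up (fW t n i [:: S C1; S C2]) /\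
  eW t n.+1 i.+1 [:: S (a :: C1); S (a' :: C2)] = omap up (eW t n i [:: S C1; S C2]).
Proof.
move=> on li up; rewrite /= !epsW_cons /epsW /=.
have eE b C : epsG t n.+1 i.+1 (S (b :: C)) = epsG t n i (S C).
  by rewrite -[S (b :: C)]/(glift b (S C)); apply: cnt_morph => g; exact: eG_shift.
have pE b C : phiG t n.+1 i.+1 (S (b :: C)) = phiG t n i (S C).
  by rewrite -[S (b :: C)]/(glift b (S C)); apply: cnt_morph => g; exact: fG_shift.
rewrite !eE !pE !fS_shift // !eS_shift //; split.
  by case: ifP => _; [case: (fS t n i C1)|case: ifP => _ //; case: (fS t n i C2)].
by case: ifP => _; [case: (eS t n i C2)|case: (eS t n i C1)].
Qed.

Lemma dm_cons t d b1 C1 b2 C2 : (if t is TD then 0 < size C1 else true) ->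
  dm t d (b1 :: C1) (b2 :: C2) = dcons (dm_step b1 b2 d).1 (dm t (dm_step b1 b2 d).2 C1 C2).
Proof. by case: t => //=; case: C1. Qed.

Arguments dm : simpl never.

Lemma dm_first t d b1 b1' C1 b2 b2' C2 : okn t (size C1).+1 -> size C2 = size C1 ->
  let x := dm t d (b1 :: b1' :: C1) (b2 :: b2' :: C2) in
  dm_match t d (fW t (size C1).+2 1 [:: S (b1 :: b1' :: C1); S (b2 :: b2' :: C2)]) (fcol t 1 x.1.1 x.1.2 x.2) /\
  dm_match t d (eW t (size C1).+2 1 [:: S (b1 :: b1' :: C1); S (b2 :: b2' :: C2)]) (ecol t 1 x.1.1 x.1.2 x.2).
Proof.
move=> on sC x; rewrite /x {x}.
have E b b' d' D1 D2 : size D1 = size C1 -> dm t d' (b :: D1) (b' :: D2) = dcons (dm_step b b' d').1 (dm t (dm_step b b' d').2 D1 D2).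
  by move=> sD; apply: dm_cons; case: (t) on; rewrite ?sD.
have E' b b' d' a a' D1 D2 : dm t d' (b :: a :: D1) (b' :: a' :: D2) = dcons (dm_step b b' d').1 (dm t (dm_step b b' d').2 (a :: D1) (a' :: D2)).
  by apply: dm_cons; case: (t).
rewrite E' E //.
clear on sC; have F x : ceq t x x by [].
by case: b1; case: b1'; case: b2; case: b2'; case: d => [|[|d]]; split; rewrite /dm_match /= ?E' /= ?E //=; case: t E E' F.
Qed.

Lemma fcol_cons t i s st b c : st <> [::] -> 0 < i ->
  fcol t i.+1 (s :: st) b c = omap (dcons s) (fcol t i st b c) /\
  ecol t i.+1 (s :: st) b c = omap (dcons s) (ecol t i st b c).
Proof. by case: i => // i; case: st. Qed.

Lemma dm_crystal t n d C1 C2 i : okn t n -> size C1 = n -> size C2 = n -> 0 < i <= n ->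
  let x := dm t d C1 C2 in
  dm_match t d (fW t n i [:: S C1; S C2]) (fcol t i x.1.1 x.1.2 x.2) /\
  dm_match t d (eW t n i [:: S C1; S C2]) (ecol t i x.1.1 x.1.2 x.2).
Proof.
move=> on sC; subst n; elim: C1 d C2 i on => [|b1 C1 IH] d [|b2 C2] i on //; first by case: (t) on.
move=> [sC2] li; case: (boolP (okn t (size C1))) => ok'; last first.
  apply: dm_last => //=; last by rewrite sC2.
  move: on ok' => /=; case: (t) => /=; lia.
case: i li => // -[|i] li.
  case: C1 ok' sC2 on li {IH} => [|b1' C1]; first by case: (t).
  case: C2 => [|b2' C2] // ok' [sC2] on li; exact: dm_first.
have li' : 0 < i.+1 <= size C1 by [].
have p0 : is_true (if t is TD then 0 < size C1 else true) by case: (t) ok' => //=; case: (C1).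
rewrite dm_cons //.
set s := (dm_step b1 b2 d).1; set d' := (dm_step b1 b2 d).2.
have [e1 e2] := IH d' C2 i.+1 ok' sC2 li'.
have [_ kk] := dm_adm (esym sC2) (leqnn d') p0.
have nn : (dm t d' C1 C2).1.1 <> [::].
  by move: kk ok'; rewrite /crk; case: (dm t d' C1 C2).1.1 => //=; case: (t) => /= <-.
have [f1 f2] := pair_shift b1 b2 C1 C2 ok' li'.
have dd D1 D2 : size D1 = size C1 -> dm t d (b1 :: D1) (b2 :: D2) = dcons s (dm t d' D1 D2).
  by move=> sD; rewrite dm_cons ?sD.
have Hc x y : ceq t x y -> ceq t (dcons s x) (dcons s y) by case=> h1 h2 h3; split; rewrite //= h1.
move=> x; rewrite f1 f2 {}/x {1 2 3 4 5 6}/dcons; cbn [fst snd].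
have [-> ->] := fcol_cons t s (dm t d' C1 C2).1.2 (dm t d' C1 C2).2 nn (ltn0Sn i).
have pv : valid_word t (size C1) [:: S C1; S C2] by rewrite /valid_word /= /valid_spin sC2 eqxx.
split.
  move: e1; case E: (fW t (size C1) i.+1 [:: S C1; S C2]) => [w|]; last by case: fcol.
  have [vw sw _ _ _] := fW_props ok' li' pv E.
  case: w vw sw {E} => [|[x|D1] [|[y|D2] []]] //= /and3P[/eqP h1 /eqP h2 _] _.
  by case: fcol => //= x hx; rewrite dd //; exact: Hc.
move: e2; case E: (eW t (size C1) i.+1 [:: S C1; S C2]) => [w|]; last by case: ecol.
have [vw sw _ _ _] := eW_props ok' li' pv E.
case: w vw sw {E} => [|[x|D1] [|[y|D2] []]] //= /and3P[/eqP h1 /eqP h2 _] _.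
by case: ecol => //= x hx; rewrite dd //; exact: Hc.
Qed.

Definition dm_word t C1 C2 : word := cword t (dm t 0 C1 C2).

Lemma dm_word_crystal t n C1 C2 i : okn t n -> size C1 = n -> size C2 = n -> 0 < i <= n ->
  (forall w, fW t n i [:: S C1; S C2] = Some w -> exists D1 D2,
    [/\ w = [:: S D1; S D2], size D1 = n, size D2 = n & fW t n i (dm_word t C1 C2) = Some (dm_word t D1 D2)]) /\
  (fW t n i [:: S C1; S C2] = None -> fW t n i (dm_word t C1 C2) = None) /\
  (forall w, eW t n i [:: S C1; S C2] = Some w -> exists D1 D2,
    [/\ w = [:: S D1; S D2], size D1 = n, size D2 = n & eW t n i (dm_word t C1 C2) = Some (dm_word t D1 D2)]) /\
  (eW t n i [:: S C1; S C2] = None -> eW t n i (dm_word t C1 C2) = None).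
Proof.
move=> on s1 s2 li; have [h1 h2] := dm_crystal 0 on s1 s2 li.
have p0 : is_true (if t is TD then 0 < size C1 else true) by rewrite s1; case: (t) on => //=; lia.
have [_ kk] := dm_adm (etrans s1 (esym s2)) (leqnn 0) p0.
have kn : crk t (dm t 0 C1 C2).1.1 = n by rewrite kk.
have [f1 f2] := col_crystal (dm t 0 C1 C2).1.2 (dm t 0 C1 C2).2 on kn li.
have xE : ((dm t 0 C1 C2).1.1, (dm t 0 C1 C2).1.2, (dm t 0 C1 C2).2) = dm t 0 C1 C2.
  by case: (dm t 0 C1 C2) => [[]].
rewrite xE in f1 f2; rewrite /dm_word f1 f2.
have pv : valid_word t n [:: S C1; S C2] by rewrite /valid_word /= /valid_spin s1 s2 eqxx.
split; [|split; [|split]].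
- move=> w E; have [vw sw _ _ _] := fW_props on li pv E; rewrite E in h1.
  case: w vw sw h1 {E} => [|[x|D1] [|[y|D2] []]] //= /and3P[/eqP v1 /eqP v2 _] _.
  case: fcol => //= x hx; exists D1, D2; split => //; by rewrite (ceq_cword hx).
- by move=> E; rewrite E in h1; case: fcol h1.
- move=> w E; have [vw sw _ _ _] := eW_props on li pv E; rewrite E in h2.
  case: w vw sw h2 {E} => [|[x|D1] [|[y|D2] []]] //= /and3P[/eqP v1 /eqP v2 _] _.
  case: ecol => //= x hx; exists D1, D2; split => //; by rewrite (ceq_cword hx).
- by move=> E; rewrite E in h2; case: ecol h2.
Qed.

(** * Letters and their codes, and the closure of R1 to R4 *)

Definition ldec (t : ctype) (n r : nat) : letter :=
  if r <= n then Pos r else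
  match t with TB => if r == n.+1 then Zer else Neg ((n.*2).+2 - r) | TD => Neg ((n.*2).+1 - r) end.

(* Unlike rank, this is injective: in type D it puts n before \bar n. *)
Definition lenc (t : ctype) (n : nat) (x : letter) : nat :=
  match t, x with
  | _, Pos k => k
  | _, Zer => n.+1
  | TB, Neg k => (n.*2).+2 - k
  | TD, Neg k => (n.*2).+1 - k
  end.

Lemma lencK t n x : valid_letter t n x -> ldec t n (lenc t n x) = x.
Proof.
rewrite /ldec; case: t; case: x => [k||k] //= h; repeat case: ifP => //; intros; try (f_equal; lia); exfalso; lia.
Qed.

Definition lmax t n := if t is TB then n + n + 1 else n + n.

Lemma ldecK t n r : 0 < r <= lmax t n -> lenc t n (ldec t n r) = r /\ valid_letter t n (ldec t n r).
Proof.
rewrite /ldec /lmax; case: t => h; repeat case: ifP => /=; intros; try (split => //; lia); lia.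
Qed.

Lemma lenc_bound t n x : valid_letter t n x -> 0 < lenc t n x <= lmax t n.
Proof. by rewrite /lmax; case: t; case: x => [k||k] //=; lia. Qed.

Definition kdat t n i r : kdata :=
  (epsG t n i (V (ldec t n r)), phiG t n i (V (ldec t n r)),
   omap (lenc t n) (fL t n i (ldec t n r)), omap (lenc t n) (eL t n i (ldec t n r))).

Definition w3 t n (x : nat * nat * nat) : word :=
  [:: V (ldec t n x.1.1); V (ldec t n x.1.2); V (ldec t n x.2)].

Definition in3 t n (x : nat * nat * nat) :=
  [&& 0 < x.1.1 <= lmax t n, 0 < x.1.2 <= lmax t n & 0 < x.2 <= lmax t n].

Lemma f3E t n i x : okn t n -> 0 < i <= n -> in3 t n x ->
  fW t n i (w3 t n x) = omap (w3 t n) (f3 x.1.1 x.1.2 x.2 (kdat t n i x.1.1) (kdat t n i x.1.2) (kdat t n i x.2)) /\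
  eW t n i (w3 t n x) = omap (w3 t n) (e3 x.1.1 x.1.2 x.2 (kdat t n i x.1.1) (kdat t n i x.1.2) (kdat t n i x.2)).
Proof.
case: x => [[a b] c] on li /and3P[]; cbn [fst snd] => ha hb hc.
have Hf r : 0 < r <= lmax t n ->
   fL t n i (ldec t n r) = omap (ldec t n) (omap (lenc t n) (fL t n i (ldec t n r))).
  move=> hr; case E: fL => [y|] //=; rewrite lencK //.
  by apply: valid_fL E => //; case: (ldecK hr).
have He r : 0 < r <= lmax t n ->
   eL t n i (ldec t n r) = omap (ldec t n) (omap (lenc t n) (eL t n i (ldec t n r))).
  move=> hr; case E: eL => [y|] //=; rewrite lencK //.
  by apply: valid_eL E => //; case: (ldecK hr).
have e1 z : epsW t n i [:: V z] = epsG t n i (V z) by rewrite epsW_cons /epsW /=; maxlia.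
rewrite /w3 /f3 /e3 /kdat /= !epsW_cons /epsW /=.
have -> : maxn (epsG t n i (V (ldec t n c))) (0 + epsG t n i (V (ldec t n c)) - phiG t n i (V (ldec t n c))) = epsG t n i (V (ldec t n c)) by maxlia.
split.
  case: ifP => _; first by rewrite {1}Hf //; case: fL.
  case: ifP => _; first by rewrite {1}Hf //; case: fL.
  case: ifP => h; first by rewrite {1}Hf //; case: fL.
  have fN : fL t n i (ldec t n c) = None.
    by move: h; rewrite /phiG /=; case: fL.
  by rewrite fN.
case: ifP => _; last by rewrite {1}He //; case: eL.
case: ifP => _; first by rewrite {1}He //; case: eL.
by rewrite {1}He //; case: eL.
Qed.

Lemma fL_decB n i r : 0 < i <= n -> 0 < r <= n + n + 1 ->
  fL TB n i (ldec TB n r) = if (r == i) || (r + i == n + n + 1) then Some (ldec TB n r.+1) else None.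
Proof.
move=> li hr; rewrite /ldec.
repeat (case: ifP => /=; intros); try (exfalso; lia); try done; try (congr Some); try (f_equal; lia).
Qed.

Lemma eL_decB n i r : 0 < i <= n -> 0 < r <= n + n + 1 ->
  eL TB n i (ldec TB n r) = if (r == i.+1) || (r + i == n + n + 2) then Some (ldec TB n r.-1) else None.
Proof.
move=> li hr; rewrite /ldec.
repeat (case: ifP => /=; intros); try (exfalso; lia); try done; try (congr Some); try (f_equal; lia).
Qed.

Lemma fL_decD n i r : 1 < n -> 0 < i <= n -> 0 < r <= n + n ->
  fL TD n i (ldec TD n r) =
    if i < n then (if (r == i) || (r + i == n + n) then Some (ldec TD n r.+1) else None)
    else if (r.+1 == n) || (r == n) then Some (ldec TD n r.+2) else None.
Proof.
move=> n1 li hr; rewrite /ldec.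
repeat (case: ifP => /=; intros); try (exfalso; lia); try done; try (congr Some); try (f_equal; lia).
Qed.

Lemma eL_decD n i r : 1 < n -> 0 < i <= n -> 0 < r <= n + n ->
  eL TD n i (ldec TD n r) =
    if i < n then (if (r == i.+1) || (r + i == n + n + 1) then Some (ldec TD n r.-1) else None)
    else if (r == n.+1) || (r == n.+2) then Some (ldec TD n r.-2) else None.
Proof.
move=> n1 li hr; rewrite /ldec.
repeat (case: ifP => /=; intros); try (exfalso; lia); try done; try (congr Some); try (f_equal; lia).
Qed.

Lemma cntS h k g : cnt h k.+1 g = if h g is Some g' then (cnt h k g').+1 else 0.
Proof. by []. Qed.

Lemma kdat_B n i r : 0 < i <= n -> 0 < r <= n + n + 1 -> iclsB n i r (kdat TB n i r).
Proof.
move=> li hr.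
have K s : 0 < s <= n + n + 1 -> omap (lenc TB n) (Some (ldec TB n s)) = Some s.
  by move=> hs; exact: (congr1 Some (@ldecK TB n s hs).1).
have fE s : 0 < s <= n + n + 1 -> (s == i) || (s + i == n + n + 1) -> fG TB n i (V (ldec TB n s)) = Some (V (ldec TB n s.+1)).
  by move=> hs h; rewrite /= fL_decB // h.
have fN s : 0 < s <= n + n + 1 -> (s == i) || (s + i == n + n + 1) = false -> fG TB n i (V (ldec TB n s)) = None.
  by move=> hs h; rewrite /= fL_decB // h.
have eE s : 0 < s <= n + n + 1 -> (s == i.+1) || (s + i == n + n + 2) -> eG TB n i (V (ldec TB n s)) = Some (V (ldec TB n s.-1)).
  by move=> hs h; rewrite /= eL_decB // h.
have eN s : 0 < s <= n + n + 1 -> (s == i.+1) || (s + i == n + n + 2) = false -> eG TB n i (V (ldec TB n s)) = None.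
  by move=> hs h; rewrite /= eL_decB // h.
rewrite /kdat /epsG /phiG fL_decB // eL_decB //.
have [c1|c1] := boolP ((r == i) || (r + i == n + n + 1)); have [c2|c2] := boolP ((r == i.+1) || (r + i == n + n + 2)).
- rewrite K; last by lia.
  rewrite K; last by lia.
  rewrite cntS eE // cntS eN; [|lia|lia]. 
  rewrite cntS fE // cntS fN; [|lia|lia].
  by apply: iclsB_7; lia.
- rewrite K; last by lia.
  rewrite cntS eN //; last by apply/negbTE.
  rewrite cntS fE //.
  have [c3|c3] := boolP ((r.+1 == i) || (r.+1 + i == n + n + 1)).
    rewrite cntS fE //; last by lia.
    rewrite cntS fN; [|lia|lia].
    by apply: iclsB_6; lia.
  rewrite cntS fN; [|lia|exact/negbTE].
  have [h|h] : r = i \/ r + i = n + n + 1 by lia.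
    by apply: iclsB_1; lia.
  by apply: iclsB_3; lia.
- rewrite K; last by lia.
  rewrite [cnt (fG _ _ _) _ _]cntS fN //; last by apply/negbTE.
  rewrite cntS eE //.
  have [c3|c3] := boolP ((r.-1 == i.+1) || (r.-1 + i == n + n + 2)).
    rewrite cntS eE //; last by lia.
    rewrite cntS eN; [|lia|lia].
    by apply: iclsB_8; lia.
  rewrite cntS eN; [|lia|exact/negbTE].
  have [h|h] : r = i.+1 \/ r + i = n + n + 2 by lia.
    by apply: iclsB_2; lia.
  by apply: iclsB_4; lia.
- rewrite [omap _ _]/= [X in (_, X)]/=.
  rewrite cntS eN //; last by apply/negbTE.
  rewrite cntS fN //; last by apply/negbTE.
  have [h|h] : i < n \/ i = n by lia.
    by apply: iclsB_5; lia.
  by apply: iclsB_9; lia.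
Qed.

Lemma kdat_D n i r : 1 < n -> 0 < i <= n -> 0 < r <= n + n -> iclsD n i r (kdat TD n i r).
Proof.
move=> n1 li hr.
have K s : 0 < s <= n + n -> omap (lenc TD n) (Some (ldec TD n s)) = Some s.
  by move=> hs; exact: (congr1 Some (@ldecK TD n s hs).1).
pose up s := if i < n then (s == i) || (s + i == n + n) else (s.+1 == n) || (s == n).
pose dn s := if i < n then (s == i.+1) || (s + i == n + n + 1) else (s == n.+1) || (s == n.+2).
pose st := if i < n then 1 else 2.
have fE s : 0 < s <= n + n -> up s -> fL TD n i (ldec TD n s) = Some (ldec TD n (s + st)).
  by move=> hs; rewrite /up /st fL_decD //; case: ifP => _ ->; rewrite ?addn1 ?addn2.
have fN s : 0 < s <= n + n -> up s = false -> fL TD n i (ldec TD n s) = None.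
  by move=> hs; rewrite /up /st fL_decD //; case: ifP => _ ->.
have eE s : 0 < s <= n + n -> dn s -> eL TD n i (ldec TD n s) = Some (ldec TD n (s - st)).
  by move=> hs; rewrite /dn /st eL_decD //; case: ifP => _ ->; rewrite ?subn1 ?subn2.
have eN s : 0 < s <= n + n -> dn s = false -> eL TD n i (ldec TD n s) = None.
  by move=> hs; rewrite /dn /st eL_decD //; case: ifP => _ ->.
rewrite /kdat /epsG /phiG.
have [c1|c1] := boolP (up r); have [c2|c2] := boolP (dn r).
- by exfalso; move: c1 c2; rewrite /up /dn; case: ifP; lia.
- have [b1 b2] : 0 < r + st <= n + n /\ up (r + st) = false.
    by move: c1 c2; rewrite /up /dn /st; case: ifP; lia.
  have gE : fG TD n i (V (ldec TD n r)) = Some (V (ldec TD n (r + st))) by rewrite /= fE.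
  have gN : fG TD n i (V (ldec TD n (r + st))) = None by rewrite /= fN.
  have hN : eG TD n i (V (ldec TD n r)) = None by rewrite /= eN //; apply/negbTE.
  rewrite fE // eN //; last by apply/negbTE.
  rewrite cntS hN cntS gE cntS gN K //.
  move: c1; rewrite /up /st; case: ifP => hi; last by rewrite addn2 => h; apply: iclsD_6; lia.
  rewrite addn1; have [h|h] := eqVneq r i; first by move=> _; apply: iclsD_1; lia.
  by move=> h'; apply: iclsD_3; lia.
- have [b1 b2] : 0 < r - st <= n + n /\ dn (r - st) = false.
    by move: c1 c2; rewrite /up /dn /st; case: ifP; lia.
  have gE : eG TD n i (V (ldec TD n r)) = Some (V (ldec TD n (r - st))) by rewrite /= eE.
  have gN : eG TD n i (V (ldec TD n (r - st))) = None by rewrite /= eN.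
  have hN : fG TD n i (V (ldec TD n r)) = None by rewrite /= fN //; apply/negbTE.
  rewrite eE // fN //; last by apply/negbTE.
  rewrite [cnt (fG _ _ _) _ _]cntS hN cntS gE cntS gN K //.
  move: c2; rewrite /dn /st; case: ifP => hi; last by rewrite subn2 => h; apply: iclsD_7; lia.
  rewrite subn1; have [h|h] := eqVneq r i.+1; first by move=> _; apply: iclsD_2; lia.
  by move=> h'; apply: iclsD_4; lia.
- have hN : fG TD n i (V (ldec TD n r)) = None by rewrite /= fN //; apply/negbTE.
  have gN : eG TD n i (V (ldec TD n r)) = None by rewrite /= eN //; apply/negbTE.
  rewrite fN ?eN //; [|exact/negbTE|exact/negbTE].
  rewrite cntS gN cntS hN /=; move: c1 c2; rewrite /up /dn; case: ifP => h1 h2 h3.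
    by apply: iclsD_5; lia.
  by apply: iclsD_8; lia.
Qed.

Definition knuth_rel t n (u v : word) : Prop :=
  exists x y, [/\ u = w3 t n x, v = w3 t n y & (if t is TB then knuthB n x y else knuthD n x y)].

Lemma knuth_in3 t n x y : okn t n -> (if t is TB then knuthB n x y else knuthD n x y) ->
  in3 t n x /\ in3 t n y.
Proof.
by case: t => on; case; intros; subst; rewrite /in3 /lmax /=; simpl in on; lia.
Qed.

Lemma optrel_knuth t n ox oy :
  optrel (keq3 (if t is TB then knuthB n else knuthD n)) ox oy ->
  optrel (fun u v => knuth_rel t n u v \/ u = v) (omap (w3 t n) ox) (omap (w3 t n) oy).
Proof.
case: ox oy => [x|] [y|] //= [k|->]; last by right.
by left; exists x, y; split => //; case: (t) k.
Qed.

Lemma knuth_rel_closed t n : okn t n -> crystal_closed t n (fun u v => knuth_rel t n u v \/ u = v).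
Proof.
move=> on u v i [h|->] li; last by split; [case: fW|case: eW] => //= *; right.
case: h => x [y [-> -> K]]; have [ix iy] := knuth_in3 on K.
have [-> ->] := f3E on li ix; have [-> ->] := f3E on li iy.
have i1 : (1 <= i)%coq_nat by lia.
have i2 : (i <= n)%coq_nat by lia.
case: t on K ix iy => /= on K ix iy.
  have hk r : (1 <= r)%coq_nat -> (r <= n + n + 1)%coq_nat -> iclsB n i r (kdat TB n i r).
    by move=> h1 h2; apply: kdat_B; lia.
  have := knuthB_closed i1 i2 hk K; cbv zeta beta => -[Hf He].
  by split; apply: optrel_knuth.
have n2 : (2 <= n)%coq_nat by lia.
have hk r : (1 <= r)%coq_nat -> (r <= n + n)%coq_nat -> iclsD n i r (kdat TD n i r).
  by move=> h1 h2; apply: kdat_D; lia.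
have := knuthD_closed i1 i2 n2 hk K; cbv zeta beta => -[Hf He].
by split; apply: optrel_knuth.
Qed.

(** * Column words and their states *)

Definition rcol (t : ctype) (n : nat) (x y : letter) : bool :=
  if t is TB then ltL TB n x y || ((x == Zer) && (y == Zer)) else ~~ leL TD n y x.

(** At each type this is convertible to [colB] or [colD], which allows one treatment of both. *)
Definition colP (t : ctype) (n : nat) (w : seq letter) : bool :=
  all (valid_letter t n) w && sorted (rcol t n) w.

Lemma rcol_shift t n x y : valid_letter t n x -> valid_letter t n y ->
  rcol t n.+1 (letter_shift x) (letter_shift y) = rcol t n x y.
Proof.
move=> vx vy; rewrite /rcol; case: t vx vy => vx vy; last by rewrite leL_shift.
congr (_ || _); last by case: x {vx}; case: y {vy}.
by move: vx vy; rewrite /ltL; case: x => [k||k]; case: y => [l||l] //=; lia.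
Qed.

Lemma rcol_rank t n x y : rcol t n x y -> rank t n x <= rank t n y.
Proof.
rewrite /rcol /leL /ltL; case: t; first by case/orP => [|/andP[/eqP-> /eqP->] //]; exact: ltnW.
by rewrite negb_or -leqNgt => /andP[].
Qed.

(** The ranks from which positions can be peeled off until only the core remains: down to 0 in type
    B and to 1 in type D. *)
Definition okn1 (t : ctype) (n : nat) := if t is TD then 0 < n else true.

Lemma rcol_1 t n y : okn1 t n -> valid_letter t n y ->
  [/\ rcol t n.+1 (Pos 1) (letter_shift y), rcol t n.+1 (letter_shift y) (Neg 1) & rcol t n.+1 (Pos 1) (Neg 1)].
Proof.
by case: t => on; case: y => [k||k] //= h; rewrite /rcol /leL /ltL /eq_op /=; split; lia.
Qed.

Lemma rcol_bad t n y : okn1 t n -> valid_letter t n.+1 y ->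
  rcol t n.+1 y (Pos 1) = false /\ rcol t n.+1 (Neg 1) y = false.
Proof.
case: t => /= on; case: y => [k||k] //= h; rewrite /rcol /leL /ltL /eq_op /=; split; lia.
Qed.

Lemma sorted_shift t n w : all (valid_letter t n) w ->
  colP t n.+1 (map letter_shift w) = colP t n w.
Proof.
move=> vw; rewrite /colP vw all_map (sub_all _ vw); last by move=> x; exact: valid_shift.
case: w vw => //= x w /andP[vx vw]; elim: w x vx vw => //= y w IH x vx /andP[vy vw].
by rewrite rcol_shift //= IH.
Qed.

Lemma sorted_rcons (T : Type) (r : rel T) (w : seq T) z : all (r^~ z) w -> sorted r (rcons w z) = sorted r w.
Proof.
case: w => //= x w; rewrite rcons_path => h; suff -> : r (last x w) z by rewrite andbT.
elim: w x h => [|y w IH] x /=; first by rewrite andbT.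
by case/and3P=> h1 h2 h3; apply: IH; rewrite /= h2.
Qed.

Lemma colP_cons t n w (s : bool * bool) : okn1 t n -> all (valid_letter t n) w ->
  colP t n.+1 (nseq s.1 (Pos 1) ++ map letter_shift w ++ nseq s.2 (Neg 1)) = colP t n w.
Proof.
move=> on vw; rewrite -(sorted_shift vw).
have vw' : all (valid_letter t n.+1) (map letter_shift w).
  by rewrite all_map; apply: sub_all vw => x; exact: valid_shift.
have hl : all (rcol t n.+1 (Pos 1)) (map letter_shift w).
  by rewrite all_map; apply: sub_all vw => x vx; have [] := rcol_1 on vx.
have hr : all ((rcol t n.+1)^~ (Neg 1)) (map letter_shift w).
  by rewrite all_map; apply: sub_all vw => x vx; have [] := rcol_1 on vx.
have pn : rcol t n.+1 (Pos 1) (Neg 1) by clear -on; case: t on => on; rewrite /rcol /leL /ltL /eq_op /=; simpl in on; lia.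
have st1 : colP t n.+1 (map letter_shift w ++ nseq s.2 (Neg 1)) = colP t n.+1 (map letter_shift w).
  case: (s.2); last by rewrite cats0.
  by rewrite /colP cats1 all_rcons sorted_rcons // vw' /=.
case: (s.1) => //=; rewrite -st1 /colP /= path_min_sorted //.
by rewrite all_cat hl; case: (s.2) => //=; rewrite pn.
Qed.

Lemma core_valid t b c : all (valid_letter t (dl t)) (core t b c).
Proof. by case: t => /=; [elim: c|elim: c b => //= c IH b; rewrite IH; case: b]. Qed.

Lemma colw_valid t st b c : all (valid_letter t (size st + dl t)) (colw st (core t b c)).
Proof.
elim: st => [|s st IH]; first exact: core_valid.
rewrite /= !all_cat all_map (sub_all _ IH); last by move=> x; exact: valid_shift.
by case: s => [[] []]; case: (t).
Qed.

Lemma okn1_st t (st : seq (bool * bool)) : okn1 t (size st + dl t).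
Proof. by case: t => //=; rewrite addn1. Qed.

Lemma colw_colP t st b c : colP t (size st + dl t) (colw st (core t b c)).
Proof.
elim: st => [|s st IH]; last by rewrite /= colP_cons ?colw_valid ?okn1_st.
rewrite /colP core_valid; case: t => /=; first by case: c => // c /=; elim: c => //= c ->.
case: c => // c /=; elim: c b => //= c IH b; rewrite IH andbT.
by case: b.
Qed.

(** In a column 1 can occur only as the first letter and \bar 1 only as the last, each at most once.
    Stripping both leaves a shifted column of lower rank. *)
Lemma colw_ex t n w : okn1 t n -> colP t n w ->
  exists st b c, size st + dl t = n /\ w = colw st (core t b c).
Proof.
elim: n w => [|n IH] w on.
  case: t on => // _ /andP[vw _]; exists [::], false, (size w); split => //=.
  by elim: w vw => //= x w IH /andP[]; case: x => [k||k] /=; [lia| |lia] => _ /IH {1}->.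
case: (boolP (okn1 t n)) => [on'|]; last first.
  (* Type D of rank 1: only 1 and \bar 1 occur and neither may follow itself, so the word alternates
     and is all core. *)
  case: t on {IH} => // _; case: n => // _ /andP[vw sw].
  case: w vw sw => [|x w]; first by exists [::], false, 0.
  move=> /= /andP[vx vw] pw; exists [::], (if x is Neg _ then true else false), (size w).+1; split => //=.
  elim: w x vx vw pw => [|y w IH] x vx vw; first by case: x vx => [k||k] //=; case: k => [|[]].
  case/andP: vw => vy vw /andP[rxy pw].
  rewrite {1}(IH y vy vw pw) /=; case: x vx rxy => [[|[|k]]||[|[|k]]] //= _;
    by case: y vy {IH pw} => [[|[|l]]||[|[|l]]].
move=> /andP[vw sw].
have strip u : all (valid_letter t n.+1) u -> sorted (rcol t n.+1) u -> exists a u',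
   [/\ u = nseq (a : bool) (Pos 1) ++ u', Pos 1 \notin u', all (valid_letter t n.+1) u' & sorted (rcol t n.+1) u'].
  have np x v : all (valid_letter t n.+1) (x :: v) -> path (rcol t n.+1) x v -> Pos 1 \notin v.
    elim: v x => //= y v IHv x /and3P[vx vy vv] /andP[rxy pv]; rewrite inE negb_or; apply/andP; split.
      by apply/eqP => yE; subst y; have [h _] := rcol_bad on' vx; rewrite h in rxy.
    by apply: (IHv y) => //=; rewrite vy.
  case: u => [|x u] vu su; first by exists false, [::].
  case: (eqVneq x (Pos 1)) => [xE|xn].
    exists true, u; split => //=; [by rewrite xE|exact: np vu su|by case/andP: vu|exact: path_sorted su].
  exists false, (x :: u); split => //=; rewrite inE negb_or eq_sym xn; exact: np vu su.
have [a [u [wE nu vu su]]] := strip w vw sw.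
have stripr : exists b u', [/\ u = u' ++ nseq (b : bool) (Neg 1), Neg 1 \notin u', all (valid_letter t n.+1) u' & sorted (rcol t n.+1) u'].
  have nn x v : all (valid_letter t n.+1) (rcons v x) -> sorted (rcol t n.+1) (rcons v x) -> Neg 1 \notin v.
    case: v => // y v /=; elim: v y => [|z v IHv] y /=.
      case/and3P=> vy vx _ /andP[r _]; rewrite inE; apply/eqP => yE; subst y.
      by have [_ h] := rcol_bad on' vx; rewrite h in r.
    case/and3P=> vy vz vv /andP[r p]; rewrite inE negb_or IHv ?vz // andbT; apply/eqP => yE; subst y.
    by have [_ h] := rcol_bad on' vz; rewrite h in r.
  case/lastP: u vu su {wE nu} => [|u x] vu su; first by exists false, [::].
  case: (eqVneq x (Neg 1)) => [xE|xn].
    exists true, u; split; [by rewrite xE cats1|exact: nn vu su|by move: vu; rewrite all_rcons => /andP[]|].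
    by move: su; rewrite -cats1 => /cat_sorted2[].
  exists false, (rcons u x); split => //; first by rewrite cats0.
  by rewrite mem_rcons inE negb_or eq_sym xn; exact: nn vu su.
have [b [v [uE nv vv sv]]] := stripr.
have [v' vE] : exists v', v = map letter_shift v' /\ all (valid_letter t n) v'.
  have : Pos 1 \notin v by move: nu; rewrite uE mem_cat negb_or => /andP[].
  elim: v vv nv {sv uE} => [|x v IHv] /=; first by exists [::].
  case/andP=> vx vv; rewrite !inE !negb_or => /andP[x1 n1] /andP[x2 n2].
  have [y [vy ->]] := valid_unshift vx (fun h => elimN eqP x2 (esym h)) (fun h => elimN eqP x1 (esym h)).
  by have [v' [-> h]] := IHv vv n1 n2; exists (y :: v'); rewrite /= vy.
case: vE => vE vv'; have : colP t n v' by rewrite -(sorted_shift vv') -vE /colP vv sv.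
case/(IH _ on') => st [b' [c [sE v'E]]]; exists ((a, b) :: st), b', c; split; first by rewrite /= addSn sE.
by rewrite wE uE vE v'E.
Qed.

Definition wrap (s : bool * bool) (w : seq letter) : seq letter :=
  nseq s.1 (Pos 1) ++ map letter_shift w ++ nseq s.2 (Neg 1).

Lemma colw_cons s st co : colw (s :: st) co = wrap s (colw st co).
Proof. by []. Qed.

Lemma shift_inj : injective letter_shift.
Proof. exact: can_inj letter_shiftK. Qed.

Lemma Ncnt_wrap t n s w k : okn1 t n -> all (valid_letter t n) w -> 0 < k <= n ->
  Ncnt t n.+1 (wrap s w) k.+1 = s.1 + s.2 + Ncnt t n w k.
Proof.
move=> on vw hk; rewrite /Ncnt /wrap !count_cat count_map.
have -> : count (preim letter_shift (fun x => leL t n.+1 x (Pos k.+1) || leL t n.+1 (Neg k.+1) x)) w =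
   count (fun x => leL t n x (Pos k) || leL t n (Neg k) x) w.
  apply: eq_in_count => x /(allP vw) vx /=.
  by rewrite -[Pos k.+1]/(letter_shift (Pos k)) -[Neg k.+1]/(letter_shift (Neg k)) !leL_shift.
have n0 : 0 < n by lia.
have vk : valid_letter t n (Pos k) by case: (t).
have vk' : valid_letter t n (Neg k) by case: (t).
have [h1 _ _ _] := leL_1 n0 vk; have [_ h2 _ _] := leL_1 n0 vk'.
by rewrite !count_nseq h1 h2 orbT /= !mul1n; lia.
Qed.

Lemma Ncnt_wrap1 t n s w : okn1 t n -> all (valid_letter t n) w -> Ncnt t n.+1 (wrap s w) 1 = s.1 + s.2.
Proof.
move=> on vw; rewrite /Ncnt /wrap !count_cat count_map.
have -> : count (preim letter_shift (fun x => leL t n.+1 x (Pos 1) || leL t n.+1 (Neg 1) x)) w = 0.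
  rewrite (@eq_in_count _ _ pred0) ?count_pred0 // => x /(allP vw) vx /=.
  case: (posnP n) => [n0|n0]; last by have [_ _ -> ->] := leL_1 n0 vx.
  by subst n; move: on vx; clear; case: t => // _; case: x => [k||k] //=; lia.
by rewrite !count_nseq /= !leLxx ?orbT !mul1n; lia.
Qed.

Lemma mem_wrap s w x : (letter_shift x \in wrap s w) = (x \in w) || (s.1 && (letter_shift x == Pos 1)) || (s.2 && (letter_shift x == Neg 1)).
Proof.
rewrite /wrap !mem_cat (mem_map shift_inj) orbCA -!orbA; congr (_ || (_ || _)).
  by case: (s.1); rewrite /= ?inE.
by case: (s.2); rewrite /= ?inE.
Qed.

Lemma pair_wrap s w k : 0 < k ->
  (Pos k.+1 \in wrap s w) = (Pos k \in w) /\ (Neg k.+1 \in wrap s w) = (Neg k \in w).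
Proof.
case: k => // k _; rewrite -[Pos k.+2]/(letter_shift (Pos k.+1)) -[Neg k.+2]/(letter_shift (Neg k.+1)) !mem_wrap.
by rewrite !andbF !orbF.
Qed.

Lemma pair_wrap1 t n s w : all (valid_letter t n) w ->
  (Pos 1 \in wrap s w) = s.1 /\ (Neg 1 \in wrap s w) = s.2.
Proof.
move=> vw; rewrite /wrap !mem_cat.
have nz x : x = Pos 1 \/ x = Neg 1 -> (x \in map letter_shift w) = false.
  move=> hx; apply/negP => /mapP[y /(allP vw) vy xE]; subst x.
  by case: y vy hx => [[|k]||[|k]] //= vy [].
by rewrite !nz ?orbF; [|by right|by left]; case: s => [[] []].
Qed.

Lemma size_wrap s w : size (wrap s w) = s.1 + s.2 + size w.
Proof. by rewrite /wrap !size_cat !size_nseq size_map; lia. Qed.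

(** Admissibility with slack g, which makes induction on the rank possible: removing position 1 with
    its s letters changes the slack to g + 1 - s, as in the walk. Slack 0 is admissibility, and
    slack 1 turns out to say that all proper factors are admissible. *)
Definition admg (t : ctype) (n g : nat) (w : seq letter) : Prop :=
  size w <= n + g /\
  forall k, 0 < k <= n -> Pos k \in w -> Neg k \in w -> Ncnt t n w k <= k + g.

Lemma admissibleE t n w : admissible t n w <-> admg t n 0 w.
Proof.
rewrite /admissible /admg addn0; split=> -[h1 h2]; split => // k lk p q; have := h2 k lk p q; lia.
Qed.

Lemma core_size t b c : size (core t b c) = c.
Proof. by case: t => /=; [rewrite size_nseq|elim: c b => //= c IH b; rewrite IH]. Qed.

Lemma alt_count b c : Ncnt TD 1 (alt b c) 1 = c.
Proof. by rewrite /Ncnt; elim: c b => //= c IH b; rewrite IH; case: b. Qed.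

Lemma adm_admg t g st b c : adm t g st c <-> admg t (size st + dl t) g (colw st (core t b c)).
Proof.
elim: st g => [|s st IH] g.
  rewrite /admg core_size; case: t => /=.
    split=> [h|[h _]]; [split; [lia|by move=> k; lia]|lia].
  split=> [h|[h _]]; last by lia.
  split; first by lia.
  by move=> k; case: k => [|[|k]] // _ _ _; rewrite alt_count; lia.
rewrite colw_cons [size _]/= addSn; set n := size st + dl t.
have on : okn1 t n := okn1_st t st.
have vw := colw_valid t st b c; rewrite -/n in vw.
have step d g' : (s.1 : nat) + s.2 + g' = g + 1 + d -> 
   (g' = g + d) -> False \/ True by right.
have key g' : (s.1 + s.2 + g' = g + 1) -> (s.1 && s.2 -> 0 < g) ->
  admg t n g' (colw st (core t b c)) <-> admg t n.+1 g (wrap s (colw st (core t b c))).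
  move=> gE hg; rewrite /admg size_wrap; split=> -[h1 h2]; split.
  - lia.
  - move=> k; case: k => // k lk; case: (posnP k) => [->|k0].
      have [-> ->] := pair_wrap1 s vw => s1 s2.
      by rewrite Ncnt_wrap1 // s1 s2; move: (hg (introT andP (conj s1 s2))); lia.
    have [-> ->] := pair_wrap s (colw st (core t b c)) k0 => p q.
    have lk' : 0 < k <= n by lia.
    rewrite Ncnt_wrap //; have := h2 k lk' p q; lia.
  - lia.
  - move=> k lk p q; have k0 : 0 < k by lia.
    have lk' : 0 < k.+1 <= n.+1 by lia.
    have [e1 e2] := pair_wrap s (colw st (core t b c)) k0.
    have := h2 k.+1 lk'; rewrite e1 e2 Ncnt_wrap // => /(_ p q); lia.
have kill : g = 0 -> s = (true, true) -> ~ admg t n.+1 g (wrap s (colw st (core t b c))).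
  move=> -> -> [h1 h2]; have := h2 1 isT.
  have [-> ->] := pair_wrap1 (true, true) vw => /(_ isT isT).
  by rewrite Ncnt_wrap1.
move: key kill; clear step; case: s => [[] []] key kill; rewrite [adm _ _ _ _]/=.
- case: g key kill IH => [|g] key kill IH; first by split=> // h; case: (kill erefl erefl h).
  by apply: iff_trans (IH g) _; apply: key => //=; lia.
- by apply: iff_trans (IH g) _; apply: key => //=; lia.
- by apply: iff_trans (IH g) _; apply: key => //=; lia.
- by apply: iff_trans (IH g.+1) _; apply: key => //=; lia.
Qed.

Definition badg t n g w k := [/\ 0 < k <= n, Pos k \in w, Neg k \in w & k + g < Ncnt t n w k].

Lemma til_spec t g st b c st' c' : til t g st c = Some (st', c') ->
  let n := size st + dl t in let w := colw st (core t b c) in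
  [/\ adm t g.+1 st c, ~~ adm t g st c &
  (exists k, [/\ k <= size st, badg t n g w k, forall k', k' < k -> ~ badg t n g w k' &
     colw st' (core t b c') = [seq x <- w | (x != Pos k) && (x != Neg k)]]) \/
  ((forall k, k <= size st -> ~ badg t n g w k) /\ st' = st /\ c = (c' + (dl t)).+1)].
Proof.
elim: st g st' => [|s st IH] g st'.
  rewrite /=; case: ifP => // /eqP -> [<- <-]; split; [lia|lia|right; split => //].
  by move=> k; case: k => // _ [].
move=> h; cbv zeta; rewrite [size _]/= addSn colw_cons; set n := size st + dl t; set w := colw st (core t b c).
have on : okn1 t n := okn1_st t st.
have vw : all (valid_letter t n) w := colw_valid t st b c.
have [[h1 h2 h3]|[g' [st1 [h1 h2 h3 h4 h5]]]] :
   [/\ g = 0 /\ s = (true, true), st' = (false, false) :: st /\ c' = c & adm t 0 st c] \/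
   exists g' st1, [/\ til t g' st c = Some (st1, c'), st' = s :: st1, s.1 + s.2 + g' = g + 1,
     (s.1 && s.2 -> 0 < g) & (adm t g.+1 (s :: st) c = adm t g'.+1 st c) /\ (adm t g (s :: st) c = adm t g' st c)].
- clear -h; case: s h => [[] []] /=; [case: g => [|g']| | |] => h.
  + by move: h; case E: (adm t 0 st c) => // -[<- <-]; left.
  + right; exists g'; move: h; case E: (til t g' st c) => [[st1 c1]|] //= [<- <-]; exists st1; split => //=; clear; lia.
  + right; exists g; move: h; case E: (til t g st c) => [[st1 c1]|] //= [<- <-]; exists st1; split => //=; clear; lia.
  + right; exists g; move: h; case E: (til t g st c) => [[st1 c1]|] //= [<- <-]; exists st1; split => //=; clear; lia.
  + right; exists g.+1; move: h; case E: (til t g.+1 st c) => [[st1 c1]|] //= [<- <-]; exists st1; split => //=; clear; lia.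
- case: h1 => -> ->; case: h2 => -> ->; split => //; left; exists 1.
  have [p1 p2] := pair_wrap1 (true, true) vw.
  split => //.
  + by split=> //; rewrite ?p1 ?p2 // Ncnt_wrap1.
  + by case=> // _ [].
  + rewrite colw_cons /wrap /= filter_cat /= cats0 /= -/w.
    rewrite [X in _ = X ++ _](_ : _ = map letter_shift w) ?cats0 //.
    rewrite filter_map; congr map; apply/all_filterP; apply: sub_all vw => x.
    by case: x => [[|k]||[|k]].
have bs k : 0 < k -> badg t n.+1 g (wrap s w) k.+1 <-> badg t n g' w k.
  move=> k0; have [e1 e2] := pair_wrap s w k0; rewrite /badg e1 e2.
  have ar N : (k.+1 + g < s.1 + s.2 + N) = (k + g' < N) by move: h3; clear; lia.
  split=> -[l p q]; have lk : 0 < k <= n by rewrite k0; case/andP: l.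
    by rewrite Ncnt_wrap // ar.
  by move=> hk; split; [case/andP: lk|by []|by []|rewrite Ncnt_wrap // ar].
have b1 : ~ badg t n.+1 g (wrap s w) 1.
  case; have [-> ->] := pair_wrap1 s vw => _ s1 s2; rewrite Ncnt_wrap1 // s1 s2.
  by move: (h4 (introT andP (conj s1 s2))); clear; case: g.
have [i1 i2 i3] := IH _ _ h1; rewrite -/n -/w in i3.
rewrite (proj1 h5) (proj2 h5) i1 i2; split => //; case: i3 => [[k [k1 k2 k3 k4]]|[k1 [k2 k3]]].
  left; exists k.+1; have k0 : 0 < k by case: k2 => /andP[].
  split => //; first exact/bs.
    case=> [|[|k']] hk; [by case|exact: b1|].
    by move/(bs k'.+1 isT); apply: k3.
  rewrite h2 colw_cons k4 /wrap !filter_cat; congr (_ ++ (_ ++ _)).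
  - by case: (s.1) => //=; case: k k0 {k1 k2 k3 k4}.
  - rewrite filter_map; congr map; apply: eq_filter => x /=.
    by rewrite -[Pos k.+1]/(letter_shift (Pos k)) -[Neg k.+1]/(letter_shift (Neg k)) !(inj_eq shift_inj).
  - by case: (s.2) => //=; case: k k0 {k1 k2 k3 k4}.
right; split; last by rewrite h2 k2.
case=> [|[|k]] hk; [by case|exact: b1|].
by move/(bs k.+1 isT); apply: k1.
Qed.

Lemma til_ex t g st c : adm t g.+1 st c -> ~~ adm t g st c -> exists st' c', til t g st c = Some (st', c').
Proof.
elim: st g => [|s st IH] g /=.
  by move=> h1 h2; exists [::], g; rewrite ifT //; lia.
case: s => [[] []].
- case: g => [|g] /=; first by move=> -> _; exists ((false, false) :: st), c.
  by move=> h1 h2; have [st' [c' ->]] := IH _ h1 h2; eexists; eexists.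
- by move=> h1 h2; have [st' [c' ->]] := IH _ h1 h2; eexists; eexists.
- by move=> h1 h2; have [st' [c' ->]] := IH _ h1 h2; eexists; eexists.
- by move=> h1 h2; have [st' [c' ->]] := IH _ h1 h2; eexists; eexists.
Qed.

Definition counted t n k x := leL t n x (Pos k) || leL t n (Neg k) x.

Lemma counted_lo t n k y : valid_letter t n y -> 0 < k <= n -> rank t n y <= k -> counted t n k y.
Proof.
by case: t; case: y => [l||l] //=; rewrite /counted /leL /ltL /eq_op /=; lia.
Qed.

Lemma counted_hi t n k y : valid_letter t n y -> 0 < k <= n -> rank t n (Neg k) <= rank t n y -> counted t n k y.
Proof.
by case: t; case: y => [l||l] //=; rewrite /counted /leL /ltL /eq_op /=; lia.
Qed.

Lemma not_counted t n k y : valid_letter t n y -> 0 < k <= n -> y <> Pos k -> y <> Neg k ->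
  k <= rank t n y <= rank t n (Neg k) -> counted t n k y = false.
Proof.
move=> vy hk /eqP/negbTE n1 /eqP/negbTE n2; rewrite /counted /leL n1 [Neg k == y]eq_sym n2 /ltL.
by case: t vy; case: y {n1 n2} => [l||l] //=; lia.
Qed.

Lemma colP_pairwise t n w : colP t n w -> pairwise (fun x y => rank t n x <= rank t n y) w.
Proof.
case/andP=> _ sw; rewrite -sorted_pairwise; last by move=> x y z; exact: leq_trans.
by apply: sub_sorted sw => x y; exact: rcol_rank.
Qed.

(** If k and \bar k both lie in a factor, every letter outside it is counted by N(k). So N(k) of a
    proper factor is smaller by at least one, which makes up for the slack. *)
Lemma factors_of_adm t n w : colP t n w -> admg t n 1 w -> proper_factors_adm t n w.
Proof.
move=> cw [h1 h2] a b c wE sb; apply/admissibleE; split.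
  by rewrite addn0; move: h1 sb; clear; lia.
move=> k lk p q; subst w; have pw := colP_pairwise cw; case/andP: cw => vw _.
move: pw vw h1 sb; rewrite !pairwise_cat !all_cat !size_cat => /and3P[r1 _ /and3P[r2 _ _]] /and3P[va vb vc] h1 sb.
have ca : Ncnt t n a k = size a.
  apply/eqP; rewrite -all_count; apply/allP => y hy; apply: counted_lo; [exact: (allP va)|by []|].
  by have := allrelP r1 y (Pos k) hy; rewrite mem_cat p => /(_ isT); case: (t).
have cc : Ncnt t n c k = size c.
  apply/eqP; rewrite -all_count; apply/allP => y hy; apply: counted_hi; [exact: (allP vc)|by []|].
  exact: (allrelP r2).
have := h2 k lk; rewrite !mem_cat p q !orbT => /(_ isT isT).
rewrite /Ncnt !count_cat -!/(Ncnt t n _ k) ca cc; move: sb; clear; lia.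
Qed.

(** Deleting the first or the last letter lowers N(k) by at most one. A pair k, \bar k that survives
    neither deletion consists of these two letters themselves; then nothing between them is counted,
    and N(k) <= 2 <= k + 1. *)
Lemma adm_of_factors t n w : colP t n w -> proper_factors_adm t n w -> admg t n 1 w.
Proof.
move=> cw pf.
have fac a b c : w = a ++ b ++ c -> size b < size w -> admg t n 0 b.
  by move=> h1 h2; apply/admissibleE; exact: (pf a b c).
case: w cw pf fac => [|x w] cw pf fac; first by split.
case/lastP: w cw pf fac => [|m z] cw pf fac.
  split; first by have [h _] := fac [::] [::] [:: x] erefl isT; rewrite /=; lia.
  by move=> k _; rewrite !inE => /eqP <-.
have szE : size (x :: rcons m z) = (size m).+2 by rewrite /= size_rcons.
have [t1 t2] : admg t n 0 (rcons m z).
  by apply: (fac [:: x] _ [::]); rewrite ?cats0 // szE size_rcons.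
have [i1 i2] : admg t n 0 (x :: m).
  by apply: (fac [::] _ [:: z]); rewrite ?cats1 // szE.
split; first by move: i1; rewrite szE /=; lia.
move=> k lk p q.
have NE : Ncnt t n (x :: rcons m z) k = counted t n k x + Ncnt t n m k + counted t n k z.
  by rewrite /Ncnt /= -cats1 count_cat /=; rewrite -!/(counted t n k _); lia.
have N1 : Ncnt t n (rcons m z) k = Ncnt t n m k + counted t n k z.
  by rewrite /Ncnt -cats1 count_cat /=; rewrite -!/(counted t n k _); lia.
have N2 : Ncnt t n (x :: m) k = counted t n k x + Ncnt t n m k by [].
have b1 (b : bool) : b <= 1 by case: b.
case pq1 : ((Pos k \in rcons m z) && (Neg k \in rcons m z)).
  case/andP: pq1 => p1 q1; have := t2 k lk p1 q1; rewrite NE N1; have := b1 (counted t n k x); clear; lia.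
case pq2 : ((Pos k \in x :: m) && (Neg k \in x :: m)).
  case/andP: pq2 => p1 q1; have := i2 k lk p1 q1; rewrite NE N2; have := b1 (counted t n k z); clear; lia.
suff m0 : Ncnt t n m k = 0 by rewrite NE m0; have := b1 (counted t n k x); have := b1 (counted t n k z); move: lk; clear; lia.
have [pm [qm hr]] : Pos k \notin m /\ Neg k \notin m /\
   (forall y, y \in m -> k <= rank t n y <= rank t n (Neg k)).
  have pw := colP_pairwise cw; have kr : k <= rank t n (Neg k) by move: lk; clear; case: t => /=; lia.
  have rk : rank t n (Pos k) = k by case: (t).
  have pw' y : y \in m -> rank t n x <= rank t n y <= rank t n z.
    move=> hy; move: pw; rewrite /= -cats1 pairwise_cat all_cat => /andP[/andP[/allP hx _] /and3P[/allrelP hz _ _]].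
    by rewrite hx // hz // inE.
  move: p q pq1 pq2; rewrite !inE !mem_rcons !inE => p q pq1 pq2.
  have [-> [-> hh]] : (Pos k \in m) = false /\ (Neg k \in m) = false /\
     ((Pos k == x) && (Neg k == z) || (Neg k == x) && (Pos k == z)).
    move: p q pq1 pq2; case: (Pos k == x); case: (Pos k == z); case: (Pos k \in m);
    by case: (Neg k == x); case: (Neg k == z); case: (Neg k \in m).
  split => //; split => // y /pw'.
  case/orP: hh => /andP[/eqP <- /eqP <-]; rewrite rk //.
  by move=> /andP[h1 h2]; rewrite (leq_trans kr h1) (leq_trans h2 kr).
apply/eqP; rewrite -leqn0 leqNgt -has_count; apply/hasPn => y hy.
rewrite -/(counted t n k y) not_counted //.
- by case/andP: cw => /allP vw _; apply: vw; rewrite inE mem_rcons inE hy !orbT.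
- by move=> yE; rewrite -yE hy in pm.
- by move=> yE; rewrite -yE hy in qm.
- exact: hr.
Qed.

Lemma wrap_split s u a e c : wrap s u = a ++ e ++ c -> e <> [::] ->
  (forall x, x \in e -> x <> Pos 1 /\ x <> Neg 1) ->
  exists a' c' e', [/\ u = a' ++ e' ++ c', e = map letter_shift e' &
    forall e1, a ++ map letter_shift e1 ++ c = wrap s (a' ++ e1 ++ c')].
Proof.
move=> h en he.
have [a1 aE] : exists a1, a = nseq s.1 (Pos 1) ++ a1.
  move: h; rewrite /wrap; case: (s.1) => /=; last by exists a.
  case: a => [|y a] /=; last by case=> <- _; exists a.
  case: e en he => // x e _ he [xE _]; have [h _] := he x (mem_head _ _); by case: h.
have [c1 cE] : exists c1, c = c1 ++ nseq s.2 (Neg 1).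
  move: h; rewrite /wrap; case: (s.2) => /=; last by exists c; rewrite cats0.
  rewrite !catA !cats1; case/lastP: c => [|c z]; last first.
    by rewrite -rcons_cat => /rcons_inj[_ ->]; exists c; rewrite cats1.
  rewrite cats0; case/lastP: e en he => // e x _ he; rewrite -rcons_cat => /rcons_inj[_ xE].
  have hx : x \in rcons e x by rewrite mem_rcons mem_head.
  by have [_ h'] := he x hx; case: h'.
move: h; rewrite /wrap aE cE -!catA => /eqP; rewrite eqseq_cat // eqxx /= => /eqP h.
have {}h : map letter_shift u = a1 ++ e ++ c1.
  have sz := congr1 size h; move/eqP: h; rewrite !catA eqseq_cat; last first.
    by move: sz; rewrite !size_cat; clear; lia.
  by case/andP=> /eqP -> _; rewrite -!catA.
have uE : u = map letter_unshift a1 ++ map letter_unshift e ++ map letter_unshift c1.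
  by rewrite -!map_cat -h -map_comp map_id_in // => x _ /=; rewrite letter_shiftK.
have sE : a1 ++ e ++ c1 = map letter_shift (map letter_unshift (a1 ++ e ++ c1)).
  by rewrite -h -map_comp; rewrite -[in RHS]map_comp; apply: eq_map => x /=; rewrite letter_shiftK.
move: sE; rewrite !map_cat => /eqP; rewrite eqseq_cat ?size_map // => /andP[/eqP aS].
rewrite eqseq_cat ?size_map // => /andP[/eqP eS /eqP cS].
exists (map letter_unshift a1), (map letter_unshift c1), (map letter_unshift e); split => // e1.
by rewrite !map_cat -aS -cS -!catA.
Qed.

Fixpoint shiftn k (w : seq letter) := if k is k'.+1 then map letter_shift (shiftn k' w) else w.

Lemma size_shiftn k w : size (shiftn k w) = size w.
Proof. by elim: k => //= k; rewrite size_map. Qed.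

Lemma colw_insert st e c1 c2 : exists a c, colw st (c1 ++ e ++ c2) = a ++ shiftn (size st) e ++ c /\
   colw st (c1 ++ c2) = a ++ c.
Proof.
elim: st => [|s st [a [c [h1 h2]]]]; first by exists c1, c2.
exists (nseq s.1 (Pos 1) ++ map letter_shift a), (map letter_shift c ++ nseq s.2 (Neg 1)).
by rewrite !colw_cons h1 h2 /wrap !map_cat -!catA.
Qed.

(** The letters of the factor have an index beyond all states, or are 0, so they can only come from
    the core. *)
Lemma colw_erase st e co a c : colw st co = a ++ shiftn (size st) e ++ c -> e <> [::] ->
  all lpos e ->
  exists c1 c2, co = c1 ++ e ++ c2 /\ colw st (c1 ++ c2) = a ++ c.
Proof.
move=> h en le; elim: st a c h => [|s st IH] a c h; first by exists a, c.
rewrite colw_cons in h.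
have nn : shiftn (size (s :: st)) e <> [::].
  by move=> h'; have := congr1 size h'; rewrite size_shiftn; case: (e) en.
have he x : x \in shiftn (size (s :: st)) e -> x <> Pos 1 /\ x <> Neg 1.
  rewrite /= => /mapP[y + ->]; suff: all lpos (shiftn (size st) e).
    by move/allP => H /H; case: y => [[|k]||[|k]].
  by elim: (size st) => //= k IHk; rewrite all_map; apply: sub_all IHk => -[k'||k'].
have [a' [c' [e' [uE eE H]]]] := wrap_split h nn he.
have e'E : e' = shiftn (size st) e by apply: (inj_map shift_inj); rewrite -eE.
rewrite e'E in uE; have [c1 [c2 [coE cE]]] := IH _ _ uE.
exists c1, c2; split => //; rewrite colw_cons cE.
by have := H [::]; rewrite /= => ->.
Qed.

Lemma badzE t n w k : badz t n w k <-> badg t n 0 w k.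
Proof. by rewrite /badz /badg addn0. Qed.

Lemma okn_okn1 t n : okn t n -> okn1 t n.
Proof. by case: t => //= h; rewrite ltnW. Qed.

Lemma R5_til t n w : okn t n -> colP t n w -> ~ admissible t n w -> proper_factors_adm t n w ->
  exists st b c st' c', [/\ size st + dl t = n, w = colw st (core t b c), til t 0 st c = Some (st', c') &
   til_rel t n (Vw w) (Vw (colw st' (core t b c')))].
Proof.
move=> on cw na pf; have [st [b [c [sn wE]]]] := colw_ex (okn_okn1 on) cw.
have a1 : adm t 1 st c by apply/(adm_admg t 1 st b c); rewrite sn -wE; exact: adm_of_factors.
have a0 : ~~ adm t 0 st c.
  by apply/negP => /(adm_admg t 0 st b c); rewrite sn -wE => /admissibleE.
have [st' [c' h]] := til_ex a1 a0.
exists st, b, c, st', c'; split => //; exists st, b, c, st', c'; split => //.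
by rewrite wE.
Qed.

Lemma R5_til_pair t n w k : okn t n -> colP t n w -> ~ admissible t n w -> proper_factors_adm t n w ->
  lowest_badz t n w k -> k + dl t <= n ->
  til_rel t n (Vw w) (Vw [seq x <- w | (x != Pos k) && (x != Neg k)]).
Proof.
move=> on cw na pf [bk lk] kn; have [st [b [c [st' [c' [sn wE h r]]]]]] := R5_til on cw na pf.
have [_ _ []] := til_spec b h; rewrite sn -wE.
  case=> k' [k1 k2 k3 k4]; suff <- : k' = k by rewrite -k4.
  case: (ltngtP k k') => // hk; last by case: (lk k' hk); apply/badzE.
  by case: (k3 k hk); apply/badzE.
case=> h1 _; case: (h1 k); last by apply/badzE.
by move: kn; rewrite -sn leq_add2r.
Qed.

Lemma nseq_erase c (x : letter) c1 c2 : nseq c x = c1 ++ [:: x] ++ c2 -> c1 ++ c2 = nseq c.-1 x.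
Proof.
elim: c c1 => [|c IH] [|y c1] //=; first by case.
by case=> <- h; move: (h) => /IH ->; case: c h {IH} => //; case: c1.
Qed.

(** Wherever two neighbours are removed, an alternating string stays alternating with the same
    start. Hence R5 with z = n gives the same word for every choice of the consecutive pair. *)
Lemma alt_erase b c x c1 c2 : alt b c = c1 ++ [:: x; bar x] ++ c2 -> exists c', c = c'.+2 /\ c1 ++ c2 = alt b c'.
Proof.
elim: c1 b c => [|y c1 IH] b [|c] //=.
  by case: c => [|c] //= [_ _ <-]; exists c; rewrite negbK.
by case=> <- /IH [c' [-> ->]]; exists c'.+1.
Qed.

Lemma shiftn_pos k x : shiftn k [:: x] = [:: iter k letter_shift x].
Proof. by elim: k => //= k ->. Qed.

Lemma shiftn_pair k x y : shiftn k [:: x; y] = [:: iter k letter_shift x; iter k letter_shift y].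
Proof. by elim: k => //= k ->. Qed.

Lemma iter_shift k : [/\ iter k letter_shift Zer = Zer, iter k letter_shift (Pos 1) = Pos k.+1 &
  iter k letter_shift (Neg 1) = Neg k.+1].
Proof. by elim: k => //= k [-> -> ->]. Qed.

Lemma R5_til_zero n a c : 0 < n -> colP TB n (a ++ Zer :: c) -> ~ admissible TB n (a ++ Zer :: c) ->
  proper_factors_adm TB n (a ++ Zer :: c) -> (forall k, ~ badz TB n (a ++ Zer :: c) k) ->
  til_rel TB n (Vw (a ++ Zer :: c)) (Vw (a ++ c)).
Proof.
move=> n0 cw na pf nb; have [st [b [d [st' [d' [sn wE h r]]]]]] := R5_til (t := TB) n0 cw na pf.
have [_ _ []] := til_spec b h; rewrite sn -wE.
  by case=> k [k1 k2 _ _]; case: (nb k); apply/badzE.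
case=> _ [stE dE]; suff -> : a ++ c = colw st' (core TB b d') by [].
have [e0 _ _] := iter_shift (size st).
have wE' : colw st (core TB b d) = a ++ shiftn (size st) [:: Zer] ++ c by rewrite shiftn_pos e0 -wE.
have [c1 [c2 [dd <-]]] := colw_erase wE' (fun h => ltac:(discriminate h)) isT.
by rewrite stE /=; rewrite (nseq_erase dd) dE addn0.
Qed.

Lemma R5_til_n n a c x : 1 < n -> x = Pos n \/ x = Neg n -> let w := a ++ [:: x; bar x] ++ c in
  colP TD n w -> ~ admissible TD n w ->
  proper_factors_adm TD n w -> lowest_badz TD n w n ->
  til_rel TD n (Vw w) (Vw (a ++ c)).
Proof.
move=> n1 hx w cw na pf [bn lb]; have [st [b [d [st' [d' [sn wE h r]]]]]] := R5_til (t := TD) n1 cw na pf.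
have [_ _ []] := til_spec b h; rewrite sn -wE.
  case=> k [k1 k2 _ _]; case: (lb k); last exact/badzE.
  by move: sn k1 => /=; lia.
case=> _ [stE dE]; suff -> : a ++ c = colw st' (core TD b d') by [].
have [_ e1 e2] := iter_shift (size st).
have sn1 : (size st).+1 = n by move: sn => /=; lia.
have [y [yE lp]] : exists y, [:: x; bar x] = shiftn (size st) [:: y; bar y] /\ all lpos [:: y; bar y].
  case: hx => ->; [exists (Pos 1)|exists (Neg 1)]; split => //=;
    by rewrite shiftn_pair e1 e2 sn1.
have wE' : colw st (core TD b d) = a ++ shiftn (size st) [:: y; bar y] ++ c by rewrite -yE -wE.
have [c1 [c2 [dd <-]]] := colw_erase wE' (fun h => ltac:(discriminate h)) lp.
have [c' [dE' ->]] := alt_erase dd.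
by rewrite stE /=; move: dE; rewrite dE' /= addn1 => -[->].
Qed.

(** R5 for both types: [k + dl t <= n] reads k <= n in type B and k < n in type D, where z = n is
    left to [R5n]. *)
Inductive relR5 (t : ctype) (n : nat) : seq letter -> seq letter -> Prop :=
| R5pair w k : colP t n w -> ~ admissible t n w -> proper_factors_adm t n w ->
    lowest_badz t n w k -> k + dl t <= n ->
    relR5 t n w [seq x <- w | (x != Pos k) && (x != Neg k)]
| R5zero a c : t = TB -> colP t n (a ++ Zer :: c) -> ~ admissible t n (a ++ Zer :: c) ->
    proper_factors_adm t n (a ++ Zer :: c) -> (forall k, ~ badz t n (a ++ Zer :: c) k) ->
    relR5 t n (a ++ Zer :: c) (a ++ c)
| R5n a c x : t = TD -> x = Pos n \/ x = Neg n -> colP t n (a ++ [:: x; bar x] ++ c) ->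
    ~ admissible t n (a ++ [:: x; bar x] ++ c) ->
    proper_factors_adm t n (a ++ [:: x; bar x] ++ c) -> lowest_badz t n (a ++ [:: x; bar x] ++ c) n ->
    relR5 t n (a ++ [:: x; bar x] ++ c) (a ++ c).

Lemma til_relR5 t n u v : okn t n -> til_rel t n u v -> exists w w', [/\ u = Vw w, v = Vw w' & relR5 t n w w'].
Proof.
move=> on [st [b [c [st' [c' [sn h -> ->]]]]]].
have sn' : size st + dl t = n by [].
exists (colw st (core t b c)), (colw st' (core t b c')); split => //.
have [a1 a0 hs] := til_spec b h; rewrite sn' in hs.
have cw : colP t n (colw st (core t b c)) by rewrite -sn'; exact: colw_colP.
have na : ~ admissible t n (colw st (core t b c)).
  by move/admissibleE; rewrite -sn' => /adm_admg h'; rewrite h' in a0.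
have pf : proper_factors_adm t n (colw st (core t b c)).
  by apply: factors_of_adm => //; move/(adm_admg t 1 st b c): a1; rewrite sn'.
case: hs => [[k [k1 k2 k3 ->]]|[nb [stE cE]]].
  apply: R5pair => //; last by rewrite -sn' leq_add2r.
  by split; [exact/badzE|move=> k' /k3 h' /badzE].
subst st'.
have nb' k : k <= size st -> ~ badz t n (colw st (core t b c)) k by move=> hk /badzE; exact: nb.
case: t on {h a1 a0 nb} sn sn' cw na pf nb' cE => on sn sn' cw na pf nb' cE.
  have e0 : shiftn (size st) [:: Zer] = [:: Zer].
    by rewrite shiftn_pos; have [-> _ _] := iter_shift (size st).
  have [a [d [h1 h2]]] := colw_insert st [:: Zer] [::] (nseq c' Zer).
  have h1' : colw st (core TB b c) = a ++ Zer :: d by rewrite /= cE addn0 -[LHS]/(colw st ([::] ++ [:: Zer] ++ nseq c' Zer)) h1 e0.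
  have h2' : colw st (core TB b c') = a ++ d by rewrite -h2.
  rewrite h2' h1' in cw na pf nb' *; apply: R5zero => // k hk; case: (hk) => lk _ _ _.
  by apply: (nb' k) => //; move: sn' lk => /=; rewrite addn0; lia.
have cE' : c = c'.+2 by move: cE => /=; lia.
pose y := if b then Neg 1 else Pos 1.
have sn1 : (size st).+1 = n by move: sn' => /=; lia.
have [x [hx xE]] : exists x, (x = Pos n \/ x = Neg n) /\ shiftn (size st) [:: y; bar y] = [:: x; bar x].
  have [_ e1 e2] := iter_shift (size st).
  rewrite shiftn_pair /y; case: (b); rewrite /= e1 e2 sn1.
    by exists (Neg n); split; [right|].
  by exists (Pos n); split; [left|].
have [a [d [h1 h2]]] := colw_insert st [:: y; bar y] [::] (alt b c').
have h1' : colw st (core TD b c) = a ++ [:: x; bar x] ++ d.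
  by rewrite -xE -h1 cE' /=; congr (colw st _); rewrite /y; case: (b).
have h2' : colw st (core TD b c') = a ++ d by rewrite -h2.
rewrite h2'; rewrite h1' in cw na pf nb' *; apply: R5n => //; split; last first.
  by move=> k hk; apply: nb'; lia.
(* No letter below n is bad, so only n can violate admissibility. N(n) counts the whole column; if
   the length is at most n the column is admissible after all, and otherwise n is bad. *)
have [[h|h] hm] : (size (a ++ [:: x; bar x] ++ d) <= n \/ ~ (size (a ++ [:: x; bar x] ++ d) <= n)) /\
    (x \in a ++ [:: x; bar x] ++ d /\ bar x \in a ++ [:: x; bar x] ++ d).
- split; first by case: (leqP (size (a ++ [:: x; bar x] ++ d)) n) => h; [left|right].
  by rewrite !mem_cat !inE !eqxx !orbT.
- case: na; split => // k lk p q; case: (leqP (Ncnt TD n (a ++ [:: x; bar x] ++ d) k) k) => // hN.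
  case: (leqP k (size st)) => hk; first by case: (nb' k hk).
  have kn : k = n by lia.
  by move: hN; rewrite ltnNge kn (leq_trans (count_size _ _) h).
split; first by lia.
- by case: hm; case: hx => ->.
- by case: hm; case: hx => ->.
suff -> : Ncnt TD n (a ++ [:: x; bar x] ++ d) n = size (a ++ [:: x; bar x] ++ d) by lia.
apply/eqP; rewrite -all_count; case/andP: cw => vw _; apply: sub_all vw => z vz.
by move: vz; clear -on; case: z => [k||k] //=; rewrite /leL /ltL /eq_op /=; simpl in on; lia.
Qed.

Lemma relR5_til t n w w' : okn t n -> relR5 t n w w' -> til_rel t n (Vw w) (Vw w').
Proof.
move=> on h; case: h on.
- by move=> u k h1 h2 h3 h4 h5 on; exact: R5_til_pair.
- by move=> a c -> h1 h2 h3 h4 on; exact: R5_til_zero.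
- by move=> a c x -> h1 h2 h3 h4 h5 on; exact: R5_til_n.
Qed.

(** * Sorting the generators into families *)

Lemma ltL_lenc t n x y : okn t n -> valid_letter t n x -> valid_letter t n y ->
  ltL t n x y = (lenc t n x < lenc t n y) && (if t is TD then ~~ ((lenc t n x == n) && (lenc t n y == n.+1)) else true).
Proof.
by rewrite /ltL /lenc; case: t => /= on; case: x => [k||k]; case: y => [l||l] //=; lia.
Qed.

Lemma lenc_inj t n x y : valid_letter t n x -> valid_letter t n y -> (x == y) = (lenc t n x == lenc t n y).
Proof.
move=> vx vy; apply/eqP/eqP => [-> //|h]; by rewrite -(lencK vx) h lencK.
Qed.

Lemma leL_lenc t n x y : okn t n -> valid_letter t n x -> valid_letter t n y ->
  leL t n x y = (lenc t n x <= lenc t n y) && (if t is TD then ~~ ((lenc t n x == n) && (lenc t n y == n.+1)) else true).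
Proof.
move=> on vx vy; rewrite /leL ltL_lenc // (lenc_inj vx vy).
by case: t on {vx vy} => /= on; lia.
Qed.

Definition lsum t n := n + n + (if t is TB then 2 else 1).

Lemma bar_lenc t n x : okn t n -> valid_letter t n x -> lenc t n x + lenc t n (bar x) = lsum t n /\ valid_letter t n (bar x).
Proof. by rewrite /lenc /lsum; case: t => /= on; case: x => [k||k] //=; lia. Qed.

Lemma neq_bar_lenc t n x y : okn t n -> valid_letter t n x -> valid_letter t n y ->
  x <> bar y <-> lenc t n x + lenc t n y <> lsum t n.
Proof.
move=> on vx vy; have [s vb] := bar_lenc on vy.
split=> h e; apply: h.
  by apply/eqP; rewrite (lenc_inj vx vb); apply/eqP; lia.
by rewrite e; lia.
Qed.

Lemma ldec_pos t n k : k <= n -> ldec t n k = Pos k.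
Proof. by rewrite /ldec => ->. Qed.

Lemma ldec_neg t n k : 0 < k <= n -> ldec t n (lsum t n - k) = Neg k.
Proof.
move=> hk; rewrite /ldec /lsum; case: t; repeat case: ifP => /=; intros; try (exfalso; lia); f_equal; lia.
Qed.

Lemma ldec_zer n : ldec TB n n.+1 = Zer.
Proof. by rewrite /ldec ltnn eqxx. Qed.

Lemma knuth_intro t n x y z x' y' z' : okn t n ->
  [&& valid_letter t n x, valid_letter t n y & valid_letter t n z] ->
  [&& valid_letter t n x', valid_letter t n y' & valid_letter t n z'] ->
  (if t is TB then knuthB n (lenc t n x, lenc t n y, lenc t n z) (lenc t n x', lenc t n y', lenc t n z')
   else knuthD n (lenc t n x, lenc t n y, lenc t n z) (lenc t n x', lenc t n y', lenc t n z')) ->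
  knuth_rel t n [:: V x; V y; V z] [:: V x'; V y'; V z'].
Proof.
move=> on /and3P[v1 v2 v3] /and3P[v4 v5 v6] K.
exists (lenc t n x, lenc t n y, lenc t n z), (lenc t n x', lenc t n y', lenc t n z').
by rewrite /w3 /= !lencK.
Qed.

(** Each of the four families is closed under the operators by itself. The way back into [relB] is
    given by [knuth_relB], [relR5_relB], [spin_rel_rel] and [relB_iso]. *)
Lemma relB_cases n u v : 0 < n -> relB n u v -> knuth_rel TB n u v \/
  (exists w w', [/\ u = Vw w, v = Vw w' & relR5 TB n w w']) \/ spin_rel TB n u v \/
  exists Sm w, [/\ u = Sm (Vw w), v = Vw w, cryst_iso TB n (in_comps TB n (seedsB n)) (tgtB n) Sm,
     (colB n w /\ admissible TB n w) & in_comps TB n (seedsB n) (Vw w)].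
Proof.
move=> n0; have on : okn TB n by [].
case.
- move=> x y z vx vy vz h1 h2 /(neq_bar_lenc on vx vz); rewrite /lsum => h3; left.
  apply: knuth_intro; rewrite ?vx ?vy ?vz //.
  move: h1 h2 (lenc_bound vx) (lenc_bound vz); rewrite /lmax !(ltL_lenc on) // => *.
  by apply: kB1a; lia.
- move=> x y z vx vy vz h1 h2 /(neq_bar_lenc on vx vz); rewrite /lsum => h3; left.
  apply: knuth_intro; rewrite ?vx ?vy ?vz //.
  move: h1 h2 (lenc_bound vx) (lenc_bound vz); rewrite /lmax !(ltL_lenc on) // => *.
  by apply: kB1b; lia.
- move=> x y vx vy h1 /(neq_bar_lenc on vx vy); rewrite /lsum => h3 xz; left.
  apply: knuth_intro; rewrite ?vx ?vy //.
  have vZ : valid_letter TB n Zer by [].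
  have xz' : lenc TB n x <> n.+1 by move=> e; apply: xz; apply/eqP; rewrite (lenc_inj vx vZ) e.
  move: h1 (lenc_bound vx) (lenc_bound vy); rewrite /lmax !(ltL_lenc on) // => *.
  by apply: kB2a; lia.
- move=> x y vx vy h1 /(neq_bar_lenc on vx vy); rewrite /lsum => h3 xz; left.
  apply: knuth_intro; rewrite ?vx ?vy //.
  have vZ : valid_letter TB n Zer by [].
  have xz' : lenc TB n y <> n.+1 by move=> e; apply: xz; apply/eqP; rewrite (lenc_inj vy vZ) e.
  move: h1 (lenc_bound vx) (lenc_bound vy); rewrite /lmax !(ltL_lenc on) // => *.
  by apply: kB2b; lia.
- move=> k y hk vy; have vk : valid_letter TB n (Pos k) by rewrite /=; lia.
  have vk' : valid_letter TB n (Neg k) by rewrite /=; lia.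
  rewrite !(leL_lenc on) // => h1 h2; left.
  apply: knuth_intro; rewrite ?vy /=; try lia.
  by move: h1 h2; rewrite /lenc; move: (match y with Pos k => _ | Zer => _ | Neg k => _ end) => r *; apply: kB3a; lia.
- move=> k y hk vy; have vk : valid_letter TB n (Pos k) by rewrite /=; lia.
  have vk' : valid_letter TB n (Neg k) by rewrite /=; lia.
  rewrite !(leL_lenc on) // => h1 h2; left.
  apply: knuth_intro; rewrite ?vy /=; try lia.
  by move: h1 h2; rewrite /lenc; move: (match y with Pos k => _ | Zer => _ | Neg k => _ end) => r *; apply: kB3b; lia.
- by left; apply: knuth_intro => //=; try lia; apply: kB3c; lia.
- by move=> k hk; left; apply: knuth_intro => //=; try lia; apply: kB4a; lia.
- by move=> k hk; left; apply: knuth_intro => //=; try lia; apply: kB4b; lia.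
- move=> w k h1 h2 h3 h4; right; left; exists w, [seq x <- w | (x != Pos k) && (x != Neg k)].
  split => //; apply: R5pair => //; rewrite addn0; by case: h4 => -[] /andP[].
- move=> a c h1 h2 h3 h4; right; left; exists (a ++ Zer :: c), (a ++ c).
  by split => //; apply: R5zero.
- move=> C x C' /eqP h1 h2 /eqP h3 h4 h5; right; right; left; exact: spin_rel_R6.
- move=> C x x' C' /eqP h1 h2 /eqP h3 vx' h4 h5 [h6 [h7 h8]] h9; right; right; left.
  have nx : (match x with Pos _ => true | _ => false end) = false.
    by move: h5 h2; rewrite /leL /ltL /eq_op; case: (x) => [k||k] //=; lia.
  apply: spin_rel_R7 => //; rewrite /ins_out_mem; first by rewrite h6.
  by move=> y; rewrite nx andFb orbF; exact: h8.
- move=> C x x' C' /eqP h1 h2 /eqP h3 vx' h4 h5 [h6 [h7 h8]] h9; right; right; left.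
  have nx : is_true (match x with Pos _ => true | _ => false end).
    by move: h5 h2; rewrite /leL /ltL /eq_op; case: (x) => [k||k] //=; lia.
  apply: spin_rel_R7 => //; rewrite /ins_out_mem; first by rewrite nx.
  by move=> y; rewrite nx andTb; exact: h8.
- move=> Sm w h1 h2 h3 h4; right; right; right; exists Sm, w; by split.
Qed.

Lemma in_dec t n r : 0 < r <= lmax t n -> valid_letter t n (ldec t n r).
Proof. by case/ldecK. Qed.

Lemma lt_dec t n r s : okn t n -> 0 < r <= lmax t n -> 0 < s <= lmax t n ->
  ltL t n (ldec t n r) (ldec t n s) = (r < s) && (if t is TD then ~~ ((r == n) && (s == n.+1)) else true).
Proof.
move=> on hr hs; rewrite (ltL_lenc on) ?in_dec //.
by have [-> _] := ldecK hr; have [-> _] := ldecK hs.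
Qed.

Lemma le_dec t n r s : okn t n -> 0 < r <= lmax t n -> 0 < s <= lmax t n ->
  leL t n (ldec t n r) (ldec t n s) = (r <= s) && (if t is TD then ~~ ((r == n) && (s == n.+1)) else true).
Proof.
move=> on hr hs; rewrite (leL_lenc on) ?in_dec //.
by have [-> _] := ldecK hr; have [-> _] := ldecK hs.
Qed.

Lemma nbar_dec t n r s : okn t n -> 0 < r <= lmax t n -> 0 < s <= lmax t n -> r + s <> lsum t n ->
  ldec t n r <> bar (ldec t n s).
Proof.
move=> on hr hs h; apply/(neq_bar_lenc on); rewrite ?in_dec //.
by have [-> _] := ldecK hr; have [-> _] := ldecK hs.
Qed.

Lemma zer_dec n r : 0 < r <= lmax TB n -> r <> n.+1 -> ldec TB n r <> Zer.
Proof. by move=> hr h e; apply: h; have [<- _] := ldecK hr; rewrite e. Qed.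

Lemma knuth_relB n u v : 0 < n -> knuth_rel TB n u v -> relB n u v.
Proof.
move=> n0 [x [y [-> -> K]]]; have on : okn TB n by [].
have iv r : (1 <= r)%coq_nat -> (r <= n + n + 1)%coq_nat -> 0 < r <= lmax TB n.
  by rewrite /lmax; lia.
case: K; intros; subst; rewrite /w3 /=.
- by apply: RB1a; rewrite ?in_dec ?lt_dec ?andbT //; try (apply: nbar_dec => //); rewrite /lmax /lsum; lia.
- by apply: RB1b; rewrite ?in_dec ?lt_dec ?andbT //; try (apply: nbar_dec => //); rewrite /lmax /lsum; lia.
- by apply: RB2a; rewrite ?in_dec ?lt_dec ?andbT //; try (apply: nbar_dec => //); try (apply: zer_dec => //); rewrite /lmax /lsum; lia.
- by apply: RB2b; rewrite ?in_dec ?lt_dec ?andbT //; try (apply: nbar_dec => //); try (apply: zer_dec => //); rewrite /lmax /lsum; lia.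
- have cE : c'.+1 = lsum TB n - c by rewrite /lsum; lia.
  have cE' : c' = lsum TB n - c.+1 by rewrite /lsum; lia.
  have h1 : leL TB n (Pos c.+1) (ldec TB n a).
    rewrite -(@ldec_pos TB n c.+1); last by lia.
    by rewrite le_dec // /lmax; lia.
  have h2 : leL TB n (ldec TB n a) (Neg c.+1).
    rewrite -(@ldec_neg TB n c.+1); last by lia.
    by rewrite le_dec // /lmax /lsum; lia.
  rewrite cE cE' (@ldec_pos _ _ c) ?(@ldec_pos _ _ c.+1) ?ldec_neg; try lia.
  by apply: (@RB3a n c.+1); rewrite ?in_dec //; rewrite /lmax; lia.
- have bE : b.+1 = lsum TB n - b' by rewrite /lsum; lia.
  have bE' : b = lsum TB n - b'.+1 by rewrite /lsum; lia.
  have h1 : leL TB n (Pos b'.+1) (ldec TB n c).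
    rewrite -(@ldec_pos TB n b'.+1); last by lia.
    by rewrite le_dec // /lmax; lia.
  have h2 : leL TB n (ldec TB n c) (Neg b'.+1).
    rewrite -(@ldec_neg TB n b'.+1); last by lia.
    by rewrite le_dec // /lmax /lsum; lia.
  rewrite bE bE' (@ldec_pos _ _ b') ?(@ldec_pos _ _ b'.+1) ?ldec_neg; try lia.
  by apply: (@RB3b n b'.+1); rewrite ?in_dec //; rewrite /lmax; lia.
- have nE : n.+2 = lsum TB n - n by rewrite /lsum; lia.
  by rewrite ldec_zer nE ldec_neg ?ldec_pos; try lia; exact: RB3c.
- by rewrite ldec_zer (@ldec_pos _ _ c) //; [apply: RB4a; lia|lia].
- have bE : b = lsum TB n - (lsum TB n - b) by rewrite /lsum; lia.
  by rewrite ldec_zer bE ldec_neg; [apply: RB4b; rewrite /lsum; lia|rewrite /lsum; lia].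
Qed.

Lemma relD_cases n u v : 1 < n -> relD n u v -> knuth_rel TD n u v \/
  (exists w w', [/\ u = Vw w, v = Vw w' & relR5 TD n w w']) \/ spin_rel TD n u v \/
  (exists Sm w, [/\ u = Sm (Vw w), v = Vw w, cryst_iso TD n (in_comps TD n (seedsDn n)) (tgtDn n) Sm,
     (colD n w /\ admissible TD n w) & in_comps TD n (seedsDn n) (Vw w)]) \/
  (exists Sm w, [/\ u = Sm (Vw w), v = Vw w, cryst_iso TD n (in_comps TD n (seedsDn1 n)) (tgtDn1 n) Sm,
     (colD n w /\ admissible TD n w) & in_comps TD n (seedsDn1 n) (Vw w)]).
Proof.
move=> n1; have on : okn TD n by [].
have vn : valid_letter TD n (Pos n) by rewrite /=; lia.
have vn' : valid_letter TD n (Neg n) by rewrite /=; lia.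
have vm : valid_letter TD n (Pos n.-1) by rewrite /=; lia.
have vm' : valid_letter TD n (Neg n.-1) by rewrite /=; lia.
have en : lenc TD n (Pos n) = n by [].
have en' : lenc TD n (Neg n) = n.+1 by rewrite /=; lia.
have em' : lenc TD n (Neg n.-1) = n.+2 by rewrite /=; lia.
have small x : valid_letter TD n x -> leL TD n x (Pos n.-1) -> lenc TD n x < n /\
   (valid_letter TD n (bar x) /\ n.+2 <= lenc TD n (bar x) <= n + n).
  move=> vx; rewrite (leL_lenc on) // => /andP[h _]; have [hb vb] := bar_lenc on vx.
  by move: hb h (lenc_bound vx); rewrite /lsum [lenc TD n (Pos n.-1)]/=; split; [lia|split => //; lia].
case.
- move=> x y z vx vy vz h1 h2 /(neq_bar_lenc on vx vz); rewrite /lsum => h3; left.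
  apply: knuth_intro; rewrite ?vx ?vy ?vz //.
  move: h1 h2 (lenc_bound vx) (lenc_bound vz); rewrite /lmax !(ltL_lenc on) // (leL_lenc on) // => *.
  by clear vn vn' vm vm' en en' em' small; apply: (@kD1a n (lenc TD n y) (lenc TD n z) (lenc TD n x)); lia.
- move=> x y z vx vy vz h1 h2 /(neq_bar_lenc on vx vz); rewrite /lsum => h3; left.
  apply: knuth_intro; rewrite ?vx ?vy ?vz //.
  move: h1 h2 (lenc_bound vx) (lenc_bound vz); rewrite /lmax !(ltL_lenc on) // (leL_lenc on) // => *.
  by clear vn vn' vm vm' en en' em' small; apply: (@kD1b n (lenc TD n x) (lenc TD n z) (lenc TD n y)); lia.
- move=> k y hk vy; have vk : valid_letter TD n (Pos k) by rewrite /=; lia.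
  have vk' : valid_letter TD n (Neg k) by rewrite /=; lia.
  rewrite !(leL_lenc on) // => /andP[h1 _] /andP[h2 _]; left.
  apply: knuth_intro; rewrite ?vy /=; try (clear vn vn' vm vm' en en' em' small; lia).
  move: h1 h2; rewrite /lenc; move: (match y with Pos k => _ | Zer => _ | Neg k => _ end) => r h1 h2.
  by clear vn vn' vm vm' en en' em' small; apply: (@kD2a n r k.-1 (n.*2.+1 - k)); lia.
- move=> k y hk vy; have vk : valid_letter TD n (Pos k) by rewrite /=; lia.
  have vk' : valid_letter TD n (Neg k) by rewrite /=; lia.
  rewrite !(leL_lenc on) // => /andP[h1 _] /andP[h2 _]; left.
  apply: knuth_intro; rewrite ?vy /=; try (clear vn vn' vm vm' en en' em' small; lia).
  move: h1 h2; rewrite /lenc; move: (match y with Pos k => _ | Zer => _ | Neg k => _ end) => r h1 h2.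
  by clear vn vn' vm vm' en en' em' small; apply: (@kD2b n k.-1 (n.*2.+1 - k) r); lia.
- move=> x vx /(small _ vx)[h1 [h2 h3]]; left; apply: knuth_intro; rewrite ?vn ?vn' ?h2 //.
  by rewrite en en'; apply: (@kD3a n (lenc TD n (bar x))); lia.
- move=> x vx /(small _ vx)[h1 [h2 h3]]; left; apply: knuth_intro; rewrite ?vn ?vn' ?h2 //.
  by rewrite en en'; apply: (@kD3b n (lenc TD n (bar x))); lia.
- move=> x vx /(small _ vx)[h1 _]; left; apply: knuth_intro; rewrite ?vn ?vn' ?vx //.
  by rewrite en en'; have := lenc_bound vx => h2; apply: (@kD3c n (lenc TD n x)); lia.
- move=> x vx /(small _ vx)[h1 _]; left; apply: knuth_intro; rewrite ?vn ?vn' ?vx //.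
  by rewrite en en'; have := lenc_bound vx => h2; apply: (@kD3d n (lenc TD n x)); lia.
- left; apply: knuth_intro; rewrite ?vn ?vn' ?vm ?vm' //.
  by rewrite en en' em' [lenc TD n (Pos _)]/=; apply: (@kD4a n n.-1); lia.
- left; apply: knuth_intro; rewrite ?vn ?vn' ?vm ?vm' //.
  by rewrite en en' em' [lenc TD n (Pos _)]/=; apply: (@kD4b n n.-1); lia.
- left; apply: knuth_intro; rewrite ?vn ?vn' ?vm ?vm' //.
  by rewrite en en' em' [lenc TD n (Pos _)]/=; apply: (@kD4c n n.-1); lia.
- left; apply: knuth_intro; rewrite ?vn ?vn' ?vm ?vm' //.
  by rewrite en en' em' [lenc TD n (Pos _)]/=; apply: (@kD4d n n.-1); lia.
- move=> w k h1 h2 h3 h4 h5; right; left; exists w, [seq x <- w | (x != Pos k) && (x != Neg k)].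
  by split => //; apply: R5pair => //; rewrite addn1.
- move=> a c h1 h2 h3 h4; right; left; exists (a ++ [:: Pos n; Neg n] ++ c), (a ++ c).
  by split => //; apply: (@R5n TD n a c (Pos n)) => //; left.
- move=> a c h1 h2 h3 h4; right; left; exists (a ++ [:: Neg n; Pos n] ++ c), (a ++ c).
  by split => //; apply: (@R5n TD n a c (Neg n)) => //; right.
- move=> C x C' /eqP h1 h2 /eqP h3 h4 h5; right; right; left; exact: spin_rel_R6.
- move=> C x x' C' /eqP h1 h2 /eqP h3 vx' h4 [h6 [h7 h8]] h9; right; right; left.
  by apply: spin_rel_R7 => //; rewrite /ins_out_mem; [rewrite h6|move=> y; rewrite orbF; exact: h8].
- by move=> Sm w h1 h2 h3 h4; do 3 right; left; exists Sm, w.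
- by move=> Sm w h1 h2 h3 h4; do 4 right; exists Sm, w.
Qed.

Lemma knuth_relD n u v : 1 < n -> knuth_rel TD n u v -> relD n u v.
Proof.
move=> n1 [x [y [-> -> K]]]; have on : okn TD n by [].
have pE k : k <= n -> ldec TD n k = Pos k by exact: ldec_pos.
have nE r k : 0 < k <= n -> r + k = n + n + 1 -> ldec TD n r = Neg k.
  by move=> hk rE; rewrite -(ldec_neg TD hk) /lsum; congr ldec; lia.
have v1 r : 0 < r <= n + n -> valid_letter TD n (ldec TD n r) by move=> h; exact: (@in_dec TD n r h).
case: K.
- move=> a b c p q r p' q' r' h1 h2 h3 h4 h5 h6 h7 *; subst; rewrite /w3 /=.
  by apply: RD1a; rewrite ?v1 ?lt_dec ?le_dec //; try (apply: nbar_dec => //); rewrite /lmax /lsum; lia.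
- move=> a b c p q r p' q' r' h1 h2 h3 h4 h5 h6 h7 *; subst; rewrite /w3 /=.
  by apply: RD1b; rewrite ?v1 ?lt_dec ?le_dec //; try (apply: nbar_dec => //); rewrite /lmax /lsum; lia.
- move=> a c d p q r p' q' r' h1 h2 h3 h4 h5 *; subst; rewrite /w3 /=.
  have e1 : ldec TD n d.+1 = Neg c by apply: nE; lia.
  have e2 : ldec TD n d = Neg c.+1 by apply: nE; lia.
  have l1 : leL TD n (Pos c.+1) (ldec TD n a).
    by rewrite -pE; [rewrite le_dec // /lmax; lia|lia].
  have l2 : leL TD n (ldec TD n a) (Neg c.+1).
    by rewrite -e2 le_dec // /lmax; lia.
  rewrite e1 e2 (pE c) ?(pE c.+1); try lia.
  by apply: (@RD2a n c.+1); rewrite ?v1 //; lia.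
- move=> a b c p q r p' q' r' h1 h2 h3 h4 h5 *; subst; rewrite /w3 /=.
  have e1 : ldec TD n b.+1 = Neg a by apply: nE; lia.
  have e2 : ldec TD n b = Neg a.+1 by apply: nE; lia.
  have l1 : leL TD n (Pos a.+1) (ldec TD n c).
    by rewrite -pE; [rewrite le_dec // /lmax; lia|lia].
  have l2 : leL TD n (ldec TD n c) (Neg a.+1).
    by rewrite -e2 le_dec // /lmax; lia.
  rewrite e1 e2 (pE a) ?(pE a.+1); try lia.
  by apply: (@RD2b n a.+1); rewrite ?v1 //; lia.
- move=> b p q r p' q' r' h1 h2 *; subst; rewrite /w3 /=.
  have e1 : ldec TD n n.+1 = Neg n by apply: nE; lia.
  have e2 : ldec TD n b = Neg (n + n + 1 - b) by apply: nE; lia.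
  rewrite e1 e2 (pE n) //; apply: (@RD3a n (Pos (n + n + 1 - b))); rewrite /leL /ltL /eq_op /=; lia.
- move=> b p q r p' q' r' h1 h2 *; subst; rewrite /w3 /=.
  have e1 : ldec TD n n.+1 = Neg n by apply: nE; lia.
  have e2 : ldec TD n b = Neg (n + n + 1 - b) by apply: nE; lia.
  rewrite e1 e2 (pE n) //; apply: (@RD3b n (Pos (n + n + 1 - b))); rewrite /leL /ltL /eq_op /=; lia.
- move=> c p q r p' q' r' h1 h2 *; subst; rewrite /w3 /=.
  have e1 : ldec TD n n.+1 = Neg n by apply: nE; lia.
  rewrite e1 (pE n) // (pE c); last by lia.
  apply: RD3c; rewrite /leL /ltL /eq_op /=; lia.
- move=> c p q r p' q' r' h1 h2 *; subst; rewrite /w3 /=.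
  have e1 : ldec TD n n.+1 = Neg n by apply: nE; lia.
  rewrite e1 (pE n) // (pE c); last by lia.
  apply: RD3d; rewrite /leL /ltL /eq_op /=; lia.
all: move=> m p q r p' q' r' h1 *; subst p q r p' q' r'; rewrite /w3 /=.
all: have e1 : ldec TD n n.+1 = Neg n by apply: nE; lia.
all: have e2 : ldec TD n n.+2 = Neg m by apply: nE; lia.
all: rewrite e1 ?e2 (pE n) // ?(pE m); try lia.
all: have -> : m = n.-1 by lia.
- exact: RD4a.
- exact: RD4b.
- exact: RD4c.
- exact: RD4d.
Qed.

Lemma relR5_relB n w w' : relR5 TB n w w' -> relB n (Vw w) (Vw w').
Proof.
case=> //.
- by move=> u k h1 h2 h3 h4 h5; apply: RB5a.
- by move=> a c _ h1 h2 h3 h4; apply: RB5b.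
Qed.

Lemma relR5_relD n w w' : relR5 TD n w w' -> relD n (Vw w) (Vw w').
Proof.
case=> //.
- by move=> u k h1 h2 h3 h4 h5; apply: RD5a => //; rewrite addn1 in h5.
- move=> a c x _ [->|->] h1 h2 h3 h4; first exact: RD5b.
  exact: RD5c.
Qed.

Lemma spin_rel_rel t n u v : okn t n -> spin_rel t n u v ->
  (if t is TB then relB n u v else relD n u v).
Proof.
move=> on [C [x [sC vx -> ->]]]; rewrite ins_word_in.
have nl' : is_true (if t is TD then ~~ nilp C else true).
  by move: on; rewrite -sC; case: (t) => //; case: (C).
have tN := tri_spin_ins on sC vx.
have := @spin_ins_valid t C (Some x) nl'; have := @spin_ins_wt t C (Some x).
have := @spin_ins_spec t C (Some x) nl'; rewrite sC.
case E: (spin_ins t C _) tN => [[y|] D] /= tN h0 h1 h2; rewrite /ins_out /ins_in /=;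
  have [vy [sD _]] := h2 vx; have := h0 vx.
  move=> [g1 g2 g3 g4]; have nt : ~ tri t n x C by move/tN.
  have hw j : 0 < j <= n -> (wt2S D j = wt2S C j + wt2L x j - wt2L y j)%R.
    by move=> lj; have := h1 j nl' vx lj; lia.
  case: t on nl' tN h0 h1 h2 vx vy g1 g2 g3 g4 nt E => on nl' tN h0 h1 h2 vx vy g1 g2 g3 g4 nt E.
    case: (boolP (leL TB n Zer x)) => hx.
      apply: RB7a => //; [exact/eqP|exact/eqP|split; [|by split]].
      move: g1 hx vx; rewrite /ins_out_mem => /orP[//|]; rewrite /leL /ltL /eq_op.
      by case: (x) => [k||k] //=; lia.
    have xp : is_true (match x with Pos _ => true | _ => false end).
      by move: hx vx; rewrite /leL /ltL /eq_op; case: (x) => [k||k] //=; lia.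
    apply: RB7b => //; [exact/eqP|exact/eqP| |split; [|split => //]].
    - by move: vx xp; rewrite /leL /ltL /eq_op; case: (x) => [k||k] //=; lia.
    - by move: g1; rewrite /ins_out_mem xp.
    - move=> z /orP[hz|/eqP ->] hl; first exact: g3.
      by case: (x) xp g4 => // k _ /(_ k erefl erefl).
  apply: RD7 => //; [exact/eqP|exact/eqP|split; [|by split]].
  by move: g1; rewrite /ins_out_mem orbF.
move=> _; have nt : tri t n x C by apply/tN.
have hw j : 0 < j <= n -> (wt2S D j = wt2S C j + wt2L x j)%R.
  by move=> lj; have := h1 j nl' vx lj; lia.
by case: t on nl' tN h0 h1 h2 vx vy nt E => on nl' tN h0 h1 h2 vx vy nt E; [apply: RB6|apply: RD6] => //; exact/eqP.
Qed.

(** * The isomorphism of R8, for both types at once *)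

Section PairIso.
Variables (t : ctype) (n : nat).
Hypothesis on : okn t n.
Variable Par : seq bool -> bool.
Hypothesis Par_f : forall i C C', size C = n -> 0 < i <= n -> fS t n i C = Some C' \/ eS t n i C = Some C' -> Par C' = Par C.
Variable Seeds : word -> Prop.

(** [Par] is a condition on the first column that the operators respect. It is void in type B; in
    type D it is the parity of the number of bars and distinguishes the targets of the two
    isomorphisms. *)
Definition pair_tgt (w : word) : Prop :=
  exists C1 C2, [/\ w = [:: S C1; S C2], size C1 = n, size C2 = n & Par C1].

Lemma pair_valid w : pair_tgt w -> valid_word t n w.
Proof. by case=> C1 [C2 [-> s1 s2 _]]; rewrite /valid_word /= /valid_spin s1 s2 eqxx. Qed.

Lemma pair_step w w' i : pair_tgt w -> 0 < i <= n -> fW t n i w = Some w' \/ eW t n i w = Some w' -> pair_tgt w'.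
Proof.
move=> [C1 [C2 [-> s1 s2 p]]] li; rewrite /=; case.
  case: ifP => _.
    case E: fS => [D|] //= [<-]; exists D, C2; have [sD _ _] := fS_props on s1 li E.
    by split => //; rewrite (Par_f s1 li (or_introl E)).
  case: ifP => _ //; case E: fS => [D|] //= [<-]; exists C1, D.
  by have [sD _ _] := fS_props on s2 li E.
case: ifP => _; last first.
  case E: eS => [D|] //= [<-]; exists D, C2; have [sD _ _] := eS_props on s1 li E.
  by split => //; rewrite (Par_f s1 li (or_intror E)).
case E: eS => [D|] //= [<-]; exists C1, D.
by have [sD _ _] := eS_props on s2 li E.
Qed.

Lemma pair_conn w w' : pair_tgt w -> conn t n w w' -> pair_tgt w'.
Proof.
move=> + h; elim: h => // [x y [i [li h]] hx|x y z _ h1 _ h2 /h1/h2 //].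
exact: pair_step hx li h.
Qed.

(** This map runs against the direction of R8, from pairs to columns, because here the bracketing
    gives a formula. The map S is then obtained by choice as its inverse. *)
Definition pdm (w : word) : word := if w is [:: S C1; S C2] then dm_word t C1 C2 else w.

Lemma pdm_fe i w : pair_tgt w -> 0 < i <= n ->
  fW t n i (pdm w) = omap pdm (fW t n i w) /\ eW t n i (pdm w) = omap pdm (eW t n i w).
Proof.
case=> C1 [C2 [-> s1 s2 _]] li; have [h1 [h2 [h3 h4]]] := dm_word_crystal on s1 s2 li.
split.
  case E: (fW t n i [:: S C1; S C2]) => [w1|]; last by rewrite [pdm _]/= h2.
  by have [D1 [D2 [-> _ _ h]]] := h1 _ E.
case E: (eW t n i [:: S C1; S C2]) => [w1|]; last by rewrite [pdm _]/= h4.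
by have [D1 [D2 [-> _ _ h]]] := h3 _ E.
Qed.

Lemma pdm_conn w w' : pair_tgt w -> conn t n w w' -> conn t n (pdm w) (pdm w').
Proof.
move=> + h; elim: h => [x y [i [li h]] hx|x _|x y z xy h1 _ h2 hx].
- apply: rt_step; exists i; split => //; have [f e] := pdm_fe hx li.
  by case: h => h; [left; rewrite f h|right; rewrite e h].
- exact: rt_refl.
- exact: rt_trans (h1 hx) (h2 (pair_conn hx xy)).
Qed.

Hypothesis hw_seed : forall w, pair_tgt w -> highest t n w -> Seeds (pdm w).
Hypothesis seed_hw : forall s, Seeds s -> exists w, [/\ pair_tgt w, highest t n w & pdm w = s].
Hypothesis hw_inj : forall w w', pair_tgt w -> highest t n w -> pair_tgt w' -> highest t n w' -> pdm w = pdm w' -> w = w'.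

(** Raise both pairs along a path that takes the first one to a highest weight vertex. As [pdm]
    commutes with the operators, the images stay equal, and at the end both pairs are highest, so
    that [hw_inj] applies. *)
Lemma pdm_inj w w' : pair_tgt w -> pair_tgt w' -> pdm w = pdm w' -> w = w'.
Proof.
move=> hw hw'; have [h [js [hh ljs hp vh]]] := exists_highest on (pair_valid hw).
elim: js w w' hw hw' hp ljs => [|i js IH] w w' hw hw' /=.
  case=> hE _; subst h => e; apply: hw_inj => // i li; have [_ e1] := pdm_fe hw' li; have [_ e2] := pdm_fe hw li.
  have := hh i li; move: e2; rewrite e e1 => e2 e3; rewrite e3 /= in e2.
  by case: (eW t n i w') e2.
rewrite -/(fpath t n js h); case E: (fpath t n js h) => [u|] //= hf /andP[li ljs] e.
have cu : conn t n w u.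
  apply: rt_step; exists i; split => //; right.
  have vu : valid_word t n u.
    by apply: (valid_conn on vh); apply: fpath_conn E.
  by have [] := fW_props on li vu hf.
have hu := pair_conn hw cu.
have eu : eW t n i w = Some u by have [] := fW_props on li (pair_valid hu) hf.
have [_ e1] := pdm_fe hw li; have [_ e2] := pdm_fe hw' li.
move: e2; rewrite -e e1 eu /=; case E' : (eW t n i w') => [u'|] //= [eq].
have hu' : pair_tgt u' by apply: (pair_step hw' li); right.
have uu : u = u' by apply: IH.
subst u'; have [_ _ fu' _ _] := eW_props on li (pair_valid hw') E'.
by move: fu'; rewrite hf => -[].
Qed.

(** A path from a seed lifts step by step to pairs; conversely a pair is raised to a highest weight
    pair, whose image is a seed. *)
Lemma in_comps_pdm w : in_comps t n Seeds w <-> exists p, pair_tgt p /\ pdm p = w.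
Proof.
split.
  case=> s [hs c]; have [p [hp _ pE]] := seed_hw hs; rewrite -{}pE in c.
  have [p' [hp' e]] : exists p', pair_tgt p' /\ pdm p' = w; last by exists p'.
  have key u v : conn t n u v -> forall p, pair_tgt p -> pdm p = u -> exists p', pair_tgt p' /\ pdm p' = v.
    elim=> [x y [i [li h]] q hq qE|x q hq qE|x y z _ h1 _ h2 q hq qE].
    - have [f e] := pdm_fe hq li; rewrite qE in f e; case: h => h.
        rewrite h in f; case E: (fW t n i q) f => [q'|] //= [->]; exists q'; split => //.
        by apply: (pair_step hq li); left.
      rewrite h in e; case E: (eW t n i q) e => [q'|] //= [->]; exists q'; split => //.
      by apply: (pair_step hq li); right.
    - by exists q.
    - by have [q' [hq' e']] := h1 _ hq qE; exact: h2 hq' e'.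
  exact: key c p hp erefl.
case=> p [hp <-]; have [h [js [hh ljs pth vh]]] := exists_highest on (pair_valid hp).
have c := fpath_conn ljs pth; have c' := conn_sym on vh c; have hh' := pair_conn hp c'.
by exists (pdm h); split; [exact: hw_seed|exact: pdm_conn c].
Qed.

Definition pair_iso (w : word) : word := epsilon (inhabits w) (fun p => pair_tgt p /\ pdm p = w).

Lemma pair_iso_spec p : pair_tgt p -> pair_iso (pdm p) = p.
Proof.
move=> hp; have [h1 h2] : pair_tgt (pair_iso (pdm p)) /\ pdm (pair_iso (pdm p)) = pdm p.
  by apply: (epsilon_spec (inhabits (pdm p)) (fun q => pair_tgt q /\ pdm q = pdm p)); exists p.
exact: pdm_inj.
Qed.

Lemma pair_iso_iso : cryst_iso t n (in_comps t n Seeds) pair_tgt pair_iso.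
Proof.
split.
- by move=> u /in_comps_pdm[p [hp <-]]; rewrite pair_iso_spec.
- by move=> u v /in_comps_pdm[p [hp <-]] /in_comps_pdm[q [hq <-]]; rewrite !pair_iso_spec // => ->.
- by move=> v hv; exists (pdm v); rewrite pair_iso_spec //; split => //; apply/in_comps_pdm; exists v.
- move=> i u li /in_comps_pdm[p [hp <-]]; rewrite pair_iso_spec //; have [-> ->] := pdm_fe hp li; split.
    case E: (fW t n i p) => [q|] //=; rewrite pair_iso_spec //.
    by apply: (pair_step hp li); left.
  case E: (eW t n i p) => [q|] //=; rewrite pair_iso_spec //.
  by apply: (pair_step hp li); right.
Qed.

(** R8 speaks of admissible columns only. Its closure under the operators needs that the whole
    domain of S consists of such columns, which holds since [dm] produces admissible data. *)
Lemma in_comps_adm w : in_comps t n Seeds w ->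
  exists u, [/\ w = Vw u, colP t n u & admissible t n u].
Proof.
case/in_comps_pdm=> p [[C1 [C2 [-> s1 s2 _]]] <-].
have p0 : is_true (if t is TD then 0 < size C1 else true) by rewrite s1; case: (t) on => //=; lia.
have [a kk] := dm_adm (etrans s1 (esym s2)) (leqnn 0) p0.
have kn : size (dm t 0 C1 C2).1.1 + dl t = n by rewrite -s1 -kk.
exists (colw (dm t 0 C1 C2).1.1 (core t (dm t 0 C1 C2).1.2 (dm t 0 C1 C2).2)); split => //.
  by rewrite -[X in colP _ X]kn; exact: colw_colP.
by apply/admissibleE; rewrite -[X in admg _ X]kn; apply/adm_admg.
Qed.

Lemma in_comps_step w w' i : in_comps t n Seeds w -> 0 < i <= n ->
  fW t n i w = Some w' \/ eW t n i w = Some w' -> in_comps t n Seeds w'.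
Proof.
case=> s [hs c] li h; exists s; split => //; apply: rt_trans c _; apply: rt_step; by exists i.
Qed.

(** As in R8, [Sm] is any crystal isomorphism. Closure uses that it commutes with the operators, and
    [pdm_iso_rel] shows that one exists. *)
Definition iso_rel (u v : word) : Prop := exists Sm w,
  [/\ u = Sm (Vw w), v = Vw w, cryst_iso t n (in_comps t n Seeds) pair_tgt Sm,
     (colP t n w /\ admissible t n w) & in_comps t n Seeds (Vw w)].

Lemma iso_rel_closed : crystal_closed t n iso_rel.
Proof.
move=> u v i [Sm [w [-> -> iso _ hc]]] li.
have [h1 h2 h3 h4] := iso; have [-> ->] := h4 i (Vw w) li hc.
split.
  case E: (fW t n i (Vw w)) => [w'|] //=; have hc' := in_comps_step hc li (or_introl E).
  by have [x [xE cx ax]] := in_comps_adm hc'; exists Sm, x; rewrite -xE.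
case E: (eW t n i (Vw w)) => [w'|] //=; have hc' := in_comps_step hc li (or_intror E).
by have [x [xE cx ax]] := in_comps_adm hc'; exists Sm, x; rewrite -xE.
Qed.

Lemma pdm_iso_rel p : pair_tgt p -> iso_rel p (pdm p).
Proof.
move=> hp; have hc : in_comps t n Seeds (pdm p) by apply/in_comps_pdm; exists p.
have [x [xE cx ax]] := in_comps_adm hc; exists pair_iso, x; rewrite -xE pair_iso_spec //.
by split => //; exact: pair_iso_iso.
Qed.

End PairIso.

(** * Highest weight pairs of spin columns *)

Lemma nbars_parity n i C C' : 1 < n -> size C = n -> 0 < i <= n ->
  fS TD n i C = Some C' \/ eS TD n i C = Some C' -> odd (nbars C') = odd (nbars C).
Proof.
move=> on; have {}on : okn TD n by [].
move=> sC li; move: C'; move: n i C on sC li.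
apply: spin_ind => [i C|b b' C on C'|n i b C sC on li IH C'].
- case: C => [|b [|b' []]] //= _; case: i => [|[|[]]] // _ C'; rewrite /fS /eS /nbars /=;
  by case: b; case: b' => -[] //= [<-].
- by rewrite /fS /eS /nbars /=; case: b; case: b' => -[] //= [<-].
rewrite fS_shift // eS_shift //; case.
  by case E: (fS TD n i C) => [D|] //= [<-]; have := IH D (or_introl E); rewrite /nbars /= !oddD => ->.
by case E: (eS TD n i C) => [D|] //= [<-]; have := IH D (or_intror E); rewrite /nbars /= !oddD => ->.
Qed.

Lemma eS_None t n i C : eS t n i C = None -> 0 < i < n -> ~~ (nth false C i.-1 && ~~ nth false C i).
Proof. by rewrite /eS => + li; rewrite li; case: ifP. Qed.

Lemma sorted_bits C : (forall i, i.+1 < size C -> ~~ (nth false C i && ~~ nth false C i.+1)) ->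
  exists2 k, k <= size C & C = nseq k false ++ nseq (size C - k) true.
Proof.
elim: C => [|b C IH] h; first by exists 0.
have [|k kC E] := IH; first by move=> i hi; exact: (h i.+1).
case: b h => h; last by exists k.+1; rewrite //= subSS -E.
case: k kC E => [|k] kC E.
  exists 0 => //=; rewrite subn0 /= in E *; by rewrite {1}E.
have nc : nth false C 0 = false by rewrite E.
have hs : 1 < size (true :: C) by rewrite /= ltnS (leq_trans _ kC).
by have := h 0 hs; rewrite /= nc.
Qed.

Lemma epsG_S t n i C : epsG t n i (S C) = 0 <-> eS t n i C = None.
Proof. by rewrite /epsG /=; case: eS => [D|] //=; split. Qed.

Lemma phiG_S t n i C : phiG t n i (S C) = 0 <-> fS t n i C = None.
Proof. by rewrite /phiG /=; case: fS => [D|] //=; split. Qed.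

Lemma epsW1 t n i g : epsW t n i [:: g] = epsG t n i g.
Proof. by rewrite epsW_cons /epsW /=; maxlia. Qed.

Lemma phiW1 t n i g : phiW t n i [:: g] = phiG t n i g.
Proof. by rewrite phiW_cons /epsW /phiW /=; maxlia. Qed.

Lemma highest_pair t n C1 C2 : okn t n -> size C1 = n -> size C2 = n ->
  highest t n [:: S C1; S C2] <->
  forall i, 0 < i <= n -> eS t n i C1 = None /\ epsG t n i (S C2) <= phiG t n i (S C1).
Proof.
move=> on s1 s2; have v : valid_word t n ([:: S C1] ++ [:: S C2]).
  by rewrite /valid_word /= /valid_spin s1 s2 eqxx.
split=> [h i li|h i li].
  have [h1 h2] := highest_cat on v h; have := h2 i li; rewrite epsW1 phiW1 => ->; split => //.
  by have := h1 i li => /=; case: eS.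
have [h1 h2] := h i li; rewrite /= ifF; first by rewrite h1.
by rewrite epsW1; lia.
Qed.

Lemma fS_zeros t n i : 0 < i < n -> fS t n i (nseq n false) = None.
Proof. by move=> li; rewrite /fS li !nth_nseq !if_same andbF. Qed.

Lemma colw_nseq k m co : colw (nseq k (true, false) ++ nseq m (false, false)) co =
  map Pos (iota 1 k) ++ shiftn (k + m) co.
Proof.
elim: k => [|k IH].
  by elim: m => //= m ->; rewrite cats0.
rewrite /= IH cats0 map_cat -map_comp; congr (_ :: _ ++ _).
by rewrite -[2]addn1 iotaDl -map_comp; apply: eq_map => x /=; rewrite add1n.
Qed.

Lemma dm_zeros_B k m : dm TB 0 (nseq (k + m) false) (nseq k false ++ nseq m true) =
  (nseq k (true, false) ++ nseq m (false, false), false, 0).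
Proof.
elim: k => [|k IH]; last by rewrite addSn /= dm_cons //= IH.
by elim: m => //= m IH; rewrite dm_cons //= IH.
Qed.

Lemma dm_zeros_D k m x y : dm TD 0 (nseq (k + m) false ++ [:: x]) (nseq k false ++ nseq m true ++ [:: y]) =
  (nseq k (true, false) ++ nseq m (false, false), x, (x == y) : nat).
Proof.
elim: k => [|k IH].
  elim: m => [|m IH]; first by case: x; case: y.
  by rewrite /= dm_cons ?size_cat ?addn1 //= IH.
by rewrite addSn /= dm_cons ?size_cat ?addn1 //= IH.
Qed.

Lemma word12E k : word12 k = Vw (map Pos (iota 1 k)).
Proof. by rewrite /word12 /Vw -map_comp. Qed.

Lemma dm_word_B k m : dm_word TB (nseq (k + m) false) (nseq k false ++ nseq m true) = word12 k.
Proof.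
rewrite /dm_word dm_zeros_B /cword colw_nseq /=.
suff -> : shiftn (k + m) [::] = [::] by rewrite cats0 word12E.
by apply/size0nil; rewrite size_shiftn.
Qed.

Lemma dm_word_D k m x y : dm_word TD (nseq (k + m) false ++ [:: x]) (nseq k false ++ nseq m true ++ [:: y]) =
  word12 k ++ (if x == y then [:: V (if x then Neg (k + m).+1 else Pos (k + m).+1)] else [::]).
Proof.
rewrite /dm_word dm_zeros_D /cword colw_nseq Vw_cat -word12E; congr (_ ++ _).
have [e0 e1 e2] := iter_shift (k + m); rewrite [(_, _, _).1.2]/= [(_, _, _).2]/=.
case: (x == y) => /=; last by rewrite (size0nil (size_shiftn _ [::])).
by rewrite shiftn_pos; case: (x); rewrite ?e1 ?e2.
Qed.

Lemma word12_rcons k : word12 k.+1 = word12 k ++ [:: V (Pos k.+1)].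
Proof. by rewrite /word12 -[k.+1 in LHS]addn1 iotaD map_cat /= add1n. Qed.

Lemma word12_inj k k' : word12 k = word12 k' -> k = k'.
Proof. by move/(congr1 size); rewrite !size_map !size_iota. Qed.

(** The only highest weight column [C1] is 12...n, with phi_i = 0 for i < n. So [C2] has eps_i = 0
    for these i, which sorts its bits, while eps_n <= 1 = phi_n is automatic. *)
Lemma highest_pair_B n C1 C2 : 0 < n -> size C1 = n -> size C2 = n ->
  highest TB n [:: S C1; S C2] <-> C1 = nseq n false /\ exists2 k, k <= n & C2 = nseq k false ++ nseq (n - k) true.
Proof.
move=> n0 s1 s2; rewrite (highest_pair (t := TB)) //; split=> [h|[-> [k kn ->]] i li].
  have C1E : C1 = nseq n false.
    have [|k kn E] := @sorted_bits C1.
      move=> i hi; have li : 0 < i.+1 <= n by lia.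
      by have [e _] := h _ li; apply: (@eS_None TB n i.+1) => //; lia.
    have [e _] := h n (introT andP (conj n0 (leqnn n))).
    move: e; rewrite /eS ltnn andbF eqxx; case: ifP => // hl _.
    case: (ltngtP k n) => hk; [|lia|].
      by move: hl; rewrite E s1 nth_cat size_nseq ifF; [rewrite nth_nseq ifT //; lia|lia].
    by rewrite E s1 hk subnn cats0.
  split => //; rewrite -s2; apply: sorted_bits => i; rewrite s2 => hi.
  have li : 0 < i.+1 < n by [].
  apply: (@eS_None TB n i.+1) => //; apply/epsG_S/eqP; rewrite -leqn0.
  have [|_ hle] := h i.+1; first by lia.
  by apply: leq_trans hle _; rewrite C1E leqn0; apply/eqP/phiG_S; exact: fS_zeros.
split; first by rewrite /eS !nth_nseq !if_same /=; repeat case: ifP.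
case: (ltngtP i n) => hi; [|lia|].
  apply: leq_trans (leq0n _); rewrite leqn0; apply/eqP/epsG_S; rewrite /eS ifT; last by lia.
  have nC j : j < n -> nth false (nseq k false ++ nseq (n - k) true) j = ~~ (j < k).
    move=> hj; rewrite nth_cat size_nseq; case: (ltnP j k) => h'; rewrite nth_nseq /=; first by rewrite if_same.
    by rewrite ifT //; lia.
  by rewrite !nC //; [case: ifP => // h'; exfalso; lia|lia].
subst i; have p1 : 0 < phiG TB n n (S (nseq n false)).
  by rewrite lt0n; apply/eqP => /phiG_S; rewrite /fS ltnn andbF eqxx nth_nseq if_same.
apply: leq_trans p1.
have sz : size (nseq k false ++ nseq (n - k) true) = n by rewrite size_cat !size_nseq; lia.
rewrite /epsG /=; case E: eS => [D|] //=; have [_ _ ->] := eS_props (t := TB) n0 sz li E; by [].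
Qed.

(** [C1] ends in n or \bar n according to x, and phi is nonzero only at node n or only at node n-1.
    At the other of these two nodes [C2] must have eps = 0, which forces y as soon as position n-1
    of [C2] is barred. *)
Lemma highest_pair_D n C1 C2 : 1 < n -> size C1 = n -> size C2 = n -> highest TD n [:: S C1; S C2] ->
  exists x y k, [/\ k < n, C1 = nseq n.-1 false ++ [:: x], C2 = nseq k false ++ nseq (n.-1 - k) true ++ [:: y] &
    if x then k = n.-1 \/ y = false else k = n.-1 \/ y = true].
Proof.
move=> n1 s1 s2; rewrite (highest_pair (t := TD)) // => h.
have C1E : exists x, C1 = nseq n.-1 false ++ [:: x].
  have [|k kn E] := @sorted_bits C1.
    move=> i hi; have li : 0 < i.+1 <= n by lia.
    by have [e _] := h _ li; apply: (@eS_None TD n i.+1) => //; lia.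
  have ln : 0 < n <= n by lia.
  have [e _] := h n ln.
  move: e; rewrite /eS ltnn andbF eqxx; case: ifP => // hl _.
  have nk i : i < n -> nth false C1 i = ~~ (i < k).
    move=> hi; rewrite E nth_cat size_nseq s1; case: (ltnP i k) => h'; rewrite nth_nseq /=; first by rewrite if_same.
    by rewrite ifT //; lia.
  have kn' : n.-1 <= k.
    move: hl; rewrite !nk; [|lia|lia]; lia.
  exists (~~ (n.-1 < k)); rewrite E s1; have [k1|k1] : k = n \/ k = n.-1 by lia.
    rewrite k1 subnn cats0; have -> : n.-1 < n by lia.
    by rewrite [RHS](_ : _ = nseq n.-1 false ++ nseq 1 false) // -nseqD; congr nseq; lia.
  by rewrite k1 ltnn; congr (_ ++ _); have -> : n - n.-1 = 1 by lia.
case: C1E => x C1E.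
have nC1 j : j < n.-1 -> nth false C1 j = false.
  by move=> hj; rewrite C1E nth_cat size_nseq hj nth_nseq if_same.
have p0 i : 0 < i < n.-1 -> phiG TD n i (S C1) = 0.
  move=> li; apply/phiG_S; rewrite /fS ifT; last by lia.
  by rewrite (nC1 i) ?andbF //; lia.
have no i : i.+1 < n.-1 -> ~~ (nth false C2 i && ~~ nth false C2 i.+1).
  move=> hi; have li : 0 < i.+1 <= n by lia.
  have [_ hle] := h _ li; apply: (@eS_None TD n i.+1); last by lia.
  by apply/epsG_S/eqP; rewrite -leqn0 -(p0 i.+1) //; lia.
have [|k kn E] := @sorted_bits (take n.-1 C2).
  move=> i; rewrite size_take s2 ifT; last by lia.
  by move=> hi; rewrite !nth_take; [exact: no|lia|lia].
have st : size (take n.-1 C2) = n.-1 by rewrite size_take s2 ifT //; lia.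
have [y yE] : exists y, C2 = take n.-1 C2 ++ [:: y].
  exists (nth false C2 n.-1); rewrite -{1}(cat_take_drop n.-1 C2); congr (_ ++ _).
  rewrite (drop_nth false); last by rewrite s2; lia.
  by rewrite drop_oversize //; rewrite s2; lia.
rewrite st in kn E.
exists x, y, k; split => //; first by lia.
  by rewrite {1}yE E -catA.
case: (ltngtP k n.-1) => hk; [|lia|by case: (x); left].
have n0 : 0 < n by lia.
have nC i : nth false C2 i = if i < n.-1 then ~~ (i < k) else (if i == n.-1 then y else false).
  rewrite {1}yE nth_cat st; case: (ltnP i n.-1) => hi.
    rewrite E nth_cat size_nseq; case: ltnP => h'; rewrite nth_nseq ?if_same // ifT //; lia.
  by case: (eqVneq i n.-1) => [->|hi']; [rewrite subnn|rewrite nth_default //=; lia].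
have last1 : nth false C2 n.-2 = true by rewrite nC ifT; lia.
have last2 : nth false C2 n.-1 = y by rewrite nC ltnn eqxx.
case: x C1E => C1E; right; case: y yE last2 {nC} => // yE last2; exfalso.
  have ln : 0 < n <= n by lia.
  have [_] := h n ln; have -> : phiG TD n n (S C1) = 0.
    apply/phiG_S; rewrite /fS ltnn andbF eqxx C1E !nth_cat !size_nseq ltnn subnn /= andbF //.
  by rewrite leqn0 => /eqP /epsG_S; rewrite /eS ltnn andbF eqxx last1 last2.
have ln : 0 < n.-1 <= n by lia.
have [_] := h n.-1 ln; have -> : phiG TD n n.-1 (S C1) = 0.
  apply/phiG_S; rewrite /fS ifT; last by lia.
  by rewrite C1E !nth_cat !size_nseq ltnn subnn /= andbF.
rewrite leqn0 => /eqP /epsG_S; rewrite /eS ifT; last by lia.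
by rewrite last1 last2.
Qed.

Lemma epsS_le1 t n i C : okn t n -> size C = n -> 0 < i <= n -> epsG t n i (S C) <= 1.
Proof.
by move=> on sC li; rewrite /epsG /=; case E: eS => [D|] //=; have [_ _ ->] := eS_props on sC li E.
Qed.

Lemma highest_pair_D_conv n x y k : 1 < n -> k < n ->
  (if x then k = n.-1 \/ y = false else k = n.-1 \/ y = true) ->
  highest TD n [:: S (nseq n.-1 false ++ [:: x]); S (nseq k false ++ nseq (n.-1 - k) true ++ [:: y])].
Proof.
move=> n1 kn hxy.
have s1 : size (nseq n.-1 false ++ [:: x]) = n by rewrite size_cat size_nseq /=; lia.
have s2 : size (nseq k false ++ nseq (n.-1 - k) true ++ [:: y]) = n by rewrite !size_cat !size_nseq /=; lia.
apply/(highest_pair (t := TD)) => // i li.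
set C1 := nseq n.-1 false ++ _ in s1 *; set C2 := nseq k false ++ _ in s2 *.
have n0 : 0 < n by lia.
have c1 j : j < n.-1 -> nth false C1 j = false.
  by move=> hj; rewrite nth_cat size_nseq hj nth_nseq if_same.
have c1x : nth false C1 n.-1 = x by rewrite nth_cat size_nseq ltnn subnn.
have c2 j : j < n.-1 -> nth false C2 j = ~~ (j < k).
  move=> hj; rewrite nth_cat size_nseq; case: ltnP => h; first by rewrite nth_nseq if_same.
  by rewrite nth_cat size_nseq ifT; [rewrite nth_nseq ifT //; lia|lia].
have c2y : nth false C2 n.-1 = y.
  rewrite nth_cat size_nseq ifF; last by lia.
  by rewrite nth_cat size_nseq ltnn subnn.
have ph : fS TD n i C1 <> None -> epsG TD n i (S C2) <= phiG TD n i (S C1).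
  move=> h; apply: leq_trans (@epsS_le1 TD n i C2 n1 s2 li) _; rewrite lt0n; apply/eqP => /phiG_S; exact: h.
have ep : eS TD n i C2 = None -> epsG TD n i (S C2) <= phiG TD n i (S C1).
  by move/epsG_S => ->.
split.
  rewrite /eS; case: (ltngtP i n) => hi; [|lia|].
    by rewrite ifT; [rewrite (c1 i.-1) //; lia|lia].
  by rewrite andbF (c1 n.-2) //; lia.
case: (ltngtP i n) => hi; [|lia|].
  case: (ltngtP i n.-1) => hi1; [|lia|].
    apply: ep; rewrite /eS ifT; last by lia.
    by rewrite !c2; [case: ifP => //; lia|lia|lia].
  case: (boolP (nth false C2 i.-1 && ~~ nth false C2 i)) => h; last first.
    by apply: ep; rewrite /eS ifT ?(negbTE h) //; lia.
  apply: ph; rewrite /fS ifT; last by lia.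
  move: h; rewrite hi1 c2y c2; last by lia.
  rewrite (c1 n.-2) ?c1x; last by lia.
  by case: (x) hxy => [_|[->|->]]; rewrite ?andbF //; case: (y) => //; lia.
subst i.
case: (boolP (nth false C2 n.-2 && nth false C2 n.-1)) => h; last first.
  by apply: ep; rewrite /eS ltnn andbF eqxx (negbTE h).
apply: ph; rewrite /fS ltnn andbF eqxx; move: h; rewrite c2y c2; last by lia.
rewrite (c1 n.-2) ?c1x; last by lia.
by case: (x) hxy => [[->|->] | _] //; rewrite ?andbF //; have -> : n.-2 < n.-1 by lia.
Qed.

(** * R8 and the closure of all generators, in types B and D *)

Definition ParB (C : seq bool) := true.
Definition ParD (b : bool) (C : seq bool) := odd (nbars C) == b.

Lemma tgtB_pair n w : tgtB n w <-> pair_tgt n ParB w.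
Proof. by split=> [[C1 [C2 [h1 h2 h3]]]|[C1 [C2 [h1 h2 h3 _]]]]; exists C1, C2. Qed.

Lemma ParB_f n i C C' : size C = n -> 0 < i <= n -> fS TB n i C = Some C' \/ eS TB n i C = Some C' -> ParB C' = ParB C.
Proof. by []. Qed.

Lemma ParD_f b n (n1 : 1 < n) i C C' : size C = n -> 0 < i <= n -> fS TD n i C = Some C' \/ eS TD n i C = Some C' ->
  ParD b C' = ParD b C.
Proof. by move=> s li h; rewrite /ParD (nbars_parity n1 s li h). Qed.

Section TypeB.
Variable n : nat.
Hypothesis n0 : 0 < n.

Lemma hwB w : pair_tgt n ParB w -> highest TB n w -> exists2 k, k <= n &
  w = [:: S (nseq n false); S (nseq k false ++ nseq (n - k) true)] /\ pdm TB w = word12 k.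
Proof.
move=> [C1 [C2 [-> s1 s2 _]]] /(highest_pair_B n0 s1 s2)[-> [k kn ->]]; exists k => //; split => //.
by rewrite /= -{1}(subnKC kn) dm_word_B.
Qed.

Lemma hw_seedB w : pair_tgt n ParB w -> highest TB n w -> seedsB n (pdm TB w).
Proof.
move=> h1 h2; have [k kn [_ ->]] := hwB h1 h2.
by case: (posnP k) => k0; [left; rewrite k0|right; exists k; rewrite k0].
Qed.

Lemma pairB_hw k : k <= n -> let w := [:: S (nseq n false); S (nseq k false ++ nseq (n - k) true)] in
  [/\ pair_tgt n ParB w, highest TB n w & pdm TB w = word12 k].
Proof.
move=> kn w; have s1 : size (nseq n false) = n by rewrite size_nseq.
have s2 : size (nseq k false ++ nseq (n - k) true) = n by rewrite size_cat !size_nseq; lia.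
split.
- by exists (nseq n false), (nseq k false ++ nseq (n - k) true).
- by apply/(highest_pair_B n0 s1 s2); split => //; exists k.
- by rewrite /= -{1}(subnKC kn) dm_word_B.
Qed.

Lemma seed_hwB s : seedsB n s -> exists w, [/\ pair_tgt n ParB w, highest TB n w & pdm TB w = s].
Proof.
by case=> [->|[i [/andP[_ li] ->]]]; [have h := pairB_hw (leq0n n)|have h := pairB_hw li]; eexists; exact: h.
Qed.

Lemma hw_injB w w' : pair_tgt n ParB w -> highest TB n w -> pair_tgt n ParB w' -> highest TB n w' ->
  pdm TB w = pdm TB w' -> w = w'.
Proof.
move=> h1 h2 h3 h4; have [k _ [-> ->]] := hwB h1 h2; have [k' _ [-> ->]] := hwB h3 h4.
by move/word12_inj ->.
Qed.

Lemma cryst_isoB Sm : cryst_iso TB n (in_comps TB n (seedsB n)) (tgtB n) Sm <->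
  cryst_iso TB n (in_comps TB n (seedsB n)) (pair_tgt n ParB) Sm.
Proof.
by split=> -[h1 h2 h3 h4]; split => // x hx; first [exact/tgtB_pair/h1 | apply: h3; exact/tgtB_pair].
Qed.

Lemma relB_iso u v : iso_rel TB n ParB (seedsB n) u v -> relB n u v.
Proof.
by move=> [Sm [w [-> -> h1 [h2 h3] h4]]]; apply: RB8 => //; exact/cryst_isoB.
Qed.

Lemma relB_valid u v : relB n u v -> valid_word TB n u /\ valid_word TB n v.
Proof.
case/(relB_cases n0) => [[x [y [-> -> K]]]|[[w [w' [-> -> h]]]|[[C [x [sC vx -> ->]]]|[Sm [w [-> -> iso [cw _] hc]]]]]].
- have [h1 h2] := @knuth_in3 TB n x y n0 K.
  move: h1 h2; rewrite /in3 /w3 /valid_word /= => /and3P[a1 a2 a3] /and3P[b1 b2 b3].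
  by rewrite !(@in_dec TB).
- have vv u0 : all (valid_letter TB n) u0 -> valid_word TB n (Vw u0) by rewrite /valid_word all_map.
  case: h => //.
    move=> u0 k /andP[h _] *; split; first exact: vv.
    by apply: vv; rewrite all_filter; apply: sub_all h => z /= ->; rewrite implybT.
  move=> a c _ /andP[h _] *; split; apply: vv => //.
  by move: h; rewrite !all_cat /= => /andP[-> ->].
- rewrite ins_word_in; have [v1 [v2 _]] := @spin_ins_valid TB C (Some x) isT (ltac:(by rewrite sC)).
  rewrite /valid_word /ins_in /ins_out /= /valid_spin sC eqxx vx; split => //.
  by case: (spin_ins TB C (Some x)) v1 v2 => [[y|] D] /=; rewrite /valid_spin sC => v1 ->; rewrite ?v1 ?eqxx.
- have [h1 _ _ _] := iso; have [C1 [C2 [-> s1 s2]]] := h1 _ hc.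
  by rewrite /valid_word all_map /= /valid_spin s1 s2 eqxx; case/andP: cw.
Qed.

Lemma relB_closed : crystal_closed TB n (fun u v => relB n u v \/ u = v).
Proof.
move=> u v i [h|->] li; last by split; [case: fW|case: eW] => //= *; right.
have mono Q : crystal_closed TB n Q -> Q u v -> (forall a b, Q a b -> relB n a b \/ a = b) ->
  optrel (fun u v => relB n u v \/ u = v) (fW TB n i u) (fW TB n i v) /\
  optrel (fun u v => relB n u v \/ u = v) (eW TB n i u) (eW TB n i v).
  move=> cQ q sub; have [hf he] := cQ _ _ _ q li; split.
    by case: (fW TB n i u) hf => [a|]; case: (fW TB n i v) => [b|] //= /sub.
  by case: (eW TB n i u) he => [a|]; case: (eW TB n i v) => [b|] //= /sub.
case/(relB_cases n0): h => [K|[[w [w' [uE vE h]]]|[h|[Sm [w [uE vE iso ca hc]]]]]].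
- apply: (mono _ (@knuth_rel_closed TB n n0)); first by left.
  by move=> a b [/(knuth_relB n0)|]; [left|right].
- apply: (mono _ (@til_rel_closed TB n n0)); first by rewrite uE vE; exact: relR5_til.
  by move=> a b /(@til_relR5 TB n a b n0)[x [x' [-> -> h']]]; left; exact: relR5_relB.
- apply: (mono _ (@spin_rel_closed TB n n0)) => // a b h'; left; exact: (@spin_rel_rel TB n a b n0 h').
- apply: (mono _ (@iso_rel_closed TB n n0 ParB (@ParB_f n) (seedsB n) hw_seedB seed_hwB)).
    by exists Sm, w; split => //; exact/cryst_isoB.
  by move=> a b /relB_iso; left.
Qed.

(** The instance of R8 that completeness uses: a column 12...k replaced by two spin columns. *)
Lemma relB_pair k : k <= n -> relB n [:: S (nseq n false); S (nseq k false ++ nseq (n - k) true)] (word12 k).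
Proof.
move=> kn; have [h1 h2 <-] := pairB_hw kn; apply: relB_iso.
exact: (@pdm_iso_rel TB n n0 ParB (@ParB_f n) (seedsB n) hw_seedB seed_hwB hw_injB).
Qed.
End TypeB.

Section TypeD.
Variable n : nat.
Hypothesis n1 : 1 < n.
Let n0 : 0 < n. Proof. exact: ltnW n1. Qed.

Definition seedsD (b : bool) := if b then seedsDn1 n else seedsDn n.
Definition tgtD (b : bool) := if b then tgtDn1 n else tgtDn n.
(** b is the last bit of the first column and hence also the parity of its bars, which selects the
    isomorphism in R8; y is the last bit of the second column. *)
Definition hwpair (b : bool) (k : nat) (y : bool) : word :=
  [:: S (nseq n.-1 false ++ [:: b]); S (nseq k false ++ nseq (n.-1 - k) true ++ [:: y])].

Lemma tgtD_pair b w : tgtD b w <-> pair_tgt n (ParD b) w.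
Proof.
rewrite /tgtD; case: b; split=> -[C1 [C2 [h1 h2 h3 h4]]]; exists C1, C2; split => //; move: h4; rewrite /ParD.
- by move->.
- by move/eqP.
- by case: odd.
- by move/eqP->.
Qed.

Lemma pdm_hwpair b k y : k < n -> pdm TD (hwpair b k y) =
  word12 k ++ (if b == y then [:: V (if b then Neg n else Pos n)] else [::]).
Proof.
move=> kn; have kn' : k <= n.-1 by lia.
by rewrite /= -{1}(subnKC kn') dm_word_D subnKC // prednK.
Qed.

Lemma hwD b w : pair_tgt n (ParD b) w -> highest TD n w ->
  exists k y, [/\ k < n, k = n.-1 \/ y = ~~ b & w = hwpair b k y].
Proof.
move=> [C1 [C2 [-> s1 s2 p]]] /(highest_pair_D n1 s1 s2)[x [y [k [kn c1 c2 h]]]].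
have xb : x = b.
  move: p; rewrite /ParD c1 /nbars count_cat count_nseq mul0n /= add0n addn0; case: (x); case: (b) => //.
by exists k, y; split => //; [move: h; rewrite xb; case: (b)|rewrite c1 c2 xb].
Qed.

Lemma hwpair_spec b k y : k < n -> k = n.-1 \/ y = ~~ b ->
  pair_tgt n (ParD b) (hwpair b k y) /\ highest TD n (hwpair b k y).
Proof.
move=> kn h; split; last by apply: highest_pair_D_conv => //; case: (b) h.
exists (nseq n.-1 false ++ [:: b]), (nseq k false ++ nseq (n.-1 - k) true ++ [:: y]); split => //.
- by rewrite size_cat size_nseq /=; lia.
- by rewrite !size_cat !size_nseq /=; lia.
- by rewrite /ParD /nbars count_cat count_nseq mul0n /= add0n addn0; case: (b).
Qed.

(** With y different from b the image is 12...k for k < n. With y = b only k = n-1 is possible, and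
    the last letter n or \bar n is added; this accounts for all seeds. *)
Lemma seeds_pdm b s : seedsD b s <-> exists k y, [/\ k < n, k = n.-1 \/ y = ~~ b & pdm TD (hwpair b k y) = s].
Proof.
have nn : n.-1.+1 = n by lia.
have w12 : word12 n = word12 n.-1 ++ [:: V (Pos n)] by rewrite -{1}nn word12_rcons nn.
have nb : (b == ~~ b) = false by case: (b).
split.
  have small k : k < n -> exists k' y, [/\ k' < n, k' = n.-1 \/ y = ~~ b & pdm TD (hwpair b k' y) = word12 k].
    by move=> kn; exists k, (~~ b); split => //; [right|rewrite pdm_hwpair // nb cats0].
  have big : exists k' y, [/\ k' < n, k' = n.-1 \/ y = ~~ b &
      pdm TD (hwpair b k' y) = word12 n.-1 ++ [:: V (if b then Neg n else Pos n)]].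
    by exists n.-1, b; split; [lia|left|rewrite pdm_hwpair ?eqxx //; lia].
  rewrite /seedsD; case: b small big {nb} => small big.
    case=> [->|[[i [/andP[_ li] ->]]|->]]; [exact: (small 0)|exact: small|exact: big].
  case=> [->|[i [li ->]]]; first exact: (small 0).
  case: (ltngtP i n) => h; [exact: small|lia|].
  by rewrite h w12.
case=> k [y [kn h <-]]; rewrite pdm_hwpair //.
case: eqP => [yb|yb]; last first.
  rewrite cats0 /seedsD; case: (posnP k) => k0; first by rewrite k0; case: (b); left.
  by case: (b); right; [left|]; exists k; split => //; lia.
have -> : k = n.-1 by case: h => // h; move: yb; rewrite h; case: (b).
rewrite /seedsD; case: (b); first by right; right.
by right; exists n; split; [lia|].
Qed.

Lemma hw_seedD b w : pair_tgt n (ParD b) w -> highest TD n w -> seedsD b (pdm TD w).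
Proof. by move=> h1 h2; have [k [y [h3 h4 ->]]] := hwD h1 h2; apply/seeds_pdm; exists k, y. Qed.

Lemma seed_hwD b s : seedsD b s -> exists w, [/\ pair_tgt n (ParD b) w, highest TD n w & pdm TD w = s].
Proof.
by move/seeds_pdm => [k [y [h1 h2 <-]]]; have [h3 h4] := hwpair_spec h1 h2; exists (hwpair b k y).
Qed.

Lemma hw_injD b w w' : pair_tgt n (ParD b) w -> highest TD n w -> pair_tgt n (ParD b) w' -> highest TD n w' ->
  pdm TD w = pdm TD w' -> w = w'.
Proof.
move=> h1 h2 h3 h4; have [k [y [kn hk ->]]] := hwD h1 h2; have [k' [y' [kn' hk' ->]]] := hwD h3 h4.
rewrite !pdm_hwpair // => /(congr1 size); rewrite !size_cat /word12 !size_map !size_iota => e.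
suff [-> ->] : k = k' /\ y = y' by [].
move: hk hk' e; case: (b); case: (y); case: (y') => -[? //|? //] [? //|? //] /=; split => //; lia.
Qed.

Lemma cryst_isoD b Sm : cryst_iso TD n (in_comps TD n (seedsD b)) (tgtD b) Sm <->
  cryst_iso TD n (in_comps TD n (seedsD b)) (pair_tgt n (ParD b)) Sm.
Proof.
by split=> -[h1 h2 h3 h4]; split => // x hx; first [exact/tgtD_pair/h1 | apply: h3; exact/tgtD_pair].
Qed.

Lemma relD_iso b u v : iso_rel TD n (ParD b) (seedsD b) u v -> relD n u v.
Proof.
move=> [Sm [w [-> -> /cryst_isoD h1 [h2 h3] h4]]]; case: b h1 h4 => h1 h4; [exact: RD8n1|exact: RD8n].
Qed.

Lemma relD_iso_cases u v : relD n u v -> knuth_rel TD n u v \/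
  (exists w w', [/\ u = Vw w, v = Vw w' & relR5 TD n w w']) \/ spin_rel TD n u v \/
  exists b, iso_rel TD n (ParD b) (seedsD b) u v.
Proof.
case/(relD_cases n1) => [h|[h|[h|[[Sm [w [h1 h2 h3 h4 h5]]]|[Sm [w [h1 h2 h3 h4 h5]]]]]]]; [by left|by right; left|by right; right; left| |];
  right; right; right; [exists false|exists true]; exists Sm, w; split => //; exact/cryst_isoD.
Qed.

Lemma relD_valid u v : relD n u v -> valid_word TD n u /\ valid_word TD n v.
Proof.
case/relD_iso_cases => [[x [y [-> -> K]]]|[[w [w' [-> -> h]]]|[[C [x [sC vx -> ->]]]|[b [Sm [w [-> -> iso [cw _] hc]]]]]]].
- have [h1 h2] := @knuth_in3 TD n x y n1 K.
  move: h1 h2; rewrite /in3 /w3 /valid_word /= => /and3P[a1 a2 a3] /and3P[b1 b2 b3].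
  by rewrite !(@in_dec TD).
- have vv u0 : all (valid_letter TD n) u0 -> valid_word TD n (Vw u0) by rewrite /valid_word all_map.
  case: h => //.
    move=> u0 k /andP[h _] *; split; first exact: vv.
    by apply: vv; rewrite all_filter; apply: sub_all h => z /= ->; rewrite implybT.
  move=> a c x _ _ /andP[h _] *; split; apply: vv => //.
  by move: h; rewrite !all_cat /= => /andP[-> /andP[_ ->]].
- rewrite ins_word_in; have [v1 [v2 _]] := @spin_ins_valid TD C (Some x) (ltac:(by rewrite /nilp sC -lt0n)) (ltac:(by rewrite sC)).
  rewrite /valid_word /ins_in /ins_out /= /valid_spin sC eqxx vx; split => //.
  by case: (spin_ins TD C (Some x)) v1 v2 => [[y|] D] /=; rewrite /valid_spin sC => v1 ->; rewrite ?v1 ?eqxx.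
- have [h1 _ _ _] := iso; have [C1 [C2 [-> s1 s2 _]]] := h1 _ hc.
  by rewrite /valid_word all_map /= /valid_spin s1 s2 eqxx; case/andP: cw.
Qed.

Lemma relD_closed : crystal_closed TD n (fun u v => relD n u v \/ u = v).
Proof.
move=> u v i [h|->] li; last by split; [case: fW|case: eW] => //= *; right.
have mono Q : crystal_closed TD n Q -> Q u v -> (forall a b, Q a b -> relD n a b \/ a = b) ->
  optrel (fun u v => relD n u v \/ u = v) (fW TD n i u) (fW TD n i v) /\
  optrel (fun u v => relD n u v \/ u = v) (eW TD n i u) (eW TD n i v).
  move=> cQ q sub; have [hf he] := cQ _ _ _ q li; split.
    by case: (fW TD n i u) hf => [a|]; case: (fW TD n i v) => [b|] //= /sub.
  by case: (eW TD n i u) he => [a|]; case: (eW TD n i v) => [b|] //= /sub.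
case/relD_iso_cases: h => [K|[[w [w' [uE vE h]]]|[h|[b h]]]].
- apply: (mono _ (@knuth_rel_closed TD n n1)); first by left.
  by move=> a b [/(knuth_relD n1)|]; [left|right].
- apply: (mono _ (@til_rel_closed TD n n1)); first by rewrite uE vE; exact: relR5_til.
  by move=> a b /(@til_relR5 TD n a b n1)[x [x' [-> -> h']]]; left; exact: relR5_relD.
- apply: (mono _ (@spin_rel_closed TD n n1)) => // a b h'; left; exact: (@spin_rel_rel TD n a b n1 h').
- apply: (mono _ (@iso_rel_closed TD n n1 (ParD b) (@ParD_f b n n1) (seedsD b) (@hw_seedD b) (@seed_hwD b))) => //.
  by move=> a c /relD_iso; left.
Qed.

Lemma relD_pair b k y : k < n -> k = n.-1 \/ y = ~~ b ->
  relD n (hwpair b k y) (word12 k ++ (if b == y then [:: V (if b then Neg n else Pos n)] else [::])).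
Proof.
move=> kn h; have [h1 h2] := hwpair_spec kn h; rewrite -pdm_hwpair //; apply: (@relD_iso b).
exact: (@pdm_iso_rel TD n n1 (ParD b) (@ParD_f b n n1) (seedsD b) (@hw_seedD b) (@seed_hwD b) (@hw_injD b)).
Qed.
End TypeD.

(** * From the congruence to isomorphic components *)

Section Main.
Variables (t : ctype) (n : nat) (R : word -> word -> Prop).
Hypothesis on : okn t n.
Hypothesis R_valid : forall u v, R u v -> valid_word t n u /\ valid_word t n v.
Hypothesis R_closed : crystal_closed t n (fun u v => R u v \/ u = v).
Hypothesis hw_congr : forall u v, valid_word t n u -> valid_word t n v -> highest t n u -> highest t n v ->
  (forall i, 0 < i <= n -> phiW t n i u = phiW t n i v) -> congr R u v.
Hypothesis hw_uniq : forall u v, valid_word t n u -> highest t n u -> highest t n v -> conn t n u v -> u = v.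

Let cclosed := congr_closed on R_valid R_closed.

Lemma conn_f i u v : 0 < i <= n -> fW t n i u = Some v -> conn t n u v.
Proof. by move=> li h; apply: rt_step; exists i; split => //; left. Qed.

Lemma conn_e i u v : 0 < i <= n -> eW t n i u = Some v -> conn t n u v.
Proof. by move=> li h; apply: rt_step; exists i; split => //; right. Qed.

(** Raise both words along one path: they stay congruent and connected and end at highest weight
    vertices of one component, which coincide. Lowering them again along the same path gives u =
    v. *)
Lemma congr_conn_eq u v : valid_word t n u -> congr R u v -> conn t n u v -> u = v.
Proof.
move=> vu; have [h [js [hh ljs hp vh]]] := exists_highest on vu.
elim: js u v vu hp ljs => [|i js IH] u v vu /=.
  by case=> <- _ c d; apply: hw_uniq => //; exact: (congr_highest on R_valid R_closed c).
rewrite -/(fpath t n js h); case E: (fpath t n js h) => [w|] //= hf /andP[li ljs] c d.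
have vw : valid_word t n w by apply: (valid_conn on vh); apply: fpath_conn E.
have ew : eW t n i u = Some w by have [] := fW_props on li vw hf.
have vv : valid_word t n v by exact: (valid_conn on vu d).
have [_] := cclosed c li; rewrite ew /=; case E': (eW t n i v) => [w'|] //= c'.
have [_ _ hf' _ _] := eW_props on li vv E'.
have ww : w = w'.
  apply: IH => //; apply: rt_trans (conn_f li hf) _; apply: rt_trans d _; exact: conn_e E'.
by move: hf'; rewrite -ww hf => -[].
Qed.

(** The isomorphism sends x to a congruent word in the component of v. Such a word exists because
    the congruence is stable, and it is unique by [congr_conn_eq], so it respects the arrows. *)
Lemma congr_sim u v : valid_word t n u -> valid_word t n v -> congr R u v -> sim t n u v.
Proof.
move=> vu vv c.
have uq x y : conn t n v x -> conn t n v y -> congr R x y -> x = y.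
  move=> cx cy cxy; apply: congr_conn_eq (cxy) _; first exact: (valid_conn on vv cx).
  exact: rt_trans (conn_sym on vv cx) cy.
have uq' x y : conn t n u x -> conn t n u y -> congr R x y -> x = y.
  move=> cx cy cxy; apply: congr_conn_eq (cxy) _; first exact: (valid_conn on vu cx).
  exact: rt_trans (conn_sym on vu cx) cy.
pose phi x := epsilon (inhabits x) (fun y => conn t n v y /\ congr R x y).
have phiP x : conn t n u x -> conn t n v (phi x) /\ congr R x (phi x).
  move=> cx; apply: (epsilon_spec (inhabits x) (fun y => conn t n v y /\ congr R x y)).
  exact: (congr_conn on R_valid R_closed c cx).
split.
  exists phi; split; first by move=> x /phiP[].
  split.
    move=> x y cx cy e; apply: uq' => //; have [_ c1] := phiP x cx; have [_ c2] := phiP y cy.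
    by rewrite -e in c2; exact: cg_trans c1 (cg_sym c2).
  split.
    move=> y cy; have [x [cx c1]] := congr_conn on R_valid R_closed (cg_sym c) cy.
    exists x; split => //; have [h1 h2] := phiP x cx.
    by apply: uq => //; exact: cg_sym (cg_trans c1 h2).
  move=> i x y li cx cy; have [h1 h2] := phiP x cx; have [h3 h4] := phiP y cy.
  have [H _] := cclosed h2 li; split=> E.
    move: H; rewrite E /=; case E': fW => [z|] //= c'; congr Some; apply: uq => //.
      exact: rt_trans h1 (conn_f li E').
    exact: cg_trans (cg_sym c') h4.
  move: H; rewrite E /=; case E': fW => [z|] //= c'; congr Some; apply: uq' => //.
    exact: rt_trans cx (conn_f li E').
  exact: cg_trans c' (cg_sym h4).
have [h [js [hh ljs hp vh]]] := exists_highest on vu.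
have ch := conn_sym on vh (fpath_conn ljs hp).
have [h' [ch' c']] := congr_conn on R_valid R_closed c ch.
exists h, h', js; split; split => //.
  exact: (congr_highest on R_valid R_closed c' hh).
have [v' [hp' c'']] := congr_fpath on R_valid R_closed ljs c' hp.
rewrite hp'; congr Some; apply: uq; last exact: cg_trans (cg_sym c'') c.
  exact: rt_trans ch' (fpath_conn ljs hp').
exact: rt_refl.
Qed.

Lemma sim_congr u v : valid_word t n u -> valid_word t n v -> sim t n u v -> congr R u v.
Proof.
move=> vu vv [[phi [p1 [p2 [p3 p4]]]] [u0 [v0 [js [[cu cv hu hv] [ljs pu pv]]]]]].
have vu0 := valid_conn on vu cu; have vv0 := valid_conn on vv cv.
have vp x : conn t n u x -> valid_word t n (phi x) by move=> /p1; exact: (valid_conn on vv).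
(* [comp_iso] mentions f only. An arrow e_i at the image of u0 is therefore read backwards as f_i
   and pulled back along the isomorphism, where it contradicts that u0 is highest. *)
have hw0 : highest t n (phi u0).
  move=> i li; case E: eW => [y|] //; have cy := rt_trans _ _ _ _ _ (p1 _ cu) (conn_e li E).
  have [x [cx xy]] := p3 y cy; have [_ _ E' _ _] := eW_props on li (vp _ cu) E.
  rewrite -xy in E'; move/(p4 i x u0 li cx cu): E' => E'.
  by have [_ _ E2 _ _] := fW_props on li (valid_conn on vu cx) E'; rewrite hu in E2.
have phi0 : phi u0 = v0.
  by apply: hw_uniq => //; [exact: vp|apply: rt_trans (conn_sym on vv (p1 _ cu)) cv].
have c0 : congr R u0 v0.
  apply: hw_congr => // i li; rewrite -phi0.
  (* phi_i counts how often f_i applies, which an isomorphism preserves; the case of length 0 uses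
     surjectivity. *)
  suff key k u1 : conn t n u u1 -> phiW t n i u1 = k -> phiW t n i u1 = phiW t n i (phi u1) by exact: key cu erefl.
  elim: k u1 => [|k IH] u1 cu1 e; last first.
    case E: (fW t n i u1) => [u2|]; last by move/(fW_None on li (valid_conn on vu cu1)): E; rewrite e.
    have cu2 := rt_trans _ _ _ _ _ cu1 (conn_f li E).
    have [_ _ _ e1 _] := fW_props on li (valid_conn on vu cu1) E.
    move/(p4 i _ _ li cu1 cu2): E => E; have [_ _ _ e2 _] := fW_props on li (vp _ cu1) E.
    by rewrite e1 e2 IH //; lia.
  rewrite e; apply/esym/(fW_None on li (vp _ cu1)).
  case E: fW => [y|] //; have cy := rt_trans _ _ _ _ _ (p1 _ cu1) (conn_f li E).
  have [x [cx xy]] := p3 y cy; rewrite -xy in E; move/(p4 i _ _ li cu1 cx): E.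
  by move/(fW_None on li (valid_conn on vu cu1)): e => ->.
have [v' [+ c']] := congr_fpath on R_valid R_closed ljs c0 pu.
by rewrite pv => -[->].
Qed.
End Main.

(** * Weights and highest weight words *)

Definition phiL (t : ctype) (n i : nat) (x : letter) : nat :=
  match t, x with
  | TB, Pos k => (i == k) + ((i == k) && (k == n))
  | TB, Zer => (i == n)
  | TB, Neg k => (k == i.+1)
  | TD, Pos k => ((i == k) && (k < n)) + ((i == n) && ((k == n) || (k == n.-1)))
  | TD, Zer => 0
  | TD, Neg k => (k == i.+1)
  end.

(** Barring letters reverses all arrows of the vector crystal. *)
Definition epsL (t : ctype) (n i : nat) (x : letter) : nat := phiL t n i (bar x).

Lemma phiG_V t n i x : okn t n -> 0 < i <= n -> valid_letter t n x -> phiG t n i (V x) = phiL t n i x.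
Proof.
move=> on li; have E g : phiG t n i g = if fG t n i g is Some g' then 1 + cnt (fG t n i) 3 g' else 0 by [].
have C k g : cnt (fG t n i) k.+1 g = if fG t n i g is Some g' then (cnt (fG t n i) k g').+1 else 0 by [].
rewrite E; case: t on E C => /= on E C; case: x => [k||k] //= v.
all: repeat (rewrite ?C /=; case: ifP => //= ?); lia.
Qed.

Lemma epsG_V t n i x : okn t n -> 0 < i <= n -> valid_letter t n x -> epsG t n i (V x) = epsL t n i x.
Proof.
move=> on li; have C k g : cnt (eG t n i) k.+1 g = if eG t n i g is Some g' then (cnt (eG t n i) k g').+1 else 0 by [].
rewrite /epsG C; case: t on C => /= on C; case: x => [k||k] //= v.
all: repeat (rewrite ?C /=; case: ifP => //= ?); rewrite /epsL /=; lia.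
Qed.

Lemma phiG_spin t n i C : okn t n -> size C = n -> 0 < i <= n -> phiG t n i (S C) = isSome (fS t n i C).
Proof.
by move=> on sC li; rewrite /phiG /=; case E: fS => [D|] //=; have [sD E' ->] := fS_props on sC li E.
Qed.

Lemma epsG_spin t n i C : okn t n -> size C = n -> 0 < i <= n -> epsG t n i (S C) = isSome (eS t n i C).
Proof.
by move=> on sC li; rewrite /epsG /=; case E: eS => [D|] //=; have [sD E' ->] := eS_props on sC li E.
Qed.

Definition wt2G (g : gletter) (j : nat) : int := match g with V x => wt2L x j | S C => wt2S C j end.
Fixpoint wtW (w : word) (j : nat) : int := (if w is g :: w' then wt2G g j + wtW w' j else 0)%R.
(** The doubled weight paired with e_1 + ... + e_p. Dominance enters the proof as the comparison of
    these sums for all p <= n, which also recover every coordinate. *)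
Fixpoint psum (p : nat) (w : word) : int := (if p is q.+1 then psum q w + wtW w p else 0)%R.

(** Evaluation of the simple coroot h_i. At a doubled weight it equals 2(phi_i - eps_i). *)
Definition pairing (t : ctype) (n i : nat) (f : nat -> int) : int :=
  if (i < n)%N then (f i - f i.+1)%R else if t is TB then (f n + f n)%R else (f n.-1 + f n)%R.

Lemma pairing_G t n i g : okn t n -> 0 < i <= n -> valid_g t n g ->
  ((phiG t n i g)%:Z + (phiG t n i g)%:Z - (epsG t n i g)%:Z - (epsG t n i g)%:Z = pairing t n i (wt2G g))%R.
Proof.
move=> on li; case: g => [x v|C /eqP sC].
  rewrite phiG_V // epsG_V // /pairing.
  move: v on; case: t; case: x => [k||k] //=; rewrite /epsL /=; intros; case: (ltnP i n) => ?;
  repeat (case: eqP => ?); lia.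
rewrite phiG_spin // epsG_spin // /pairing /fS /eS /wt2G /wt2S; clear -on li.
case: (ltngtP i n) => h; [|by exfalso; lia|].
  have -> : 0 < i by lia.
  by rewrite /=; case: (nth false C i.-1); case: (nth false C i).
rewrite andbF; case: t on => on; first by case: (nth false C n.-1).
by case: (nth false C n.-1); case: (nth false C n.-2).
Qed.

Lemma pairing_W t n i w : okn t n -> 0 < i <= n -> valid_word t n w ->
  ((phiW t n i w)%:Z + (phiW t n i w)%:Z - (epsW t n i w)%:Z - (epsW t n i w)%:Z = pairing t n i (wtW w))%R.
Proof.
move=> on li; elim: w => [_|g w IH /andP[vg vw]].
  by rewrite /pairing; case: ifP => //; case: t on.
have := pairing_G on li vg; have := IH vw; rewrite phiW_cons epsW_cons.
have -> : (pairing t n i (wtW (g :: w)) = pairing t n i (wt2G g) + pairing t n i (wtW w))%R.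
  by rewrite /pairing /=; case: ifP => _; [lia|case: (t); lia].
by move=> <- <-; maxlia.
Qed.

(** The simple coroots separate weights: the nodes i < n give the differences of neighbouring
    coordinates, and node n then determines the last coordinate. *)
Lemma wt_phi_eps t n u v : okn t n -> valid_word t n u -> valid_word t n v ->
  (forall i, 0 < i <= n -> epsW t n i u = epsW t n i v /\ phiW t n i u = phiW t n i v) ->
  forall j, 0 < j <= n -> wtW u j = wtW v j.
Proof.
move=> on vu vv h.
have pe i : 0 < i <= n -> pairing t n i (wtW u) = pairing t n i (wtW v).
  by move=> li; rewrite -!pairing_W //; have [-> ->] := h i li.
have step j : 0 < j < n -> (wtW u j - wtW u j.+1 = wtW v j - wtW v j.+1)%R.
  by move=> lj; have := pe j; rewrite /pairing (_ : j < n); [apply; lia|lia].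
have n0 : 0 < n by clear -on; case: t on => /=; lia.
have last : wtW u n = wtW v n.
  have := pe n; rewrite /pairing ltnn n0 leqnn => /(_ isT); move: on step; clear; case: t => on step; first by lia.
  have := step n.-1; rewrite prednK; last by rewrite /okn in on; lia.
  by move=> /(_ ltac:(rewrite /okn in on; lia)); lia.
have key k : k < n -> wtW u (n - k) = wtW v (n - k).
  elim: k => [|k IH] hk; first by rewrite subn0.
  have := step (n - k.+1) ltac:(lia); have -> : (n - k.+1).+1 = n - k by lia.
  by move: (IH (ltnW hk)); lia.
by move=> j /andP[j0 jn]; rewrite -(subKn jn); apply: key; lia.
Qed.

Lemma wtW_cat u v j : (wtW (u ++ v) j = wtW u j + wtW v j)%R.
Proof. by elim: u => [|g u IH] /=; rewrite ?IH; lia. Qed.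

Lemma psum_cat p u v : (psum p (u ++ v) = psum p u + psum p v)%R.
Proof. by elim: p => //= p ->; rewrite wtW_cat; lia. Qed.

Lemma psum_nil p : psum p [::] = 0%R.
Proof. by elim: p => //= p ->. Qed.

Lemma psum_cons p g w : psum p (g :: w) = (psum p [:: g] + psum p w)%R.
Proof. by rewrite -[g :: w]/([:: g] ++ w) psum_cat. Qed.

Lemma psum_V p x : psum p [:: V x] = match x with
  | Pos k => if 0 < k <= p then 2%R else 0%R | Zer => 0%R | Neg k => if 0 < k <= p then (- 2)%R else 0%R end.
Proof.
elim: p => [|p IH]; first by case: x => [k||k] //=; case: ifP => //; lia.
rewrite /= {}IH; case: x => [k||k] //=; repeat (case: ifP => ?); lia.
Qed.

Lemma psum_spin_le p C : (psum p [:: S C] <= p%:Z)%R.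
Proof. by elim: p => //= p; rewrite /wt2S; case: ifP; lia. Qed.

Lemma psum_zeros p n : (psum p [:: S (nseq n false)] = p%:Z)%R.
Proof. by elim: p => //= p ->; rewrite /wt2S nth_nseq if_same; lia. Qed.

Lemma psum_word12 p k : (psum p (word12 k) = (minn k p)%:Z + (minn k p)%:Z)%R.
Proof.
elim: k => [|k IH]; first by rewrite psum_nil min0n.
by rewrite word12_rcons psum_cat IH psum_V; case: ifP; lia.
Qed.

Definition isV (g : gletter) : bool := if g is V _ then true else false.

Lemma psum_Vs p w : all isV w -> (psum p w <= (size w)%:Z + (size w)%:Z)%R.
Proof.
elim: w => [|[x|C] w IH] //=; first by rewrite psum_nil.
by move=> /IH h; rewrite psum_cons psum_V; case: (x) => [k||k]; repeat (case: ifP => ?); lia.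
Qed.

Lemma psum_wt n u v p : p <= n -> (forall j, 0 < j <= n -> wtW u j = wtW v j) -> psum p u = psum p v.
Proof. by move=> + h; elim: p => //= p IH hp; rewrite IH ?h //; lia. Qed.

Lemma wt_psum n u v : (forall p, p <= n -> psum p u = psum p v) -> forall j, 0 < j <= n -> wtW u j = wtW v j.
Proof.
move=> h [|j] // lj; have := h j.+1 ltac:(lia); have := h j ltac:(lia) => /= ->; lia.
Qed.

(** Doubled weights have even coordinates for vector letters and odd ones for spin columns, and
    within each kind they are visibly distinct. So a letter can be recovered from its weight. *)
Lemma wt2G_inj t n g g' : okn t n -> valid_g t n g -> valid_g t n g' ->
  (forall j, 0 < j <= n -> wt2G g j = wt2G g' j) -> g = g'.
Proof.
move=> on vg vg' h.
have n0 : 0 < n by clear -on; case: t on => /=; lia.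
have spin x C : valid_letter t n x -> exists2 j, 0 < j <= n & wt2L x j <> wt2S C j.
  by move=> vx; exists 1 => //; rewrite /wt2S; case: ifP => _; case: (x) => [k||k] /=; repeat (case: ifP => ?); lia.
case: g g' vg vg' h => [x|C] [x'|C'] vg vg' h.
- congr V; case: x x' vg vg' h => [k||k] [k'||k'] //= vk vk' h; try (have := h k vk); try (have := h k' vk');
    rewrite ?eqxx; repeat (case: eqP => [?|?]); subst; rewrite ?eqxx //; lia.
- by have [j lj ne] := spin x C' vg; case: ne; apply: h.
- by have [j lj ne] := spin x' C vg'; case: ne; apply/esym/h.
congr S; move/eqP: vg => sC; move/eqP: vg' => sC'; apply: (@eq_from_nth _ false); first by rewrite sC.
move=> i; rewrite sC => hi; have := h i.+1 hi; rewrite /= /wt2S /=.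
by case: ifP; case: ifP.
Qed.

(** * Completeness from a few congruences shared by both types *)

Section Completeness.
Variables (t : ctype) (n : nat) (R : word -> word -> Prop).
Hypothesis n1 : 1 < n.
Hypothesis R_valid : forall u v, R u v -> valid_word t n u /\ valid_word t n v.
Hypothesis R_closed : crystal_closed t n (fun u v => R u v \/ u = v).

Local Notation "u ≈ v" := (congr R u v) (at level 70).
Definition Spin0 n : word := [:: S (nseq n false)].
Definition Spin1 n : word := [:: S (nseq n.-1 false ++ [:: true])].

Hypothesis spin_neg : forall k D, size D + k.+1 = n ->
  [:: S (nseq k false ++ false :: D); V (Neg k.+1)] ≈ [:: S (nseq k false ++ true :: D)].
Hypothesis spin_pos : forall C k, size C = n -> k < n -> nth false C k = false ->
  [:: S C; V (Pos k.+1)] ≈ [:: V (Pos k.+1); S C].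
Hypothesis spin_col : forall k, k <= n -> [:: S (nseq n false); S (nseq k false ++ nseq (n - k) true)] ≈ word12 k.
Hypothesis spin_zer : t = TB -> Spin0 n ++ [:: V Zer] ≈ Spin0 n.
Hypothesis spin_posn : t = TD -> Spin1 n ++ [:: V (Pos n)] ≈ Spin0 n.
Hypothesis spin_spin : t = TD -> Spin1 n ++ Spin0 n ≈ word12 n.-1.

Lemma okn_gt1 : okn t n.
Proof. by case: (t) => //=; apply: ltnW. Qed.
Let on := okn_gt1.

Lemma congr_catl u v w : v ≈ w -> u ++ v ≈ u ++ w.
Proof. by move=> h; apply: congr_cat => //; exact: cg_refl. Qed.
Lemma congr_catr u v w : v ≈ w -> v ++ u ≈ w ++ u.
Proof. by move=> h; apply: congr_cat => //; exact: cg_refl. Qed.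

(** Highest weight words of the fundamental weights: spin columns for i = n and, in type D, for i =
    n-1; columns 12...i otherwise. *)
Definition fund (i : nat) : word :=
  if i == n then Spin0 n else if t is TD then (if i == n.-1 then Spin1 n else word12 i) else word12 i.

Lemma fundP i : 0 < i <= n -> [\/ fund i = Spin0 n, t = TD /\ fund i = Spin1 n | i < n /\ fund i = word12 i].
Proof.
rewrite /fund => li; case: eqP => hi; first by constructor 1.
case: (t); first by constructor 3; split => //; lia.
by case: eqP => hi'; [constructor 2|constructor 3; split => //; lia].
Qed.

Definition commute_congr u v := u ++ v ≈ v ++ u.

Lemma comm_sym u v : commute_congr u v -> commute_congr v u.
Proof. exact: cg_sym. Qed.

Lemma comm_cat u v w : commute_congr u v -> commute_congr u w -> commute_congr u (v ++ w).
Proof.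
rewrite /commute_congr => h1 h2; rewrite catA; apply: cg_trans (congr_catr w h1) _.
by rewrite -!catA; apply: congr_catl.
Qed.

Lemma comm_congr u v w : v ≈ w -> commute_congr u w -> commute_congr u v.
Proof.
move=> h1 h2; apply: cg_trans (congr_catl u h1) _; apply: cg_trans h2 _.
exact: congr_catr (cg_sym h1).
Qed.

Lemma comm_spin_col C k : size C = n -> k <= n -> (forall i, i < k -> nth false C i = false) ->
  commute_congr [:: S C] (word12 k).
Proof.
move=> sC; elim: k => [|k IH] kn h; first by exact: cg_refl.
rewrite word12_rcons; apply: comm_cat; first by apply: IH => [|i hi]; [lia|apply: h; lia].
by apply: spin_pos => //; apply: h.
Qed.

(** The longer column is the one to be replaced: for k <= l both spin columns that stand for 12...l
    contain 1, ..., k, so these letters pass through unchanged. *)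
Lemma comm_col_col k l : k <= l -> l <= n -> commute_congr (word12 k) (word12 l).
Proof.
move=> kl ln; apply: comm_congr (cg_sym (spin_col ln)) _; apply: comm_sym.
apply: comm_sym; rewrite -[[:: _; _]]/([:: S (nseq n false)] ++ [:: S (nseq l false ++ nseq (n - l) true)]).
apply: comm_cat; apply: comm_sym; apply: comm_spin_col.
- by rewrite size_nseq.
- by lia.
- by move=> i _; rewrite nth_nseq if_same.
- by rewrite size_cat !size_nseq; lia.
- by lia.
- by move=> i hi; rewrite nth_cat size_nseq ifT; [rewrite nth_nseq if_same|lia].
Qed.

Lemma comm_fund i j : 0 < i <= n -> 0 < j <= n -> commute_congr (fund i) (fund j).
Proof.
have self u : commute_congr u u by exact: cg_refl.
have c0 k : k <= n -> commute_congr (Spin0 n) (word12 k).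
  by move=> kn; apply: comm_spin_col => //; [rewrite size_nseq|move=> i' _; rewrite nth_nseq if_same].
have c1 k : k < n -> commute_congr (Spin1 n) (word12 k).
  move=> kn; apply: comm_spin_col; [by rewrite size_cat size_nseq /=; lia|by lia|].
  by move=> i' h; rewrite nth_cat size_nseq ifT; [rewrite nth_nseq if_same|lia].
have c2 k l : k <= n -> l <= n -> commute_congr (word12 k) (word12 l).
  by move=> kn ln; case: (leqP k l) => h; [exact: comm_col_col|apply: comm_sym; apply: comm_col_col; lia].
(* Both orders are congruent to 12...(n-1), one by [spin_col] and the other by [spin_spin]. *)
have c3 : t = TD -> commute_congr (Spin0 n) (Spin1 n).
  move=> tD; apply: cg_trans (cg_sym (spin_spin tD)).
  by have := spin_col (leq_pred n); rewrite (_ : n - n.-1 = 1) //; lia.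
by case/fundP=> [->|[tD ->]|[li ->]]; case/fundP=> [->|[tD' ->]|[lj ->]] //;
  try (apply: comm_sym; first [apply: c0; lia|apply: c1; lia|by apply: c3]);
  first [apply: c0; lia|apply: c1; lia|by apply: c3|apply: c2; lia].
Qed.

Definition fprod (P : seq nat) : word := flatten (map fund P).
Definition inrange (P : seq nat) := all (fun i => 0 < i <= n) P.

Lemma fprod_cat P Q : fprod (P ++ Q) = fprod P ++ fprod Q.
Proof. by rewrite /fprod map_cat flatten_cat. Qed.

Lemma comm_fprod i P : 0 < i <= n -> inrange P -> commute_congr (fund i) (fprod P).
Proof.
move=> li; elim: P => [_|j P IH /andP[lj lP]]; first by rewrite /commute_congr /= cats0; exact: cg_refl.
by rewrite -[j :: P]cat1s fprod_cat; apply: comm_cat; [rewrite /fprod /= cats0; apply: comm_fund|apply: IH].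
Qed.

Lemma fprod_perm P Q : inrange P -> perm_eq P Q -> fprod P ≈ fprod Q.
Proof.
elim: P Q => [|i P IH] Q.
  by move=> _; rewrite perm_sym => /perm_nilP ->; exact: cg_refl.
case/andP=> li lP pq; have iQ : i \in Q by rewrite -(perm_mem pq) mem_head.
have := pq; case/splitPr: iQ => Q1 Q2 {}pq.
have pq' : perm_eq P (Q1 ++ Q2).
  by rewrite -(perm_cons i); apply: perm_trans pq _; rewrite -cat1s perm_catCA.
have : inrange (Q1 ++ Q2) by rewrite /inrange -(perm_all _ pq').
rewrite /inrange all_cat => /andP[l1 l2].
rewrite -[i :: P]cat1s fprod_cat; apply: cg_trans (congr_catl _ (IH _ lP pq')) _.
rewrite -[i :: Q2]cat1s !fprod_cat !catA; apply: congr_catr; rewrite [fprod [:: i]]/fprod /= !cats0.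
exact: comm_fprod.
Qed.

(** The weight of 12...k as a sum of fundamental weights: twice the n-th one for k = n, and the sum
    of the last two for k = n-1 in type D. *)
Definition colidx (k : nat) : seq nat :=
  if k == 0 then [::] else if k == n then [:: n; n]
  else if t is TD then (if k == n.-1 then [:: n.-1; n] else [:: k]) else [:: k].

Lemma inrange_colidx k : k <= n -> inrange (colidx k).
Proof.
move=> kn; rewrite /colidx; case: eqP => // k0; case: eqP => kn' /=; first by lia.
by case: (t); [|case: eqP] => //=; lia.
Qed.

Lemma fprod_colidx k : k <= n -> fprod (colidx k) ≈ word12 k.
Proof.
move=> kn; rewrite /colidx; case: eqP => [->|k0]; first exact: cg_refl.
case: eqP => [->|kn'].
  by rewrite /fprod /= /fund eqxx /=; have := spin_col (leqnn n); rewrite subnn cats0.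
have gen : t = TB \/ k <> n.-1 -> fprod [:: k] ≈ word12 k.
  rewrite /fprod /= cats0 /fund (introF eqP kn') => -[->|/eqP/negbTE ->]; first exact: cg_refl.
  by case: (t); exact: cg_refl.
move: gen spin_spin; rewrite /fprod /fund; case: (t) => gen ss; first by apply: gen; left.
case: eqP gen => [->|kn1] gen; last by apply: gen; right.
by rewrite /= ifF ?eqxx ?cats0; [exact: ss|apply/eqP; lia].
Qed.

(** With 12...(k+1) written as two spin columns, the second one absorbs the barred letter. *)
Lemma col_neg k : k < n -> word12 k.+1 ++ [:: V (Neg k.+1)] ≈ word12 k.
Proof.
move=> kn; apply: cg_trans (congr_catr _ (cg_sym (spin_col kn))) _.
apply: cg_trans (spin_col (ltnW kn)); rewrite -[_ ++ _]/(Spin0 n ++ [:: S _; V (Neg k.+1)]).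
rewrite -[X in _ ≈ X]/(Spin0 n ++ [:: S _]); apply: congr_catl.
have -> : nseq (n - k) true = true :: nseq (n - k.+1) true by rewrite -[n - k]prednK ?subn_gt0 //= subnS.
have -> : nseq k.+1 false = nseq k false ++ [:: false] by rewrite -[k.+1]addn1 nseqD.
rewrite -catA; apply: spin_neg; rewrite size_nseq; lia.
Qed.

Definition simple (g : gletter) : bool := valid_g t n g && (if g is S C then C == nseq n false else true).

(** Reading one letter g consumes the fundamental words counted by eps_i(g) and leaves those counted
    by phi_i(g). The multiplicities must be exact, since a highest weight prefix provides no more
    than eps_i(g) of them for certain. *)
Lemma step_simple g : simple g -> exists P Q, [/\ inrange P, inrange Q,
  forall i, 0 < i <= n -> count_mem i P = epsG t n i g /\ count_mem i Q = phiG t n i g &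
  fprod P ++ [:: g] ≈ fprod Q].
Proof.
case: g => [x|C] /andP[vx]; last first.
  move=> /eqP ->; exists [::], [:: n]; split => //.
  - by rewrite /inrange /=; lia.
  - move=> i li; rewrite phiG_spin ?epsG_spin ?size_nseq // /eS /fS !nth_nseq !if_same /=.
    case: (ltngtP i n) => h; [|lia|]; first by have -> : 0 < i by lia.
    by rewrite andbF; case: (t).
  - by rewrite /fprod /fund /= eqxx; exact: cg_refl.
move=> _.
have cnt i k : 0 < i <= n -> k <= n -> count_mem i (colidx k) =
    if t is TD then ((i == k) && (k < n.-1)) + ((k == n.-1) && (n.-1 <= i)) + ((i == n) && (k == n)).*2
    else (i == k) + ((i == k) && (k == n)).
  move=> li kn; rewrite /colidx; case: eqP => [->|k0] /=; first by case: (t); lia.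
  by case: eqP => [?|kn'] /=; case: (t); repeat (case: eqP => ? /=); lia.
have tbl P Q : (forall i, 0 < i <= n -> count_mem i P = epsL t n i x /\ count_mem i Q = phiL t n i x) ->
   forall i, 0 < i <= n -> count_mem i P = epsG t n i (V x) /\ count_mem i Q = phiG t n i (V x).
  by move=> h i li; rewrite epsG_V // phiG_V //; exact: h.
have up k : 0 < k <= n -> fprod (colidx k.-1) ++ [:: V (Pos k)] ≈ fprod (colidx k).
  move=> lk; apply: cg_trans (cg_sym (fprod_colidx _)); last by lia.
  apply: cg_trans (congr_catr _ (fprod_colidx _)) _; first by lia.
  by rewrite -{2 3}(prednK (proj1 (andP lk))) word12_rcons; exact: cg_refl.
have down k : 0 < k <= n -> fprod (colidx k) ++ [:: V (Neg k)] ≈ fprod (colidx k.-1).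
  move=> lk; apply: cg_trans (cg_sym (fprod_colidx _)); last by lia.
  apply: cg_trans (congr_catr _ (fprod_colidx _)) _; first by lia.
  by rewrite -{1 2}(prednK (proj1 (andP lk))); apply: col_neg; lia.
have fn : fund n = Spin0 n by rewrite /fund eqxx.
have nr : inrange [:: n] by rewrite /inrange /=; lia.
have [tE|tE] : t = TB \/ t = TD by case: (t); [left|right].
  move: vx tbl; rewrite tE /epsL; case: x => [k||k] /= vk tbl.
  - exists (colidx k.-1), (colidx k); split; [apply: inrange_colidx; lia|apply: inrange_colidx; lia| |exact: up].
    by apply: tbl => i li; (rewrite !cnt ?tE /=; [|move: li vk; clear; lia..]); move: (i) li vk n1; clear; lia.
  - exists [:: n], [:: n]; split => //; first by apply: tbl => i li /=; move: (i) li vk n1; clear; lia.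
    by rewrite /fprod /= cats0 fn; apply: spin_zer.
  - exists (colidx k), (colidx k.-1); split; [apply: inrange_colidx; lia|apply: inrange_colidx; lia| |exact: down].
    by apply: tbl => i li; (rewrite !cnt ?tE /=; [|move: li vk; clear; lia..]); move: (i) li vk n1; clear; lia.
have fn1 : fund n.-1 = Spin1 n by rewrite /fund tE eqxx ifF //; apply/eqP; lia.
have nr1 : inrange [:: n.-1] by rewrite /inrange /=; lia.
move: vx tbl; rewrite tE /epsL; case: x => [k||k] //= vk tbl; case: (ltngtP k n) => hk; try lia.
- exists (colidx k.-1), (colidx k); split; [apply: inrange_colidx; lia|apply: inrange_colidx; lia| |exact: up].
  apply: tbl => i li; (rewrite !cnt ?tE /=; [|move: li vk; clear; lia..]).
  move: (i) li vk n1 hk; clear => i li vk n1 hk; split; case: (ltngtP k n.-1) => ?; case: (ltngtP i k) => ?;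
    case: (ltngtP i n) => ? //=; try (exfalso; lia); lia.
(* [up] would consume the factors n-1 and n and leave n twice. For the letter n of type D, eps and
   phi account for one factor each, so the common factor n has to be dropped. *)
- exists [:: n.-1], [:: n]; split => //; first by apply: tbl => i li /=; move: (i) li vk n1 hk; clear; lia.
  by rewrite /fprod /= !cats0 fn fn1 hk; apply: spin_posn.
- exists (colidx k), (colidx k.-1); split; [apply: inrange_colidx; lia|apply: inrange_colidx; lia| |exact: down].
  apply: tbl => i li; (rewrite !cnt ?tE /=; [|move: li vk; clear; lia..]).
  move: (i) li vk n1 hk; clear => i li vk n1 hk; split; case: (ltngtP k n.-1) => ?; case: (ltngtP i k) => ?;
    case: (ltngtP i n) => ? //=; try (exfalso; lia); lia.
- exists [:: n], [:: n.-1]; split => //; first by apply: tbl => i li /=; move: (i) li vk n1 hk; clear; lia.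
  rewrite /fprod /= !cats0 fn fn1 hk; have := @spin_neg n.-1 [::]; rewrite /= prednK; last by lia.
  move=> /(_ erefl); suff -> : nseq n.-1 false ++ [:: false] = nseq n false by [].
  by rewrite -[[:: false]]/(nseq 1 false) -nseqD addn1 prednK //; lia.
Qed.

(** R6 read backwards: each bar of C is a barred letter absorbed by 12...n. The bars are put in from
    the last position to the first, since \bar k is absorbed only while all positions up to k are
    unbarred. *)
Lemma spin_reduce C : size C = n -> exists ks, all (fun k => 0 < k <= n) ks /\
  [:: S C] ≈ Spin0 n ++ [seq V (Neg k) | k <- ks].
Proof.
suff key D k : size D + k = n -> exists ks, all (fun k => 0 < k <= n) ks /\
    [:: S (nseq k false ++ D)] ≈ Spin0 n ++ [seq V (Neg k) | k <- ks].
  by move=> sC; apply: (key C 0); lia.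
elim: D k => [|b D IH] k /= sD; first by exists [::]; rewrite -sD /= cats0; split => //; exact: cg_refl.
have [|ks [h1 h2]] := IH k.+1; first by lia.
have e : nseq k.+1 false ++ D = nseq k false ++ false :: D by rewrite -cat1s catA -[[:: false]]/(nseq 1 false) -nseqD addn1.
case: b; last by exists ks; rewrite -e.
exists (rcons ks k.+1); rewrite all_rcons h1; split; first by lia.
apply: cg_trans (cg_sym (spin_neg _)) _; first by lia.
by rewrite map_rcons -cats1 -cat_cons -e; exact: congr_catr h2.
Qed.

Lemma word_reduce w : valid_word t n w -> exists2 w', all simple w' & w ≈ w'.
Proof.
elim: w => [|g w IH] /=; first by exists [::] => //; exact: cg_refl.
case/andP=> vg /IH[w' sw' c].
have [u su cu] : exists2 u, all simple u & [:: g] ≈ u.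
  case: g vg => [x|C] vx; first by exists [:: V x]; [rewrite /= /simple vx|exact: cg_refl].
  have [ks [h1 h2]] := spin_reduce (eqP vx); exists (Spin0 n ++ [seq V (Neg k) | k <- ks]) => //.
  rewrite all_cat all_map {1}/simple /= /simple /= /valid_spin size_nseq !eqxx /=.
  by apply/allP => k /(allP h1) /= ->.
by exists (u ++ w'); [rewrite all_cat su|rewrite -cat1s; exact: congr_cat].
Qed.

Lemma hw_fprod w : all simple w -> highest t n w -> exists P, [/\ inrange P,
  forall i, 0 < i <= n -> count_mem i P = phiW t n i w & w ≈ fprod P].
Proof.
elim/last_ind: w => [_ _|w g IH]; first by exists [::]; split => //; exact: cg_refl.
rewrite all_rcons -cats1 => /andP[sg sw] hw.
have vw : valid_word t n (w ++ [:: g]).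
  have vg : valid_g t n g by case/andP: sg.
  by rewrite /valid_word all_cat /= vg !andbT; apply: sub_all sw => g1 /andP[].
have [h1 h2] := highest_cat on vw hw.
have [P [lP cP c]] := IH sw h1; have [P1 [Q1 [lP1 lQ1 c1 c2]]] := step_simple sg.
(* The word being highest means eps_i(g) <= phi_i(w). So the factors in [P1] occur in [P] and can be
   commuted to the right end, next to g. *)
have [|P2 sub pm] := (@count_subseqP _ P1 P).1.
  move=> i; case: (boolP (0 < i <= n)) => li.
    by rewrite cP // (c1 i li).1 -epsW1; exact: h2.
  rewrite (_ : count_mem i P1 = 0) //; apply/count_memPn; apply: contraNN li => /(allP lP1) //.
have [P3 pP] := perm_to_subseq sub.
have {}pP : perm_eq P (P3 ++ P1).
  by apply: perm_trans pP _; rewrite perm_catC perm_cat2l perm_sym.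
have lP3 : inrange P3 by move: lP; rewrite /inrange (perm_all _ pP) all_cat => /andP[].
exists (P3 ++ Q1); split; first by rewrite /inrange all_cat; apply/andP.
  move=> i li; have := cP i li; move/permP: pP => ->; have [e1 e2] := c1 i li.
  rewrite !count_cat e1 e2 phiW_cat phiW1 epsW1; have := h2 i li; rewrite epsW1; clear; lia.
apply: cg_trans (congr_catr _ c) _; apply: cg_trans (congr_catr _ (fprod_perm lP pP)) _.
by rewrite !fprod_cat -catA; apply: congr_catl.
Qed.

Lemma hw_fprod_valid w : valid_word t n w -> highest t n w -> exists P, [/\ inrange P,
  forall i, 0 < i <= n -> count_mem i P = phiW t n i w & w ≈ fprod P].
Proof.
move=> vw hw; have [w' sw' c] := word_reduce vw.
have [P [lP cP c']] := hw_fprod sw' (congr_highest on R_valid R_closed c hw).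
exists P; split => //; last exact: cg_trans c c'.
by move=> i li; rewrite cP // (congr_eps_phi on R_valid R_closed li c).2.
Qed.

Lemma hw_congr u v : valid_word t n u -> valid_word t n v -> highest t n u -> highest t n v ->
  (forall i, 0 < i <= n -> phiW t n i u = phiW t n i v) -> u ≈ v.
Proof.
move=> vu vv hu hv e; have [P [lP cP c]] := hw_fprod_valid vu hu; have [Q [lQ cQ d]] := hw_fprod_valid vv hv.
apply: cg_trans c _; apply: cg_trans (cg_sym d); apply: fprod_perm => //.
apply/allP => i _ /=; case: (boolP (0 < i <= n)) => li; first by rewrite cP // cQ // e.
have no X : inrange X -> count_mem i X = 0.
  by move=> lX; apply/count_memPn; apply: contraNN li => /(allP lX).
by rewrite !no.
Qed.

Lemma fe_isV i u v : fW t n i u = Some v \/ eW t n i u = Some v -> map isV v = map isV u.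
Proof.
elim: u v => [|g u IH] v /=; first by case.
case; case: ifP => _.
- by case: g => [x|C] /=; [case: fL|case: fS] => //= a [<-].
- by case E: fW => [a|] //= [<-] /=; rewrite (IH a) //; left.
- by case E: eW => [a|] //= [<-] /=; rewrite (IH a) //; right.
- by case: g => [x|C] /=; [case: eL|case: eS] => //= a [<-].
Qed.

Lemma conn_isV u v : conn t n u v -> map isV v = map isV u.
Proof.
elim=> // [x y [i [_ h]]|x y z _ h1 _ h2]; first exact: fe_isV h.
by rewrite h2.
Qed.

Lemma conn_spin C w : size C = n -> conn t n [:: S C] w ->
  exists C', [/\ w = [:: S C'], size C' = n & t = TD -> odd (nbars C') = odd (nbars C)].
Proof.
move=> sC h; pose Q w := exists C', [/\ w = [:: S C'], size C' = n & t = TD -> odd (nbars C') = odd (nbars C)].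
rewrite -/(Q w); have : Q [:: S C] by exists C.
elim: h => //= [x y [i [li h]] [D [xE sD pD]]|x y z _ h1 _ h2 /h1/h2 //].
have key D' : fS t n i D = Some D' \/ eS t n i D = Some D' -> Q [:: S D'].
  move=> h'; exists D'; split => //.
    by case: h' => h'; [have [] := fS_props on sD li h'|have [] := eS_props on sD li h'].
  by move=> tD; rewrite -pD //; rewrite tD in h'; exact: (nbars_parity n1 sD li h').
move: h; rewrite {}xE /=; case.
  case: ifP => // _; by case E: fS => [D'|] //= [<-]; apply: key; left.
by case E: eS => [D'|] //= [<-]; apply: key; right.
Qed.

Lemma psum_nbars p C : p <= size C -> (psum p [:: S C] = p%:Z - (nbars (take p C))%:Z - (nbars (take p C))%:Z)%R.
Proof.
elim: p => [|p IH] hp; first by rewrite take0.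
rewrite /= IH; last by lia.
rewrite (take_nth false) // /nbars -cats1 count_cat /= /wt2S; case: ifP; lia.
Qed.

Lemma psum_congr p u v : p <= n -> valid_word t n u -> u ≈ v -> psum p u = psum p v.
Proof.
move=> pn vu c; have vv : valid_word t n v by rewrite -(congr_valid R_valid c).
apply: psum_wt pn _; apply: (wt_phi_eps on vu vv) => i li.
exact: (congr_eps_phi on R_valid R_closed li c).
Qed.

(** A spin column has partial sum at most p, and an odd number of bars excludes equality at p = n.
    For 12...i the bound 2 min(i, p) combines two: i letters contribute at most 2 each, and a
    congruent pair of spin columns contributes at most p each. *)
Lemma fund_dom i p v : 0 < i <= n -> p <= n -> conn t n (fund i) v -> (psum p v <= psum p (fund i))%R.
Proof.
move=> li pn; case/fundP: (li) => [->|[tD ->]|[lin ->]] c.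
- have [C' [-> _ _]] := conn_spin (size_nseq n false) c.
  by rewrite psum_zeros psum_spin_le.
- have s1 : size (nseq n.-1 false ++ [:: true]) = n by rewrite size_cat size_nseq /=; lia.
  have [C' [-> sC' /(_ tD) par]] := conn_spin s1 c.
  rewrite /Spin1 !psum_nbars ?s1 ?sC' //.
  case: (ltnP p n) => hp.
    rewrite takel_cat ?size_nseq; last by lia.
    have -> : nbars (take p (nseq n.-1 false)) = 0.
      by rewrite /nbars take_nseq; [rewrite count_nseq mul0n|lia].
    by clear; lia.
  have -> : p = n by apply/eqP; rewrite eqn_leq pn hp.
  rewrite take_oversize ?sC' // take_oversize ?s1 //; move: par; rewrite /nbars count_cat count_nseq mul0n /=.
  by case: (count id C') => [|m] //= _; clear; lia.
have vw : valid_word t n (word12 i).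
  by rewrite /word12 /valid_word all_map; apply/allP => k; rewrite mem_iota /=; lia.
rewrite psum_word12; have b1 : (psum p v <= i%:Z + i%:Z)%R.
  have sz : size v = i by rewrite (size_conn on vw c) size_map size_iota.
  rewrite -[X in (_ <= X%:Z + X%:Z)%R]sz; apply: psum_Vs.
  have -> : all isV v = all id (map isV v) by rewrite all_map.
  by rewrite (conn_isV c) all_map /word12 all_map; apply/allP.
have b2 : (psum p v <= p%:Z + p%:Z)%R.
  have [v' [c' cv]] := congr_conn on R_valid R_closed (cg_sym (spin_col (ltnW lin))) c.
  have vv : valid_word t n v by exact: (valid_conn on vw c).
  rewrite (psum_congr pn vv cv).
  have s1 : size (nseq n false) = n by rewrite size_nseq.
  have s2 : size (nseq i false ++ nseq (n - i) true) = n by rewrite size_cat !size_nseq; lia.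
  have vp : valid_word t n ([:: S (nseq n false)] ++ [:: S (nseq i false ++ nseq (n - i) true)]).
    by rewrite /valid_word /= /valid_spin s1 s2 eqxx.
  have [u1 [u2 [-> d1 d2]]] := conn_cat vp c'.
  have [C1 [-> _ _]] := conn_spin s1 d1; have [C2 [-> _ _]] := conn_spin s2 d2.
  by rewrite psum_cat; have := psum_spin_le p C1; have := psum_spin_le p C2; clear; lia.
by move: b1 b2; clear; lia.
Qed.

Lemma fprod_dom P p v : inrange P -> p <= n -> valid_word t n (fprod P) -> conn t n (fprod P) v ->
  (psum p v <= psum p (fprod P))%R.
Proof.
move=> + pn; elim: P v => [|i P IH] v lP vP c.
  by have := size_conn on vP c => /size0nil ->.
case/andP: lP => li lP; rewrite -[i :: P]cat1s fprod_cat in vP c *.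
have [u1 [u2 [-> c1 c2]]] := conn_cat vP c.
move: vP; rewrite /valid_word all_cat => /andP[_ vP]; have := IH _ lP vP c2.
move: c1; rewrite /fprod /= cats0 => /(fund_dom li pn); rewrite !psum_cat; clear; lia.
Qed.

(** The congruence preserves weights and carries paths along, so the bound for products of
    fundamental words passes to all highest weight words. *)
Lemma hw_dom u v p : valid_word t n u -> highest t n u -> conn t n u v -> p <= n -> (psum p v <= psum p u)%R.
Proof.
move=> vu hu c pn; have [P [lP _ cP]] := hw_fprod_valid vu hu.
have [v' [c' cv]] := congr_conn on R_valid R_closed cP c.
rewrite (psum_congr pn (valid_conn on vu c) cv) (psum_congr pn vu cP).
by apply: fprod_dom => //; rewrite -(congr_valid R_valid cP).
Qed.

(* Dominance in both directions equates the weights of u and v; the last letters are then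
   determined by their weights, the prefixes by induction. *)
Lemma hw_uniq u v : valid_word t n u -> highest t n u -> highest t n v -> conn t n u v -> u = v.
Proof.
elim/last_ind: u v => [|u g IH] v vu hu hv c.
  by have := size_conn on vu c => /esym/eqP; rewrite eq_sym => /nilP ->.
have vv := valid_conn on vu c; have c' := conn_sym on vu c.
have wt : forall j, 0 < j <= n -> wtW (rcons u g) j = wtW v j.
  apply: wt_psum => p pn; apply/eqP; rewrite Order.POrderTheory.eq_le.
  by rewrite (hw_dom vu hu c pn) (hw_dom vv hv c' pn).
move: vu hu c wt {c'}; rewrite -cats1 => vu hu c wt.
have [v1 [v2 [vE c1 c2]]] := conn_cat vu c; move: (vu); rewrite /valid_word all_cat => /andP[vu1 vg].
have := size_conn on vg c2; case: v2 vE c2 => [|g' [|]] // vE c2 _.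
rewrite vE in vv hv wt *; have [h1 _] := highest_cat on vu hu; have [h2 _] := highest_cat on vv hv.
have uv := IH v1 vu1 h1 h2 c1; rewrite -uv in wt *; congr (_ ++ [:: _]).
move: vv; rewrite /valid_word all_cat => /andP[_ /= /andP[vg' _]]; move: vg => /= /andP[vg _].
apply: (wt2G_inj on vg vg') => j lj; have := wt j lj; rewrite !wtW_cat /=; clear; lia.
Qed.

Theorem sim_iff_congr u v : valid_word t n u -> valid_word t n v -> (sim t n u v <-> u ≈ v).
Proof.
move=> vu vv; split; first exact: (sim_congr on R_valid R_closed hw_congr hw_uniq vu vv).
exact: (congr_sim on R_valid R_closed hw_uniq vu vv).
Qed.
End Completeness.

(** * The required instances of R6 and R7, and the theorem for both types *)

Lemma spin_ins_neg t k D :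
  spin_ins t (nseq k false ++ false :: D) (Some (Neg k.+1)) = (None, nseq k false ++ true :: D).
Proof. by elim: k => //= k ->. Qed.

(** A letter that already stands in the column is the least one above itself, so it bumps out its
    own copy. *)
Lemma spin_ins_pos t C k : k < size C -> nth false C k = false ->
  spin_ins t C (Some (Pos k.+1)) = (Some (Pos k.+1), C).
Proof.
elim: C k => // b C IH [|k] /=; first by move=> _ ->.
by move=> kn h; rewrite IH.
Qed.

Lemma spin_ins_zer m : spin_ins TB (nseq m false) (Some Zer) = (None, nseq m false).
Proof. by elim: m => //= m ->. Qed.

Lemma spin_ins_posn m : spin_ins TD (nseq m false ++ [:: true]) (Some (Pos m.+1)) = (None, nseq m.+1 false).
Proof. by elim: m => //= m ->. Qed.

Lemma spin_relE t n C x y D : size C = n -> valid_letter t n x -> spin_ins t C (Some x) = (y, D) ->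
  spin_rel t n [:: S C; V x] (ins_out (y, D)).
Proof. by move=> sC vx e; exists C, x; split => //=; rewrite e. Qed.

Theorem mainTheorem18 (n : nat) (hn : 2 <= n) :
  (forall w1 w2 : word, valid_word TB n w1 -> valid_word TB n w2 ->
     (sim TB n w1 w2 <-> congr (relB n) w1 w2)) /\
  (forall w1 w2 : word, valid_word TD n w1 -> valid_word TD n w2 ->
     (sim TD n w1 w2 <-> congr (relD n) w1 w2)).
Proof.
have n0 : 0 < n := ltnW hn.
have snn : size (nseq n false) = n by rewrite size_nseq.
have sz k D : size D + k.+1 = n -> size (nseq k false ++ false :: D) = n by rewrite size_cat size_nseq /=; lia.
have n1 : n.-1.+1 = n by rewrite prednK.
split=> u v.
  have spin a b : spin_rel TB n a b -> congr (relB n) a b.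
    by move=> h; apply: congr_base; exact: (@spin_rel_rel TB n a b n0 h).
  apply: (sim_iff_congr hn (@relB_valid n n0) (@relB_closed n n0)) => //.
  - move=> k D s; apply: spin; apply: (spin_relE (sz k D s) _ (spin_ins_neg TB k D)) => /=; lia.
  - move=> C k sC kn h; apply: spin; apply: (spin_relE sC _ (spin_ins_pos TB _ h)); [by rewrite /=; lia|by rewrite sC].
  - by move=> k kn; apply: congr_base; exact: relB_pair.
  - by move=> _; apply: spin; apply: (spin_relE snn _ (spin_ins_zer n)).
have spin a b : spin_rel TD n a b -> congr (relD n) a b.
  by move=> h; apply: congr_base; exact: (@spin_rel_rel TD n a b hn h).
have pair b k y : k < n -> k = n.-1 \/ y = ~~ b -> congr (relD n) (hwpair n b k y)
    (word12 k ++ (if b == y then [:: V (if b then Neg n else Pos n)] else [::])).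
  by move=> kn h; apply: congr_base; exact: relD_pair.
have w12 : word12 n = word12 n.-1 ++ [:: V (Pos n)] by rewrite -{1}n1 word12_rcons n1.
have zeros m : nseq m false ++ [:: false] = nseq m.+1 false by rewrite -[[:: false]]/(nseq 1 false) -nseqD addn1.
apply: (sim_iff_congr hn (@relD_valid n hn) (@relD_closed n hn)) => //.
- move=> k D s; apply: spin; apply: (spin_relE (sz k D s) _ (spin_ins_neg TD k D)) => /=; lia.
- move=> C k sC kn h; apply: spin; apply: (spin_relE sC _ (spin_ins_pos TD _ h)); [by rewrite /=; lia|by rewrite sC].
(* The last bit of the second column differs: k = n needs y = false and adds the letter n to
   12...(n-1), whereas k < n needs y = true. *)
- move=> k; rewrite leq_eqVlt => /orP[/eqP ->|kn].
    have := pair false n.-1 false ltac:(lia) (or_introl erefl).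
    by rewrite /hwpair subnn eqxx /= !zeros n1 subnn cats0 w12.
  have := pair false k true kn (or_intror erefl); rewrite /hwpair /= zeros n1 cats0.
  have -> // : nseq (n.-1 - k) true ++ [:: true] = nseq (n - k) true.
  by rewrite -[[:: true]]/(nseq 1 true) -nseqD; congr nseq; lia.
- move=> _; apply: spin; have := @spin_relE TD n (nseq n.-1 false ++ [:: true]) (Pos n) None (nseq n false).
  apply; [by rewrite size_cat size_nseq addn1|by rewrite /= n0 leqnn|].
  by rewrite -{2}n1 spin_ins_posn n1.
- move=> _; have := pair true n.-1 false ltac:(lia) (or_introl erefl).
  by rewrite /hwpair subnn /= !zeros n1 cats0.
Qed.
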